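(* Let $p_k$, $k=0,\dots,K$, be the solution to the recursion $$p_k(t,x,y_{0:k})=p_k(t_{k,0},x,y_{0:k})+\int_{t_{k,0}}^t (A_b+F_b)\,p_k(s,x,y_{0:k})\,\mathrm ds,\quad t\in(t_{k,0},t_{k+1,0}],\ k=0,\dots,K-1,$$ $$p_0(0,x,y_0)=q_0(x)L(y_0,x),\qquad p_k(t_{k,0},x,y_{0:k})=p_{k-1}(t_{k,0},x,y_{0:k-1})L(y_k,x),\quad k=1,\dots,K,$$ and let $\widetilde\pi_{k,n}$, $(k,n)\in\mathcal I_{K,N}$, be the solution to the recursive optimization problems $$(\widetilde\pi_{k,n+1}(x,y))_{(x,y)\in\mathbb R^d\times\mathrm{supp}(\mathbb P_Y)}=\mathop{\mathrm{arg\,min}}_{u\in L^\infty(\mathrm{supp}(\mathbb P_Y);C(\mathbb R^d;\mathbb R))}\mathbb E\Big[\big|u(Z_{N-(n+1)},Y_{0:k})-(G_b\widetilde\pi_{k,n})(Z_{N-n},Y_{0:k})\big|^2\Big],$$ for $k=0,\dots,K-1$, $n=0,\dots,N-1$, with $$\widetilde\pi_{0,0}(x,y_0)=q_0(x)L(y_0,x),\qquad \widetilde\pi_{k,0}(x,y_{0:k})=\widetilde\pi_{k-1,N}(x,y_{0:k-1})L(y_k,x),\quad k=1,\dots,K.$$ Suppose that $b$ is given by $b_i=-\mu_i+\sum_{j=1}^d\frac{\partial a_{ij}}{\partial x_j}$, $i=1,\dots,d$. Then there exists a constant $C=C(T,\mu,\sigma,L,K)>0$ (independent of $N$) such that, whenever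 $\tau:=\frac{T}{KN}\le1$, $$\sup_{(k,n)\in\mathcal I_{K,N}}\big\|p_k(t_{k,n})-\widetilde\pi_{k,n}\big\|_{L^\infty(\mathrm{supp}(\mathbb P_Y);L^\infty(\mathbb R^d;\mathbb R))}\le C\tau.$$
   Context: Setting. $T>0$; $d,d',K\ge1$ are integers; $N\ge1$ is an integer ($K$ is fixed, $N$ varies); $\mathbb Y:=\mathbb R^{d'\times(K+1)}$; for $y=(y_0,\dots,y_K)\in\mathbb Y$, $y_{0:k}:=(y_0,\dots,y_k)$. $\tau=\frac{T}{KN}$, $t_{k,n}:=\frac{kT}{K}+n\tau$, so the observation times are $t_{k,0}=kT/K$, $k=0,\dots,K$, and $t_{k,N}=t_{k+1,0}$; moreover $t_n:=t_{0,n}=n\tau$, $n=0,\dots,N$. Index set $\mathcal I_{K,N}:=(\{0,\dots,K-1\}\times\{0,\dots,N\})\cup(\{K\}\times\{0\})$. The function $p_K$ is only defined at the final time $t_{K,0}=T$, through the update formula. $C_{\mathrm b}^\infty$ denotes infinitely differentiable functions that are bounded together with all their derivatives. Standing assumptions. (i) $\mu\in C_{\mathrm b}^\infty(\mathbb R^d;\mathbb R^d)$, $\sigma\in C_{\mathrm b}^\infty(\mathbb R^d;\mathbb R^{d\times d})$, the initial probability density $q_0\in C_{\mathrm b}^\infty(\mathbb R^d;\mathbb R)$, and the measurement likelihood $L\in C_{\mathrm b}^\infty(\mathbb R^{d'}\times\mathbb R^d;\mathbb R)$ (with $L(y,x)=g(y\mid x)$ a conditional observation density). (ii) Parabolic Hörmander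 condition: let $V_i=\sigma_i$ ($i$-th column of $\sigma$), $i=1,\dots,d$, and $V_0=\mu+\frac12\sum_{j=1}^d \mathrm DV_j\,V_j$, where $\mathrm DV$ is the Jacobi matrix; with $[V,W]=\mathrm DW\,V-\mathrm DV\,W$, for every $x\in\mathbb R^d$ the vectors $V_{j_0}(x)$, $[V_{j_1},V_{j_2}](x)$, $[[V_{j_1},V_{j_2}],V_{j_3}](x),\dots$ with $j_0\in\{1,\dots,d\}$ and $j_i\in\{0,\dots,d\}$ for $i\ge1$ span $\mathbb R^d$. Operators. $a:=\sigma\sigma^\top$. $A_b\varphi=\frac12\sum_{i,j}a_{ij}\frac{\partial^2\varphi}{\partial x_i\partial x_j}+\sum_i b_i\frac{\partial\varphi}{\partial x_i}$, $$F_b\varphi=\sum_{i}\Big(\sum_j\frac{\partial a_{ij}}{\partial x_j}\Big)\frac{\partial\varphi}{\partial x_i}+\frac12\sum_{i,j}\frac{\partial^2a_{ij}}{\partial x_i\partial x_j}\varphi-\sum_i\frac{\partial\mu_i}{\partial x_i}\varphi-\sum_i\mu_i\frac{\partial\varphi}{\partial x_i}-\sum_i b_i\frac{\partial\varphi}{\partial x_i},$$ so that $A_b+F_b=A^*$, where $A^*\varphi=\frac12\sum_{i,j}\frac{\partial^2}{\partial x_i\partial x_j}(a_{ij}\varphi)-\sum_i\frac{\partial}{\partial x_i}(\mu_i\varphi)$. $G_b\varphi:=\varphi+\tau F_b\varphi$. All operators act in the variable $x$. Random objects. $W$ is a $d$-dimensional Brownian motion on a filtered probability space $(\Omega,\mathcal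 A,(\mathcal F_t)_{t\in[0,T]},\mathbb P)$. $Z$ is the Euler–Maruyama scheme $Z_{n+1}=Z_n+b(Z_n)\tau+\sigma(Z_n)(W_{t_{n+1}}-W_{t_n})$, $n=0,\dots,N-1$, with $Z_0\sim\widetilde q_0$, where $\widetilde q_0$ is a probability density with finite moments. $Y\in L^\infty(\Omega;\mathbb Y)$ is a random variable with distribution $\mathbb P_Y$; the expectation in the optimization problems is with respect to the product measure $\mathbb P_Z\times\mathbb P_Y$, i.e. $Y$ is independent of $Z$. Function spaces and norms. $L^\infty(\mathrm{supp}(\mathbb P_Y);U)$ is the space of (equivalence classes of) strongly measurable essentially bounded $U$-valued functions on $\mathrm{supp}(\mathbb P_Y)\subset\mathbb Y$; $C(\mathbb R^d;\mathbb R)$ is the space of continuous functions, measured in the supremum norm. $\|f\|_{L^\infty(\mathrm{supp}(\mathbb P_Y);L^\infty(\mathbb R^d;\mathbb R))}=\sup_{y\in\mathrm{supp}(\mathbb P_Y)}\sup_{x\in\mathbb R^d}|f(x,y)|$ with sup meaning essential supremum; $p_k(t_{k,n})$ and $\widetilde\pi_{k,n}$ are viewed as functions of $(x,y)$ through $y_{0:k}$.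
   Formalization: The constant C may also depend on the initial density q_0 (uniformity in q_0 is false: concentrating q_0 gives one-step errors of order √τ); the arg min is required to be unique up to P_Y-null sets, and p_k is the bounded solution that is C² in x. *)

(* Defs.v *)
From HB Require Import structures.
From mathcomp Require Import all_boot all_order all_algebra.
From mathcomp Require Import all_classical all_reals all_analysis.
From mathcomp Require Import ess_sup_inf.

Set Implicit Arguments.
Unset Strict Implicit.
Unset Printing Implicit Defensive.

Import Order.TTheory GRing.Theory Num.Theory.
Import numFieldNormedType.Exports.

Local Open Scope classical_set_scope.
Local Open Scope ring_scope.

(* Real matrices carry the sigma-algebra generated by their entries, that is,
   the Borel sigma-algebra (compare the library's instance on tuples). *)

Definition measure_matrix_display : measure_display -> measure_display.
Proof. exact. Qed.

Section measurable_matrix.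
Context {R : realType} (m n : nat).

Definition entry_sets : set (set 'M[R]_(m, n)) :=
  \bigcup_(ij in [set: 'I_m * 'I_n])
    preimage_set_system setT (fun M : 'M[R]_(m, n) => M ij.1 ij.2) measurable.

Let mx_set0 : <<s entry_sets >> set0.
Proof. exact: sigma_algebra0. Qed.

Let mx_setC A : <<s entry_sets >> A -> <<s entry_sets >> (~` A).
Proof. exact: sigma_algebraC. Qed.

Let mx_bigcup (F : _^nat) : (forall i, <<s entry_sets >> (F i)) ->
  <<s entry_sets >> (\bigcup_i (F i)).
Proof. exact: sigma_algebra_bigcup. Qed.

HB.instance Definition _ :=
  @isMeasurable.Build (measure_matrix_display default_measure_display)
    'M[R]_(m, n) <<s entry_sets >> mx_set0 mx_setC mx_bigcup.

Lemma measurable_entry (i : 'I_m) (j : 'I_n) :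
  measurable_fun [set: 'M[R]_(m, n)] (fun M : 'M[R]_(m, n) => M i j).
Proof.
move=> _ Y mY; rewrite setTI; apply: sub_sigma_algebra.
by exists (i, j) => //; exists Y => //=; rewrite setTI.
Qed.

Lemma measurable_fun_mx d (T : measurableType d) (f : T -> 'M[R]_(m, n)) :
  (forall i j, measurable_fun [set: T] (fun t => f t i j)) ->
  measurable_fun [set: T] f.
Proof.
move=> mf; apply: (@measurability _ _ _ _ _ _ entry_sets) => //.
move=> _ [A [[i j] _ [B mB <-]] <-].
by have := mf i j measurableT B mB; rewrite !setTI.
Qed.

End measurable_matrix.

Section lebesgue_step.
Local Open Scope ereal_scope.
Context {R : realType} (n : nat).

Definition cV_cons (z : R * 'cV[R]_n) : 'cV[R]_n.+1 :=
  \col_i if unlift ord0 i is Some j then z.2 j ord0 else z.1.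

Definition cV_uncons (v : 'cV[R]_n.+1) : R * 'cV[R]_n :=
  (v ord0 ord0, \col_i v (lift ord0 i) ord0).

Lemma cV_consK : cancel cV_cons cV_uncons.
Proof.
move=> [a v]; rewrite /cV_uncons; congr pair; first by rewrite mxE unlift_none.
by apply/colP => i; rewrite !mxE liftK.
Qed.

Lemma measurable_cV_cons : measurable_fun [set: R * 'cV[R]_n] cV_cons.
Proof.
apply: measurable_fun_mx => i j.
rewrite (_ : (fun t => _) = (fun t : R * 'cV[R]_n =>
    if unlift ord0 i is Some k then t.2 k ord0 else t.1)); last first.
  by apply/funext => t; rewrite mxE.
case: (unlift ord0 i) => [k|]; last exact: measurable_fst.
exact: (measurableT_comp (measurable_entry k ord0) measurable_snd).
Qed.

Lemma measurable_cV_uncons : measurable_fun [set: 'cV[R]_n.+1] cV_uncons.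
Proof.
apply/measurable_fun_pairP; split; first exact: measurable_entry.
apply: measurable_fun_mx => i j.
rewrite (_ : (fun t => _) = (fun v : 'cV[R]_n.+1 => v (lift ord0 i) ord0)).
  exact: measurable_entry.
by apply/funext => v; rewrite /= mxE.
Qed.

Variable m : {sigma_finite_measure set 'cV[R]_n -> \bar R}.

Definition lebesgue_step : set 'cV[R]_n.+1 -> \bar R :=
  pushforward (lebesgue_measure \x m) cV_cons.

Let step0 : lebesgue_step set0 = 0.
Proof. by rewrite /lebesgue_step /pushforward preimage_set0 measure0. Qed.

Let step_ge0 A : 0 <= lebesgue_step A.
Proof. by rewrite /lebesgue_step /pushforward; exact: measure_ge0. Qed.

Let step_sigma_additive : semi_sigma_additive lebesgue_step.
Proof.
exact: (@measure_semi_sigma_additive _ _ _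
  (measure_function_pushforward__canonical__measure_function_Measure
     (lebesgue_measure \x m) measurable_cV_cons)).
Qed.

HB.instance Definition _ := isMeasure.Build _ _ _ lebesgue_step
  step0 step_ge0 step_sigma_additive.

Let step_sigma_finite : sigma_finite [set: 'cV[R]_n.+1] lebesgue_step.
Proof.
have /sigma_finiteP[F [FT ndF mF]] := sigma_finiteT (@lebesgue_measure R).
have /sigma_finiteP[G [GT ndG mG]] := sigma_finiteT m.
exists (fun i => cV_uncons @^-1` (F i `*` G i)).
  apply/seteqP; split => // v _.
  have [i _ Fi] : (\bigcup_i F i) (cV_uncons v).1 by rewrite -FT.
  have [j _ Gj] : (\bigcup_j G j) (cV_uncons v).2 by rewrite -GT.
  exists (maxn i j) => //; split.
    by move: Fi; exact/subsetPset/ndF/leq_maxl.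
  by move: Gj; exact/subsetPset/ndG/leq_maxr.
move=> i; have [mFi Fi] := mF i; have [mGi Gi] := mG i; split.
  rewrite -[X in measurable X]setTI; apply: measurable_cV_uncons => //.
  exact: measurableX.
rewrite /lebesgue_step /pushforward -comp_preimage.
rewrite (_ : cV_uncons \o cV_cons = id).
  rewrite preimage_id product_measure1E// lte_mul_pinfty// ge0_fin_numE//.
by apply/funext => z /=; rewrite cV_consK.
Qed.

HB.instance Definition _ := Measure_isSigmaFinite.Build _ _ _ lebesgue_step
  step_sigma_finite.

End lebesgue_step.

(* The d-fold product of the Lebesgue measure of the line. *)
Fixpoint lebesgue_cV {R : realType} (n : nat) :
    {sigma_finite_measure set 'cV[R]_n -> \bar R} :=
  match n with
  | 0 => dirac (0 : 'cV[R]_0)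
  | n'.+1 => lebesgue_step (lebesgue_cV n')
  end.

Section calculus.
Context {R : realType}.

Definition partial n (i : 'I_n) (f : 'cV[R]_n -> R) : 'cV[R]_n -> R :=
  fun x => 'D_(delta_mx i ord0) f x.

(* [:: i1; ..; ir] |-> d/dx_i1 (.. (d/dx_ir f)) *)
Definition iter_partial n (s : seq 'I_n) (f : 'cV[R]_n -> R) :
    'cV[R]_n -> R :=
  foldr (@partial n) f s.

Definition Cb_infty n (f : 'cV[R]_n -> R) : Prop :=
  forall s : seq 'I_n,
    (forall x, differentiable (iter_partial s f) x) /\
    (exists M : R, forall x, `|iter_partial s f x| <= M).

Definition Cb_infty_mx n m k (f : 'cV[R]_n -> 'M[R]_(m, k)) : Prop :=
  forall i j, Cb_infty (fun x => f x i j).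

Definition jacobi_mx n (V : 'cV[R]_n -> 'cV[R]_n) (x : 'cV[R]_n) : 'M[R]_n :=
  \matrix_(i, j) partial j (fun z => V z i ord0) x.

Definition lie_bracket n (V W : 'cV[R]_n -> 'cV[R]_n) :
    'cV[R]_n -> 'cV[R]_n :=
  fun x => jacobi_mx W x *m V x - jacobi_mx V x *m W x.

End calculus.

Section hoermander.
Context {R : realType} (d : nat).
Variables (mu : 'cV[R]_d -> 'cV[R]_d) (sigma : 'cV[R]_d -> 'M[R]_d).

Definition diffusion_field (j : 'I_d) : 'cV[R]_d -> 'cV[R]_d :=
  fun x => col j (sigma x).

Definition drift_field : 'cV[R]_d -> 'cV[R]_d :=
  fun x => mu x + 2^-1 *: \sum_(j < d)
    jacobi_mx (diffusion_field j) x *m diffusion_field j x.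

(* V_0 is the drift field; V_j, for 1 <= j <= d, is the j-th column of sigma *)
Definition hoermander_field (j : 'I_d.+1) : 'cV[R]_d -> 'cV[R]_d :=
  if unlift ord0 j is Some j' then diffusion_field j' else drift_field.

(* [..[[V_j1, V_j2], V_j3].., V_jr] for s = [:: j2; ..; jr] *)
Definition iter_bracket (j1 : 'I_d.+1) (s : seq 'I_d.+1) :
    'cV[R]_d -> 'cV[R]_d :=
  foldl (fun X j => lie_bracket X (hoermander_field j))
        (hoermander_field j1) s.

Definition hoermander_vectors (x : 'cV[R]_d) : set 'cV[R]_d :=
  [set v | (exists j0 : 'I_d, v = diffusion_field j0 x) \/
           (exists j1 s, s != [::] /\ v = iter_bracket j1 s x)].

Definition parabolic_hoermander : Prop :=
  forall x, exists vs : seq 'cV[R]_d,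
    (forall v, v \in vs -> hoermander_vectors x v) /\ (<<vs>> = fullv)%VS.

End hoermander.

Section operators.
Context {R : realType} (d : nat).
Variables (mu : 'cV[R]_d -> 'cV[R]_d) (sigma : 'cV[R]_d -> 'M[R]_d).
Variable b : 'cV[R]_d -> 'cV[R]_d.

Definition diffusion_mx (x : 'cV[R]_d) : 'M[R]_d := sigma x *m (sigma x)^T.

Definition diffusion_coef (i j : 'I_d) : 'cV[R]_d -> R :=
  fun x => diffusion_mx x i j.

Local Notation a := diffusion_coef.

Definition op_A (phi : 'cV[R]_d -> R) : 'cV[R]_d -> R := fun x =>
  2^-1 * (\sum_(i < d) \sum_(j < d) a i j x * partial i (partial j phi) x) +
  \sum_(i < d) b x i ord0 * partial i phi x.

Definition op_F (phi : 'cV[R]_d -> R) : 'cV[R]_d -> R := fun x =>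
  \sum_(i < d) (\sum_(j < d) partial j (a i j) x) * partial i phi x +
  2^-1 * (\sum_(i < d) \sum_(j < d) partial i (partial j (a i j)) x * phi x) -
  \sum_(i < d) partial i (fun z => mu z i ord0) x * phi x -
  \sum_(i < d) mu x i ord0 * partial i phi x -
  \sum_(i < d) b x i ord0 * partial i phi x.

Definition op_G (tau : R) (phi : 'cV[R]_d -> R) : 'cV[R]_d -> R := fun x =>
  phi x + tau * op_F phi x.

End operators.

Section grid.
Context {R : realType}.

Definition time_step (T : R) (K N : nat) : R := T / (K * N)%:R.

Definition obs_time (T : R) (K k : nat) : R := k%:R * T / K%:R.

Definition grid_time (T : R) (K N k n : nat) : R :=
  obs_time T K k + n%:R * time_step T K N.

Definition grid_index (K N : nat) : set (nat * nat) :=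
  [set kn | ((kn.1 < K)%N /\ (kn.2 <= N)%N) \/ kn = (K, 0%N)].

(* y_k and y_{0:k}, for k <= K; the columns of y are y_0, .., y_K *)
Definition obs d' K (k : nat) (y : 'M[R]_(d', K.+1)) : 'cV[R]_d' :=
  col (inord k) y.

Definition obs_upto d' K (k : nat) (y : 'M[R]_(d', K.+1)) : 'M[R]_(d', k.+1) :=
  \matrix_(i < d', j < k.+1) y i (inord j).

End grid.

Section probability.
Context {R : realType}.

Definition is_density n (q : 'cV[R]_n -> R) : Prop :=
  [/\ measurable_fun [set: 'cV[R]_n] q, (forall x, 0 <= q x) &
      (\int[lebesgue_cV n]_x (q x)%:E = 1)%E].

(* `|x| is the library's norm on matrices, the maximum norm *)
Definition finite_moments n (q : 'cV[R]_n -> R) : Prop :=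
  forall r : nat, (\int[lebesgue_cV n]_x (`|x| ^+ r * q x)%:E < +oo)%E.

Definition msupport m n (nu : set 'M[R]_(m, n) -> \bar R) : set 'M[R]_(m, n) :=
  [set y | forall U : set 'M[R]_(m, n), open U -> U y -> (0 < nu U)%E].

Context {dO : measure_display} {Omega : measurableType dO}.
Variable P : probability Omega R.

Definition is_filtration (T : R) (F : R -> set (set Omega)) : Prop :=
  (forall t, 0 <= t <= T ->
     sigma_algebra [set: Omega] (F t) /\ F t `<=` measurable) /\
  (forall s t, 0 <= s -> s <= t -> t <= T -> F s `<=` F t).

Record brownian_motion d (T : R) (F : R -> set (set Omega))
    (W : R -> Omega -> 'cV[R]_d) : Prop := BrownianMotion {
  bm_adapted : forall t, 0 <= t <= T ->
    forall B, measurable B -> F t (W t @^-1` B) ;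
  bm_start : {ae P, forall w, W 0 w = 0} ;
  bm_independent : forall s t, 0 <= s -> s < t -> t <= T ->
    forall A B, F s A -> measurable B ->
    (P (A `&` (fun w => W t w - W s w)%R @^-1` B) =
     P A * P ((fun w => W t w - W s w)%R @^-1` B))%E ;
  bm_gaussian : forall s t, 0 <= s -> s < t -> t <= T ->
    forall B : 'I_d -> set R, (forall i, measurable (B i)) ->
    (P [set w | forall i, B i ((W t w - W s w)%R i ord0)] =
     \prod_(i < d) normal_prob 0 (Num.sqrt (t - s)) (B i))%E ;
  bm_continuous : {ae P, forall w, {within `[0, T], continuous (W ^~ w)}} }.

Record euler_maruyama d (N : nat) (tau : R) (b : 'cV[R]_d -> 'cV[R]_d)
    (sigma : 'cV[R]_d -> 'M[R]_d) (q : 'cV[R]_d -> R)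
    (F : R -> set (set Omega)) (W : R -> Omega -> 'cV[R]_d)
    (Z : nat -> Omega -> 'cV[R]_d) : Prop := EulerMaruyama {
  em_init_adapted : forall B, measurable B -> F 0 (Z 0%N @^-1` B) ;
  em_init_density : forall B, measurable B ->
    (P (Z 0%N @^-1` B) = \int[lebesgue_cV d]_(x in B) (q x)%:E)%E ;
  em_step : forall n, (n < N)%N -> forall w,
    Z n.+1 w = Z n w + tau *: b (Z n w) +
               sigma (Z n w) *m (W (n.+1%:R * tau) w - W (n%:R * tau) w) }.

Definition independent_path d m n (N : nat) (Z : nat -> Omega -> 'cV[R]_d)
    (Y : Omega -> 'M[R]_(m, n)) : Prop :=
  forall (A : nat -> set 'cV[R]_d) (B : set 'M[R]_(m, n)),
    (forall i, measurable (A i)) -> measurable B ->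
    (P ([set w | forall i, (i <= N)%N -> A i (Z i w)] `&` Y @^-1` B) =
     P [set w | forall i, (i <= N)%N -> A i (Z i w)] * P (Y @^-1` B))%E.

End probability.

Section spaces.
Context {R : realType} (d m n : nat).
Variable nu : {measure set 'M[R]_(m, n) -> \bar R}.

(* Simple functions with values in the continuous bounded functions, the
   latter metrized by the supremum norm. *)
Definition simple_Cb (s : 'M[R]_(m, n) -> 'cV[R]_d -> R) : Prop :=
  [/\ finite_set (range s), (forall g, measurable (s @^-1` [set g])) &
      forall y, continuous (s y) /\ exists M, forall x, `|s y x| <= M].

Definition strongly_measurable (u : 'M[R]_(m, n) -> 'cV[R]_d -> R) : Prop :=
  exists2 s : nat -> 'M[R]_(m, n) -> 'cV[R]_d -> R,
    (forall r, simple_Cb (s r)) &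
    {ae nu, forall y, forall e, 0 < e ->
       exists r0, forall r, (r0 <= r)%N -> forall x, `|s r y x - u y x| <= e}.

(* L^oo(supp nu; C(R^d; R)) *)
Definition Linfty_C : set ('M[R]_(m, n) -> 'cV[R]_d -> R) :=
  [set u | [/\ (forall y, msupport nu y -> continuous (u y)),
      strongly_measurable u &
      exists M : R, {ae nu, forall y, forall x, `|u y x| <= M}]].

(* The norm of L^oo(supp nu; L^oo(R^d; R)); msupport nu has full measure. *)
Definition Linfty_norm (f : 'M[R]_(m, n) -> 'cV[R]_d -> R) : \bar R :=
  ess_sup nu (fun y => ess_sup (lebesgue_cV d) (fun x => `|f y x|%:E)).

End spaces.

(* u is the argmin of J over U, as an element of the quotient by eqv: u is a
   minimizer and every minimizer is equivalent to u. *)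
Definition is_argmin {R : realType} (A : Type) (U : set A) (J : A -> \bar R)
    (eqv : A -> A -> Prop) (u : A) : Prop :=
  [/\ U u, (forall v, U v -> (J u <= J v)%E) &
      forall v, U v -> J v = J u -> eqv v u].

Section recursions.
Context {R : realType} (d d' K N : nat) (T : R).
Variables (mu : 'cV[R]_d -> 'cV[R]_d) (sigma : 'cV[R]_d -> 'M[R]_d).
Variables (b : 'cV[R]_d -> 'cV[R]_d).
Variables (q0 : 'cV[R]_d -> R) (L : 'cV[R]_d' -> 'cV[R]_d -> R).

(* Uniqueness for the Cauchy problem requires a growth restriction; the
   solutions considered are bounded and of class C^2 in x, up to the initial
   time. *)
Definition regular_on (I : set R) (f : R -> 'cV[R]_d -> R) : Prop :=
  [/\ exists M : R, forall t x, I t -> `|f t x| <= M,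
      (forall (s : seq 'I_d) t x, (size s <= 1)%N -> I t ->
         differentiable (iter_partial s (f t)) x) &
      (forall s : seq 'I_d, (size s <= 2)%N ->
         {within I `*` [set: 'cV[R]_d],
            continuous (fun z => iter_partial s (f z.1) z.2)})].

Record fokker_planck_recursion (S : set 'M[R]_(d', K.+1))
    (p : forall k, R -> 'cV[R]_d -> 'M[R]_(d', k.+1) -> R) : Prop :=
  FokkerPlanckRecursion {
  fp_init : forall x y, S y ->
    p 0%N 0 x (obs_upto 0%N y) = q0 x * L (obs 0%N y) x ;
  fp_update : forall k x y, (k < K)%N -> S y ->
    p k.+1 (obs_time T K k.+1) x (obs_upto k.+1 y) =
    p k (obs_time T K k.+1) x (obs_upto k y) * L (obs k.+1 y) x ;
  fp_regular : forall k y, (k < K)%N -> S y ->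
    regular_on `[obs_time T K k, obs_time T K k.+1]
               (fun t x => p k t x (obs_upto k y)) ;
  fp_equation : forall k t x y, (k < K)%N -> S y ->
    obs_time T K k < t <= obs_time T K k.+1 ->
    p k t x (obs_upto k y) =
    p k (obs_time T K k) x (obs_upto k y) +
    \int[lebesgue_measure]_(s in `[obs_time T K k, t])
      (op_A sigma b (fun z => p k s z (obs_upto k y)) x +
       op_F mu sigma b (fun z => p k s z (obs_upto k y)) x) }.

Context {dO : measure_display} {Omega : measurableType dO}.
Variables (P : probability Omega R) (Z : nat -> Omega -> 'cV[R]_d).
Variable Y : {RV P >-> 'M[R]_(d', K.+1)}.

(* phi stands for the previous iterate pi_{k,n} *)
Definition splitting_loss (k n : nat)
    (phi u : 'cV[R]_d -> 'M[R]_(d', k.+1) -> R) : \bar R :=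
  'E_P[(fun w => `|u (Z (N - n.+1)%N w) (obs_upto k (Y w)) -
    op_G mu sigma b (time_step T K N)
      (fun x => phi x (obs_upto k (Y w))) (Z (N - n)%N w)| ^+ 2)%R]%E.

Definition splitting_space (k : nat) :
    set ('cV[R]_d -> 'M[R]_(d', k.+1) -> R) :=
  [set u | Linfty_C (distribution P Y) (fun y x => u x (obs_upto k y))].

Definition splitting_eq (k : nat)
    (u v : 'cV[R]_d -> 'M[R]_(d', k.+1) -> R) : Prop :=
  {ae distribution P Y, forall y,
     forall x, u x (obs_upto k y) = v x (obs_upto k y)}.

Record splitting_recursion
    (tpi : forall k, nat -> 'cV[R]_d -> 'M[R]_(d', k.+1) -> R) : Prop :=
  SplittingRecursion {
  ds_init : forall x y, msupport (distribution P Y) y ->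
    tpi 0%N 0%N x (obs_upto 0%N y) = q0 x * L (obs 0%N y) x ;
  ds_update : forall k x y, (k < K)%N -> msupport (distribution P Y) y ->
    tpi k.+1 0%N x (obs_upto k.+1 y) =
    tpi k N x (obs_upto k y) * L (obs k.+1 y) x ;
  ds_step : forall k n, (k < K)%N -> (n < N)%N ->
    is_argmin (@splitting_space k) (@splitting_loss k n (tpi k n))
      (@splitting_eq k) (tpi k n.+1) }.

End recursions.

(* Main.v *)
Require Import Defs.
From HB Require Import structures.
From mathcomp Require Import all_boot all_order all_algebra.
From mathcomp Require Import all_classical all_reals all_analysis.
From mathcomp Require Import ess_sup_inf measurable_realfun ring lra.
Import Order.TTheory GRing.Theory Num.Theory.
Import numFieldNormedType.Exports.

(** For this drift b the operator F_b is multiplication by a potential c.  The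
    mean minimizes the quadratic loss, so that one optimization step applies to
    the previous iterate the transition operator
      S f (x) = E[((1 + tau c) f)(x + tau b(x) + sigma(x) w)],  w ~ N(0, tau I).
    The operator S is stable in the supremum norm with constant 1 + O(tau), and
    by a symmetrized Taylor expansion S g = g + tau (A_b + F_b) g + O(tau^2)
    when the derivatives of g up to order four are bounded.

    Such bounds are obtained without regularity theory for the equation, by
    comparing with a random walk with steps +-r sigma_i in place of p_k: the sum
    of the squares of the partial derivatives of order at most four of its
    iterates grows by a factor 1 + O(r^2) in each step, since the terms of order
    r cancel when both signs are averaged.  The splitting iterates stay within
    O(tau) of the walk, uniformly in r, and by the maximum principle the walk
    converges to p_k as r -> 0. *)

Set Implicit Arguments.
Unset Strict Implicit.
Unset Printing Implicit Defensive.

Local Open Scope classical_set_scope.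
Local Open Scope ring_scope.

(** * Smooth functions and their jets *)

Section smooth_functions.
Context {R : realType}.

(** The solution $p_k$ is only bounded and C^2, and the splitting iterates are only shown to be
    Lipschitz, while a step with error O(tau^2) needs four derivatives bounded uniformly in tau.
    Neither can be inserted into the consistency estimate, so an object with controlled derivatives
    is put between them. A finite average over steps +-r sigma_i can be differentiated term by term,
    and its time step r^2 / d can be made exactly tau / m, so that both chains meet at every grid
    time. The comparison with $p_k$ is qualitative in r, and C^2 regularity is enough for it; since
    the moduli of continuity of $p_k$ are uniform on compact sets only, it uses the weight 1 +
    |x|^2, and r -> 0 is taken at a fixed x. The minimization determines the iterates up to a null
    set of observations. Explicit iterates, built from S and the likelihood, are shown to be
    admissible and of least loss, and the uniqueness contained in the argmin identifies them with
    the given ones. The estimate is then made path by path for the explicit iterates. *)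

Lemma partialE n (f : 'cV[R]_n -> R) x i : differentiable f x ->
  partial i f x = 'd f x (delta_mx i ord0).
Proof. exact: deriveE. Qed.

Lemma cV_sum_delta n (v : 'cV[R]_n) : v = \sum_i v i ord0 *: delta_mx i ord0.
Proof.
rewrite {1}(matrix_sum_delta v); apply: eq_bigr => i _.
by rewrite big_ord1.
Qed.

Lemma diff_partial n (f : 'cV[R]_n -> R) x v : differentiable f x ->
  'd f x v = \sum_i v i ord0 * partial i f x.
Proof.
move=> df; rewrite {1}(cV_sum_delta v) linear_sum; apply: eq_bigr => i _.
by rewrite linearZ partialE.
Qed.

Lemma differentiable_cV n m (phi : 'cV[R]_n -> 'cV[R]_m) x :
  (forall l, differentiable (fun z => phi z l ord0) x) -> differentiable phi x.
Proof.
move=> dphi.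
have -> : phi = \sum_l (fun z => phi z l ord0 *: delta_mx l ord0).
  by apply/funext => z; rewrite fct_sumE -cV_sum_delta.
by apply: differentiable_sum => l; apply: differentiableZl.
Qed.

Lemma differentiable_chain n m (phi : 'cV[R]_n -> 'cV[R]_m) (f : 'cV[R]_m -> R) x :
  (forall l, differentiable (fun z => phi z l ord0) x) ->
  differentiable f (phi x) -> differentiable (fun z => f (phi z)) x.
Proof. by move=> dphi df; apply: differentiable_comp => //; exact: differentiable_cV. Qed.

Lemma partial_chain n m (phi : 'cV[R]_n -> 'cV[R]_m) (f : 'cV[R]_m -> R) x j :
  (forall l, differentiable (fun z => phi z l ord0) x) ->
  differentiable f (phi x) ->
  partial j (fun z => f (phi z)) x =
  \sum_l partial j (fun z => phi z l ord0) x * partial l f (phi x).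
Proof.
move=> dphi df; have dP := differentiable_cV dphi.
rewrite partialE; last exact: differentiable_chain.
rewrite (_ : (fun z => _) = f \o phi)// diff_comp//= diff_partial//.
apply: eq_bigr => l _; congr (_ * _).
rewrite -(deriveE _ dP) derive_mx ?mxE//.
exact: diff_derivable.
Qed.

Lemma partialD n (f g : 'cV[R]_n -> R) j x : differentiable f x ->
  differentiable g x ->
  partial j (fun z => f z + g z) x = partial j f x + partial j g x.
Proof. by move=> df dg; apply: deriveD; exact: diff_derivable. Qed.

Lemma partialM n (f g : 'cV[R]_n -> R) j x : differentiable f x ->
  differentiable g x ->
  partial j (fun z => f z * g z) x = f x * partial j g x + g x * partial j f x.
Proof. by move=> df dg; apply: deriveM; exact: diff_derivable. Qed.

Lemma partial_cst n (c : R) (j : 'I_n) : partial j (fun=> c) = fun=> 0.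
Proof. by apply/funext => x; exact: derive_cst. Qed.

Lemma partial_coord n (i j : 'I_n) :
  partial j (fun x : 'cV[R]_n => x i ord0) = fun=> (i == j)%:R.
Proof.
apply/funext => x; rewrite /partial.
have := @derive_mx R _ _ _ (@id 'cV[R]_n) x (delta_mx j ord0) (@derivable_id _ _ _ _).
by rewrite derive_id => /matrixP /(_ i ord0); rewrite !mxE andbT => <-.
Qed.

Lemma differentiable_sumF n (I : Type) (r : seq I) (F : I -> 'cV[R]_n -> R) x :
  (forall i, differentiable (F i) x) ->
  differentiable (fun z => \sum_(i <- r) F i z) x.
Proof.
move=> dF; elim: r => [|a r IH].
  under [fun _ => _]funext do rewrite big_nil.
  exact: differentiable_cst.
under [fun _ => _]funext do rewrite big_cons.
exact: differentiableD.
Qed.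

Lemma partial_sumF n (I : Type) (r : seq I) (F : I -> 'cV[R]_n -> R) j x :
  (forall i, differentiable (F i) x) ->
  partial j (fun z => \sum_(i <- r) F i z) x = \sum_(i <- r) partial j (F i) x.
Proof.
move=> dF; elim: r => [|a r IH].
  rewrite big_nil; under [fun _ => _]funext do rewrite big_nil.
  by rewrite partial_cst.
rewrite big_cons; under [fun _ => _]funext do rewrite big_cons.
by rewrite partialD ?IH//; exact: differentiable_sumF.
Qed.

(** [smooth] and [Cb_infty] are both of this form, for differentiability without and with a bound;
    closure under sums and products is proved once for both. *)
Definition hereditarily n (Q : ('cV[R]_n -> R) -> Prop) (f : 'cV[R]_n -> R) :=
  forall s, Q (iter_partial s f).

Lemma iter_partial_rcons n (s : seq 'I_n) j f :
  iter_partial (rcons s j) f = iter_partial s (partial j f) :> ('cV[R]_n -> R).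
Proof. exact: foldr_rcons. Qed.

Lemma hereditarily_partial n Q (f : 'cV[R]_n -> R) j :
  hereditarily Q f -> hereditarily Q (partial j f).
Proof. by move=> Qf s; rewrite -iter_partial_rcons. Qed.

Section closure.
Variables (n : nat) (Q : ('cV[R]_n -> R) -> Prop).
Hypothesis Qdiff : forall f, Q f -> forall x, differentiable f x.
Hypothesis Qcst : forall c, Q (fun=> c).
Hypothesis QD : forall f g, Q f -> Q g -> Q (fun x => f x + g x).
Hypothesis QM : forall f g, Q f -> Q g -> Q (fun x => f x * g x).

Lemma hereditarily_cst c : hereditarily Q (fun=> c).
Proof.
move=> s; elim/last_ind: s c => [|s j IH] c; first exact: Qcst.
by rewrite iter_partial_rcons partial_cst.
Qed.

Lemma hereditarilyD f g : hereditarily Q f -> hereditarily Q g ->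
  hereditarily Q (fun x => f x + g x).
Proof.
move=> Qf Qg s; elim/last_ind: s f g Qf Qg => [|s j IH] f g Qf Qg.
  by apply: QD; [exact: (Qf [::])|exact: (Qg [::])].
rewrite iter_partial_rcons (_ : partial j _ = fun x => partial j f x + partial j g x).
  by apply: IH; exact: hereditarily_partial.
apply/funext => x; apply: partialD; apply: Qdiff; [exact: (Qf [::])|exact: (Qg [::])].
Qed.

Lemma hereditarilyM f g : hereditarily Q f -> hereditarily Q g ->
  hereditarily Q (fun x => f x * g x).
Proof.
move=> Qf Qg s.
(* The derivative of a product is a sum of two products. Finite sums of products are stable under
   [partial j], so the induction on the word runs over these. *)
suff H : forall r (F G : nat -> 'cV[R]_n -> R), (forall i, hereditarily Q (F i)) ->
    (forall i, hereditarily Q (G i)) ->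
    Q (iter_partial s (fun x => \sum_(i <- r) F i x * G i x)).
  have := H [:: 0%N] (fun=> f) (fun=> g) (fun=> Qf) (fun=> Qg).
  by under [fun _ => _]funext do rewrite big_seq1.
elim/last_ind: s => [|s j IH] r F G QF QG.
  rewrite /=; elim: r => [|a r IHr].
    by under [fun _ => _]funext do rewrite big_nil.
  under [fun _ => _]funext do rewrite big_cons.
  by apply: QD => //; apply: QM; [exact: (QF _ [::])|exact: (QG _ [::])].
rewrite iter_partial_rcons.
(* Leibniz rule: the summand i gives the summand 2i, with the derivative on G, and the summand 2i +
   1, with the derivative on F. *)
pose F' i := if odd i then partial j (F i./2) else F i./2.
pose G' i := if odd i then G i./2 else partial j (G i./2).
rewrite (_ : partial j _ = fun x =>
    \sum_(i <- flatten [seq [:: i.*2; i.*2.+1] | i <- r]) F' i x * G' i x).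
  by apply: IH => i; rewrite /F' /G'; case: ifP => _ //; exact: hereditarily_partial.
have dF i x : differentiable (F i) x by apply: Qdiff; exact: (QF _ [::]).
have dG i x : differentiable (G i) x by apply: Qdiff; exact: (QG _ [::]).
apply/funext => x; rewrite partial_sumF; last by move=> i; exact: differentiableM.
elim: r => [|a r IHr]; first by rewrite !big_nil.
rewrite /= !big_cons IHr /F' /G' /= odd_double /= uphalf_double half_double.
by rewrite partialM// addrA [G a x * _]mulrC.
Qed.

Lemma hereditarily_sum (I : Type) (r : seq I) (F : I -> 'cV[R]_n -> R) :
  (forall i, hereditarily Q (F i)) ->
  hereditarily Q (fun x => \sum_(i <- r) F i x).
Proof.
move=> QF; elim: r => [|a r IH].
  by under [fun _ => _]funext do rewrite big_nil; exact: hereditarily_cst.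
by under [fun _ => _]funext do rewrite big_cons; exact: hereditarilyD.
Qed.

End closure.

Definition smooth n (f : 'cV[R]_n -> R) :=
  hereditarily (fun g => forall x, differentiable g x) f.

Lemma smooth_differentiable n (f : 'cV[R]_n -> R) x : smooth f -> differentiable f x.
Proof. by move=> /(_ [::]). Qed.

Lemma smooth_partial n (f : 'cV[R]_n -> R) j : smooth f -> smooth (partial j f).
Proof. exact: hereditarily_partial. Qed.

Lemma smooth_cst n (c : R) : smooth (fun=> c : R) (n := n).
Proof. by apply: hereditarily_cst => a x; exact: differentiable_cst. Qed.

Lemma smoothD n (f g : 'cV[R]_n -> R) : smooth f -> smooth g ->
  smooth (fun x => f x + g x).
Proof. by apply: hereditarilyD => // a b da db x; exact: differentiableD. Qed.

Lemma smoothM n (f g : 'cV[R]_n -> R) : smooth f -> smooth g ->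
  smooth (fun x => f x * g x).
Proof.
apply: hereditarilyM => // a b da db x.
- exact: differentiableD.
- exact: differentiableM.
Qed.

Lemma smooth_sum n (I : Type) (r : seq I) (F : I -> 'cV[R]_n -> R) :
  (forall i, smooth (F i)) -> smooth (fun x => \sum_(i <- r) F i x).
Proof.
apply: hereditarily_sum => // a b da db x.
exact: differentiableD.
Qed.

Lemma smooth_coord n (i : 'I_n) : smooth (fun x : 'cV[R]_n => x i ord0).
Proof.
move=> s; elim/last_ind: s => [|s j _] x; first exact: differentiable_coord.
by rewrite iter_partial_rcons partial_coord; exact: smooth_cst.
Qed.

(** Finite sums of products of G with F o phi are stable under differentiation: the summand i yields
    one summand [inl i], with the derivative on G, and by the chain rule one summand [inr (i, l)]
    for each coordinate l of phi. *)
Lemma smooth_chain n m (phi : 'cV[R]_n -> 'cV[R]_m) (f : 'cV[R]_m -> R) :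
  (forall l, smooth (fun x => phi x l ord0)) -> smooth f ->
  smooth (fun x => f (phi x)).
Proof.
move=> sphi sf s.
suff H (I : finType) (F : I -> 'cV[R]_m -> R) (G : I -> 'cV[R]_n -> R) :
    (forall i, smooth (F i)) -> (forall i, smooth (G i)) ->
    forall x, differentiable (iter_partial s (fun x => \sum_i G i x * F i (phi x))) x.
  have := H unit (fun=> f) (fun=> fun=> 1) (fun=> sf) (fun=> @smooth_cst n 1).
  rewrite (_ : (fun x => _) = (fun x => f (phi x)))//; apply/funext => x.
  by rewrite big_const card_unit iterS mul1r addr0.
elim/last_ind: s I F G => [|s j IH] I F G sF sG x.
  apply: differentiable_sumF => i; apply: differentiableM.
    exact: smooth_differentiable.
  by apply: differentiable_chain => [l|]; exact: smooth_differentiable.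
rewrite iter_partial_rcons.
pose F' (z : I + I * 'I_m) := match z with inl i => F i | inr (i, l) => partial l (F i) end.
pose G' (z : I + I * 'I_m) := match z with inl i => partial j (G i)
  | inr (i, l) => fun x => G i x * partial j (fun z => phi z l ord0) x end.
rewrite (_ : partial j _ = fun x => \sum_z G' z x * F' z (phi x)); last first.
  apply/funext => z.
  rewrite big_sumType (_ : \sum_(p : I * 'I_m) _ = \sum_i \sum_l
      G' (inr (i, l)) z * F' (inr (i, l)) (phi z)) /=; last first.
    by rewrite pair_bigA; apply: eq_bigr => -[].
  rewrite partial_sumF; last first.
    move=> i; apply: differentiableM; first exact: smooth_differentiable.
    by apply: differentiable_chain => [l|]; exact: smooth_differentiable.
  rewrite -big_split/=; apply: eq_bigr => i _.
  rewrite partialM; [|exact: smooth_differentiable|]; last first.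
    by apply: differentiable_chain => [l|]; exact: smooth_differentiable.
  rewrite addrC; congr (_ + _); last exact: mulrC.
  rewrite (@partial_chain _ _ phi (F i)); last exact: smooth_differentiable.
        by rewrite mulr_sumr; apply: eq_bigr => l _; rewrite mulrA.
  by move=> l; exact: smooth_differentiable.
apply: IH => -[i|[i l]] /=; do ?[exact: sF|exact: smooth_partial].
by apply: smoothM => //; exact: smooth_partial.
Qed.

Lemma Cb_inftyE n (f : 'cV[R]_n -> R) : Cb_infty f = hereditarily (fun g =>
  (forall x, differentiable g x) /\ exists M, forall x, `|g x| <= M) f.
Proof. by []. Qed.

Lemma Cb_smooth n (f : 'cV[R]_n -> R) : Cb_infty f -> smooth f.
Proof. by move=> Cf s; have [] := Cf s. Qed.

Lemma Cb_partial n (f : 'cV[R]_n -> R) j : Cb_infty f -> Cb_infty (partial j f).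
Proof. by rewrite !Cb_inftyE; exact: hereditarily_partial. Qed.

Let bD n (f g : 'cV[R]_n -> R) :
  ((forall x, differentiable f x) /\ exists M, forall x, `|f x| <= M) ->
  ((forall x, differentiable g x) /\ exists M, forall x, `|g x| <= M) ->
  (forall x, differentiable (fun x => f x + g x) x) /\
  exists M, forall x, `|f x + g x| <= M.
Proof.
move=> [df [M fM]] [dg [M' gM]]; split=> [x|]; first exact: differentiableD.
by exists (M + M') => x; apply: (le_trans (ler_normD _ _)); apply: lerD.
Qed.

Let bM n (f g : 'cV[R]_n -> R) :
  ((forall x, differentiable f x) /\ exists M, forall x, `|f x| <= M) ->
  ((forall x, differentiable g x) /\ exists M, forall x, `|g x| <= M) ->
  (forall x, differentiable (fun x => f x * g x) x) /\
  exists M, forall x, `|f x * g x| <= M.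
Proof.
move=> [df [M fM]] [dg [M' gM]]; split=> [x|]; first exact: differentiableM.
by exists (M * M') => x; rewrite normrM; apply: ler_pM.
Qed.

Let bC n (c : R) : (forall x : 'cV[R]_n, differentiable (fun=> c : R) x) /\
  exists M, forall x : 'cV[R]_n, `|c| <= M.
Proof. by split; [move=> x; exact: differentiable_cst|exists `|c|]. Qed.

Lemma Cb_cst n (c : R) : Cb_infty (fun=> c : R) (n := n).
Proof. by rewrite Cb_inftyE; apply: hereditarily_cst; exact: bC. Qed.

Lemma CbD n (f g : 'cV[R]_n -> R) : Cb_infty f -> Cb_infty g ->
  Cb_infty (fun x => f x + g x).
Proof. 
rewrite !Cb_inftyE; apply: hereditarilyD => [? []//|a b]; exact: bD.
Qed.

Lemma CbM n (f g : 'cV[R]_n -> R) : Cb_infty f -> Cb_infty g ->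
  Cb_infty (fun x => f x * g x).
Proof.
rewrite !Cb_inftyE; apply: hereditarilyM => [? []//|c|a b|a b].
- exact: bC.
- exact: bD.
- exact: bM.
Qed.

Lemma Cb_sum n (I : Type) (r : seq I) (F : I -> 'cV[R]_n -> R) :
  (forall i, Cb_infty (F i)) -> Cb_infty (fun x => \sum_(i <- r) F i x).
Proof.
move=> CF; rewrite Cb_inftyE; apply: hereditarily_sum => // [? []//|c|a b].
  exact: bC.
exact: bD.
Qed.

Lemma Cb_bounded n (f : 'cV[R]_n -> R) : Cb_infty f ->
  exists2 M, 0 < M & forall x, `|f x| <= M.
Proof.
move=> /(_ [::])[_ [M fM]]; exists (`|M| + 1); first by rewrite ltr_wpDl.
by move=> x; apply: (le_trans (fM x)); apply: (le_trans (ler_norm _)); rewrite lerDl.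
Qed.

End smooth_functions.

(** * Transformation of jets under a weight and a change of variables *)

Section pullback.
Context {R : realType}.

(** The jets are indexed by words of length at most k: mixed partials taken in different orders are
    separate entries. *)
Fixpoint words (n k : nat) : seq (seq 'I_n) :=
  if k is k'.+1 then [::] :: [seq i :: s | i <- enum 'I_n, s <- words n k']
  else [:: [::]].

Lemma big_words n k (F : seq 'I_n -> R) : \sum_(s <- words n k.+1) F s =
  F [::] + \sum_i \sum_(s <- words n k) F (i :: s).
Proof. by rewrite /= big_cons big_allpairs_dep big_enum. Qed.

Lemma mem_words n k (s : seq 'I_n) : (s \in words n k) = (size s <= k)%N.
Proof.
elim: k s => [|k IH] [|i s] //=; rewrite inE/=.
apply/allpairsP/idP => [[[j t] [/= _ tk [_ ->]]]|sk]; first by rewrite ltnS -IH.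
by exists (i, s); split; rewrite ?mem_enum ?IH.
Qed.

Lemma uniq_words n k : uniq (words n k).
Proof.
elim: k => //= k IH; rewrite allpairs_uniq ?enum_uniq// ?andbT; last first.
  by move=> [i s] [j t] _ _ /= [-> ->].
by apply/allpairsP => -[[i s] [_ _]].
Qed.

Lemma sum_words_trunc n k (F : seq 'I_n -> R) :
  (forall s, (k < size s)%N -> F s = 0) ->
  \sum_(s <- words n k.+1) F s = \sum_(s <- words n k) F s.
Proof.
elim: k F => [|k IH] F F0.
  rewrite big_words big1 ?addr0 ?big_seq1// => i _.
  by rewrite big_seq1 F0.
rewrite big_words [RHS]big_words; congr (_ + _); apply: eq_bigr => i _.
by apply: IH => s ks; apply: F0.
Qed.

Variables (n m : nat).

(* The coefficients of the jet of f in the jet of g * (f o phi). *)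
Fixpoint pullback_coef (g : 'cV[R]_n -> R) (phi : 'cV[R]_n -> 'cV[R]_m)
    (s : seq 'I_n) (t : seq 'I_m) : 'cV[R]_n -> R :=
  match s with
  | [::] => if t is [::] then g else fun=> 0
  | j :: s' => fun x => partial j (pullback_coef g phi s' t) x +
      (if t is l :: t' then pullback_coef g phi s' t' x *
         partial j (fun z => phi z l ord0) x else 0)
  end.

Variables (g : 'cV[R]_n -> R) (phi : 'cV[R]_n -> 'cV[R]_m).
Hypothesis sg : smooth g.
Hypothesis sphi : forall l, smooth (fun x => phi x l ord0).

Lemma smooth_pullback_coef s t : smooth (pullback_coef g phi s t).
Proof.
elim: s t => [|j s IH] [|l t] /=; [by []|exact: smooth_cst| |].
  apply: smoothD; [exact: smooth_partial|exact: smooth_cst].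
apply: smoothD; first exact: smooth_partial.
by apply: smoothM => //; exact: smooth_partial.
Qed.

Lemma pullback_coef_eq0 s t : (size s < size t)%N -> pullback_coef g phi s t = fun=> 0.
Proof.
elim: s t => [|j s IH] [|l t]//= st; apply/funext => x.
rewrite IH; last by rewrite (leq_trans (leqnSn _))// ltnS ltnW.
by rewrite partial_cst add0r IH// mul0r.
Qed.

(** A further derivative acts on the coefficient, keeping the word t, or on the jet of f at phi x,
    prolonging t by a letter; these are the two terms in the recursion of [pullback_coef].
    Coefficients with t longer than s vanish, so raising the bound on the length of t adds only
    zeros. *)
Lemma iter_partial_pullback k s f x : smooth f -> (size s <= k)%N ->
  iter_partial s (fun x => g x * f (phi x)) x =
  \sum_(t <- words m k) pullback_coef g phi s t x * iter_partial t f (phi x).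
Proof.
move=> sf; elim: s k x => [|j s IH] k x sk.
  case: k sk => [|k] _; first by rewrite big_seq1.
  rewrite big_words big1 ?addr0// => i _; rewrite big1// => t _.
  by rewrite mul0r.
case: k sk => // k; rewrite ltnS => sk.
have dfphi t z : differentiable (fun z => iter_partial t f (phi z)) z.
  apply: differentiable_chain => [l|]; first exact: smooth_differentiable.
  exact: sf.
have dM t z : differentiable (pullback_coef g phi s t) z.
  exact/smooth_differentiable/smooth_pullback_coef.
rewrite [LHS]/= -/(iter_partial s _).
rewrite (_ : iter_partial s _ = fun x => \sum_(t <- words m k)
    pullback_coef g phi s t x * iter_partial t f (phi x)); last first.
  by apply/funext => z; exact: IH.
rewrite partial_sumF; last by move=> t; exact: differentiableM.
under eq_bigr do rewrite partialM// addrC.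
rewrite big_split/=.
under [RHS]eq_bigr do rewrite mulrDl.
rewrite [RHS]big_split/=; congr (_ + _).
  rewrite -/(words m k.+1) [RHS]sum_words_trunc.
    by apply: eq_bigr => t _; rewrite mulrC.
  move=> t kt; rewrite pullback_coef_eq0 ?partial_cst ?mul0r//.
  exact: leq_ltn_trans kt.
rewrite -/(words m k.+1) big_words mul0r add0r exchange_big/=.
apply: eq_bigr => t _; rewrite (@partial_chain _ _ _ phi (iter_partial t f)).
- by rewrite mulr_sumr; apply: eq_bigr => l _; rewrite mulrA.
- by move=> l; exact: smooth_differentiable.
- exact: sf.
Qed.

End pullback.

(** * Polynomials in the step size with smooth bounded coefficients *)

Section polynomial_families.
Context {R : realType} (n : nat).
Implicit Types m : R -> 'cV[R]_n -> R.

(** A syntactic class, so that stability under [partial] and the expansion at r = 0 follow by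
    induction. The coefficients of the jet of a walk step belong to it. *)
Inductive poly_family : (R -> 'cV[R]_n -> R) -> Prop :=
| pf_cst f : Cb_infty f -> poly_family (fun=> f)
| pf_id : poly_family (fun r _ => r)
| pf_add m1 m2 : poly_family m1 -> poly_family m2 ->
    poly_family (fun r x => m1 r x + m2 r x)
| pf_mul m1 m2 : poly_family m1 -> poly_family m2 ->
    poly_family (fun r x => m1 r x * m2 r x).

Lemma pf_Cb m r : poly_family m -> Cb_infty (m r).
Proof.
elim=> [//||m1 m2 _ C1 _ C2|m1 m2 _ C1 _ C2].
- exact: Cb_cst.
- exact: CbD.
- exact: CbM.
Qed.

Lemma pf_partial m j : poly_family m -> poly_family (fun r => partial j (m r)).
Proof.
have dm m' r x : poly_family m' -> differentiable (m' r) x.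
  by move=> pm; apply/smooth_differentiable/Cb_smooth; exact: pf_Cb.
elim=> [f Cf||m1 m2 p1 D1 p2 D2|m1 m2 p1 D1 p2 D2].
- by apply: pf_cst; exact: Cb_partial.
- rewrite (_ : (fun r => _) = fun=> fun=> 0); first by apply: (pf_cst (f := fun=> 0)); exact: Cb_cst.
  by apply/funext => r; rewrite partial_cst.
- rewrite (_ : (fun r => _) = fun r x => partial j (m1 r) x + partial j (m2 r) x).
    exact: pf_add.
  by apply/funext => r; apply/funext => x; rewrite partialD//; exact: dm.
- rewrite (_ : (fun r => _) = fun r x => m1 r x * partial j (m2 r) x +
                                         m2 r x * partial j (m1 r) x).
    by apply: pf_add; exact: pf_mul.
  by apply/funext => r; apply/funext => x; rewrite partialM//; exact: dm.
Qed.

(** [B0] does not depend on r, hence the linear terms at r and -r are opposite; only the quadratic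
    remainder [B1] varies with r. *)
Lemma pf_expand m : poly_family m -> exists C B0 B1, 0 <= C /\
  forall r x, `|r| <= 1 -> [/\ m r x = m 0 x + r * B0 x + r ^+ 2 * B1 r x,
    `|m 0 x| <= C, `|B0 x| <= C & `|B1 r x| <= C].
Proof.
elim=> [f Cf||m1 m2 _ [C [B0 [B1 [C0 H]]]] _ [C' [B0' [B1' [C0' H']]]]|
        m1 m2 _ [C [B0 [B1 [C0 H]]]] _ [C' [B0' [B1' [C0' H']]]]].
- have [M M0 fM] := Cb_bounded Cf.
  exists M, (fun=> 0), (fun=> fun=> 0); split=> [|r x _]; first exact: ltW.
  by rewrite !normr0 !mulr0 !addr0; split => //; exact: ltW.
- exists 1, (fun=> 1), (fun=> fun=> 0); split=> // r x _.
  by rewrite !normr0 normr1 mulr1 mulr0 addr0 add0r.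
- exists (C + C'), (fun x => B0 x + B0' x), (fun r x => B1 r x + B1' r x).
  split=> [|r x r1]; first exact: addr_ge0.
  have [-> a1 a2 a3] := H r x r1; have [-> b1 b2 b3] := H' r x r1.
  by split; [ring|..]; apply: (le_trans (ler_normD _ _)); apply: lerD.
- exists (C * C' *+ 8), (fun x => m1 0 x * B0' x + m2 0 x * B0 x),
    (fun r x => m1 0 x * B1' r x + m2 0 x * B1 r x + B0 x * B0' x +
       r * (B0 x * B1' r x + B0' x * B1 r x) + r ^+ 2 * (B1 r x * B1' r x)).
  split=> [|r x r1]; first by rewrite mulrn_wge0// mulr_ge0.
  have [-> a1 a2 a3] := H r x r1; have [-> b1 b2 b3] := H' r x r1.
  have P u v : `|u| <= C -> `|v| <= C' -> `|u * v| <= C * C'.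
    by move=> uC vC; rewrite normrM; apply: ler_pM.
  have CC0 : 0 <= C * C' by exact: mulr_ge0.
  have r2 : `|r ^+ 2| <= 1 by rewrite normrX expr_le1.
  have Z (t u v : R) : `|t| <= 1 -> `|u| <= v -> `|t * u| <= v.
    by move=> t1 uv; rewrite normrM -[leRHS]mul1r; apply: ler_pM.
  split; [ring|..].
  + by apply: (le_trans (P _ _ a1 b1)); rewrite -[leLHS]mulr1n ler_wpMn2l.
  + apply: (le_trans (ler_normD _ _)).
    have := P _ _ a1 b2; have := P _ _ a2 b1; rewrite [m2 0 x * _]mulrC.
    by move: CC0; lra.
  + have e1 := P _ _ a1 b3; have e2 := P _ _ a3 b1; have e3 := P _ _ a2 b2.
    have e4 : `|r * (B0 x * B1' r x + B0' x * B1 r x)| <= C * C' *+ 2.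
      apply: Z => //; apply: (le_trans (ler_normD _ _)); rewrite mulr2n.
      by apply: lerD; [|rewrite mulrC]; exact: P.
    have e5 := Z _ _ _ r2 (P _ _ a3 b3).
    apply: (le_trans (ler_normD _ _)); apply: (le_trans (lerD (ler_normD _ _) (lexx _))).
    apply: (le_trans (lerD (lerD (ler_normD _ _) (lexx _)) (lexx _))).
    apply: (le_trans (lerD (lerD (lerD (ler_normD _ _) (lexx _)) (lexx _)) (lexx _))).
    move: e1 e2 e3 e4 e5 CC0; rewrite [m2 0 x * B1 r x]mulrC.
    set a := `|_|; set b := `|_|; set c := `|_|; set e := `|_|; set f := `|_|; lra.
Qed.

End polynomial_families.

(** Only derivatives of phi enter the coefficients. These are bounded although phi itself, a
    perturbation of the identity, is not. *)
Lemma pf_pullback {R : realType} n (g : R -> 'cV[R]_n -> R)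
    (phi : R -> 'cV[R]_n -> 'cV[R]_n) s t : poly_family g ->
  (forall j l, poly_family (fun r => partial j (fun z => phi r z l ord0))) ->
  poly_family (fun r => pullback_coef (g r) (phi r) s t).
Proof.
move=> pg pphi; elim: s t => [|j s IH] [|l t] //=.
- apply: (pf_cst (f := fun=> 0)); exact: Cb_cst.
- by apply: pf_add; [exact: pf_partial|apply: (pf_cst (f := fun=> 0)); exact: Cb_cst].
- by apply: pf_add; [exact: pf_partial|exact: pf_mul].
Qed.

(** This is the situation at r = 0, where the walk does not move and has weight one: to leading
    order jets are transformed by the identity matrix. *)
Lemma pullback_coef_id {R : realType} n (g : 'cV[R]_n -> R)
    (phi : 'cV[R]_n -> 'cV[R]_n) s t :
  g = (fun=> 1) ->
  (forall j l, partial j (fun z => phi z l ord0) = (fun=> (l == j)%:R : R)) ->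
  pullback_coef g phi s t = fun=> (s == t)%:R.
Proof.
move=> -> phi1; elim: s t => [|j s IH] [|l t] //=; apply/funext => x.
  by rewrite IH partial_cst addr0.
rewrite !IH partial_cst add0r phi1 -natrM mulnb eqseq_cons andbC.
by rewrite [l == j]eq_sym.
Qed.

(** * Quadratic estimate for a pair of opposite perturbations of the identity *)

Section duality.
Context {R : realType} (I : eqType) (W : seq I).
Hypothesis uW : uniq W.

Lemma sum_delta (y : I -> R) t : t \in W -> \sum_(s <- W) y s * (s == t)%:R = y t.
Proof.
move=> tW; rewrite (bigD1_seq t)//= eqxx mulr1 big1 ?addr0// => s /negbTE ->.
by rewrite mulr0.
Qed.

Lemma sqr_sum_le (y : I -> R) :
  (\sum_(s <- W) `|y s|) ^+ 2 <= (size W)%:R * \sum_(s <- W) y s ^+ 2.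
Proof.
rewrite expr2 big_distrlr/=.
apply: (@le_trans _ _ (\sum_(s <- W) \sum_(t <- W) (y s ^+ 2 + y t ^+ 2) / 2)).
  apply: ler_sum => s _; apply: ler_sum => t _.
  rewrite ler_pdivlMr// -subr_ge0 -[y s ^+ 2]real_normK ?num_real//.
  rewrite -[y t ^+ 2]real_normK ?num_real//.
  by apply: le_trans (sqr_ge0 (`|y s| - `|y t|)) _; lra.
have cst (c : R) : \sum_(s <- W) c = (size W)%:R * c.
  by rewrite (big_const_seq _ _ _ xpredT) count_predT iter_addr_0 mulr_natl.
rewrite le_eqVlt; apply/orP; left; apply/eqP.
transitivity (\sum_(s <- W) ((size W)%:R * y s ^+ 2 + \sum_(t <- W) y t ^+ 2) / 2).
  by apply: eq_bigr => s _; rewrite -mulr_suml big_split/= cst.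
by rewrite -mulr_suml big_split/= cst -mulr_sumr; field.
Qed.

(* The term linear in r disappears after averaging over both signs. *)
Lemma dual_average (y : I -> R) (B0 Gp Gm : I -> I -> R) (C r : R) :
  0 <= C -> `|r| <= 1 ->
  (forall s t, s \in W -> t \in W ->
    [/\ `|B0 s t| <= C, `|Gp s t| <= C & `|Gm s t| <= C]) ->
  \sum_(t <- W)
    ((\sum_(s <- W) y s * ((s == t)%:R + r * B0 s t + r ^+ 2 * Gp s t)) ^+ 2 +
     (\sum_(s <- W) y s * ((s == t)%:R - r * B0 s t + r ^+ 2 * Gm s t)) ^+ 2) / 2
  <= (1 + (1 + 5 * (C * (size W)%:R) ^+ 2) * r ^+ 2) * \sum_(s <- W) y s ^+ 2.
Proof.
move=> C0 r1 BC; set q := \sum_(s <- W) y s ^+ 2.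
have q0 : 0 <= q by apply: sumr_ge0 => s _; exact: sqr_ge0.
have bnd (B : I -> I -> R) t : (forall s, s \in W -> `|B s t| <= C) ->
    (\sum_(s <- W) y s * B s t) ^+ 2 <= C ^+ 2 * (size W)%:R * q.
  move=> BtC; rewrite -real_normK ?num_real//.
  apply: (@le_trans _ _ ((C * \sum_(s <- W) `|y s|) ^+ 2)).
    rewrite lerXn2r ?nnegrE// ?mulr_ge0 ?sumr_ge0//.
    apply: (le_trans (ler_norm_sum _ _ _)); rewrite mulr_sumr big_seq [leRHS]big_seq.
    by apply: ler_sum => s sW; rewrite normrM mulrC ler_wpM2r// BtC.
  by rewrite exprMn -mulrA ler_wpM2l ?sqr_ge0// sqr_sum_le.
set V := C ^+ 2 * (size W)%:R * q.
have r2 : r ^+ 2 <= 1 by rewrite -real_normK ?num_real// expr_le1.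
have r20 : 0 <= r ^+ 2 by exact: sqr_ge0.
(* The factor 5 counts terms bounded by V: [be ^+ 2] occurs twice and the mean of [gp ^+ 2] and
   [gm ^+ 2] three times. *)
have pt t : t \in W ->
   ((\sum_(s <- W) y s * ((s == t)%:R + r * B0 s t + r ^+ 2 * Gp s t)) ^+ 2 +
     (\sum_(s <- W) y s * ((s == t)%:R - r * B0 s t + r ^+ 2 * Gm s t)) ^+ 2) / 2
   <= y t ^+ 2 + r ^+ 2 * (y t ^+ 2 + 5 * V).
  move=> tW.
  have E (k : R) (G : I -> I -> R) :
    \sum_(s <- W) y s * ((s == t)%:R + k * B0 s t + r ^+ 2 * G s t) =
    y t + k * (\sum_(s <- W) y s * B0 s t) + r ^+ 2 * (\sum_(s <- W) y s * G s t).
    rewrite -(sum_delta y tW) !mulr_sumr -!big_split/=.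
    by apply: eq_bigr => s _; ring.
  rewrite E; under [X in (_ + X ^+ 2) / 2]eq_bigr do rewrite -mulNr.
  rewrite E.
  have b1 : (\sum_(s <- W) y s * B0 s t) ^+ 2 <= V.
    by apply: bnd => s sW; have [] := BC s t sW tW.
  have b2 : (\sum_(s <- W) y s * Gp s t) ^+ 2 <= V.
    by apply: bnd => s sW; have [] := BC s t sW tW.
  have b3 : (\sum_(s <- W) y s * Gm s t) ^+ 2 <= V.
    by apply: bnd => s sW; have [] := BC s t sW tW.
  move: b1 b2 b3; set be := \sum_(s <- W) _; set gp := \sum_(s <- W) _.
  set gm := \sum_(s <- W) _ => b1 b2 b3.
  have -> : ((y t + r * be + r ^+ 2 * gp) ^+ 2 + (y t + - r * be + r ^+ 2 * gm) ^+ 2) / 2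
    = y t ^+ 2 + r ^+ 2 * (be ^+ 2 + r ^+ 2 * ((gp ^+ 2 + gm ^+ 2) / 2)
      + y t * (gp + gm) + r * be * (gp - gm)) by field.
  rewrite lerD2l ler_wpM2l//.
  have h1 : r ^+ 2 * ((gp ^+ 2 + gm ^+ 2) / 2) <= V.
    rewrite -[leRHS]mul1r; apply: ler_pM => //; last by lra.
    by rewrite divr_ge0// addr_ge0// sqr_ge0.
  have h2 : y t * (gp + gm) <= y t ^+ 2 + (gp ^+ 2 + gm ^+ 2) / 2.
    have := sqr_ge0 (y t - gp); have := sqr_ge0 (y t - gm); lra.
  have h3 : r * be * (gp - gm) <= be ^+ 2 + (gp ^+ 2 + gm ^+ 2) / 2.
    have rb : (r * be) ^+ 2 <= be ^+ 2.
      by rewrite exprMn -[leRHS]mul1r ler_wpM2r// sqr_ge0.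
    have := sqr_ge0 (r * be - gp); have := sqr_ge0 (r * be + gm); lra.
  lra.
rewrite big_seq; apply: (le_trans (ler_sum _ pt)); rewrite -big_seq.
rewrite big_split/= -mulr_sumr big_split/= -/q.
rewrite (big_const_seq _ _ _ xpredT) count_predT iter_addr_0 -mulr_natl.
rewrite /V le_eqVlt; apply/orP; left; apply/eqP; ring.
Qed.

End duality.

(** * Random walks *)

Section iterated_partials.
Context {R : realType} (n : nat).
Implicit Types f g : 'cV[R]_n -> R.

Lemma iter_partialD s f g : smooth f -> smooth g ->
  iter_partial s (fun x => f x + g x) = fun x => iter_partial s f x + iter_partial s g x.
Proof.
move=> sf sg; elim: s => //= j s IH; rewrite -!/(iter_partial s _) IH.
by apply/funext => x; apply: partialD; [exact: sf|exact: sg].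
Qed.

Lemma iter_partialZ s (c : R) f : smooth f ->
  iter_partial s (fun x => c * f x) = fun x => c * iter_partial s f x.
Proof.
move=> sf; elim: s => //= j s IH; rewrite -!/(iter_partial s _) IH.
apply/funext => x; rewrite partialM; [|exact: differentiable_cst|exact: sf].
by rewrite partial_cst mulr0 addr0.
Qed.

Lemma iter_partial_sum (I : Type) (r : seq I) (F : I -> 'cV[R]_n -> R) s :
  (forall i, smooth (F i)) ->
  iter_partial s (fun x => \sum_(i <- r) F i x) =
  fun x => \sum_(i <- r) iter_partial s (F i) x.
Proof.
move=> sF; elim: s => //= j s IH; rewrite -!/(iter_partial s _) IH.
by apply/funext => x; apply: partial_sumF => i; exact: sF.
Qed.

(** Estimating a step by absolute values would cost a factor 1 + O(|r|), which the order of r^-2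
    steps would make unbounded as r -> 0. A quadratic quantity allows the terms linear in r to
    cancel. *)
Definition jet_sq f x := \sum_(s <- words n 4) iter_partial s f x ^+ 2.

Definition jet_le f (M : R) :=
  forall s x, (size s <= 4)%N -> `|iter_partial s f x| <= M.

Lemma jet_le_sq f M x : jet_le f M -> jet_sq f x <= (size (words n 4))%:R * M ^+ 2.
Proof.
move=> fM; rewrite /jet_sq big_seq.
apply: (@le_trans _ _ (\sum_(s <- words n 4) M ^+ 2)).
  rewrite [leRHS]big_seq; apply: ler_sum => s; rewrite mem_words => sn.
  by rewrite -real_normK ?num_real// lerXn2r ?nnegrE ?(le_trans _ (fM s x sn))// fM.
by rewrite (big_const_seq _ _ _ xpredT) count_predT iter_addr_0 mulr_natl.
Qed.

Lemma jet_sq_le f M : 0 <= M -> (forall x, jet_sq f x <= M ^+ 2) -> jet_le f M.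
Proof.
move=> M0 fM s x sn; rewrite -(@ler_pXn2r _ 2)// ?nnegrE//.
apply: le_trans (fM x); rewrite real_normK ?num_real// /jet_sq.
rewrite (bigD1_seq s) ?uniq_words ?mem_words//= lerDl.
by apply: sumr_ge0 => t _; exact: sqr_ge0.
Qed.

(** Each derivative turns one product into two, whence [2 ^+ k]. *)
Lemma iter_partialM_le k f g (A B : R) : smooth f -> smooth g ->
  (forall s x, (size s <= k)%N -> `|iter_partial s f x| <= A) ->
  (forall s x, (size s <= k)%N -> `|iter_partial s g x| <= B) ->
  forall s x, (size s <= k)%N ->
    `|iter_partial s (fun x => f x * g x) x| <= 2 ^+ k * (A * B).
Proof.
elim: k f g A B => [|k IH] f g A B sf sg fA gB s x.
  case: s => // _; rewrite mul1r normrM; apply: ler_pM => //.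
    exact: (fA [::]).
  exact: (gB [::]).
elim/last_ind: s => [_|s j _].
  have AB : `|f x * g x| <= A * B.
    by rewrite normrM; apply: ler_pM => //; [exact: (fA [::])|exact: (gB [::])].
  apply: (le_trans AB); rewrite ler_peMl// ?exprn_ege1 ?ler1n//.
  exact: le_trans AB.
rewrite size_rcons ltnS => sk; rewrite iter_partial_rcons.
rewrite (_ : partial j _ = fun x => f x * partial j g x + g x * partial j f x); last first.
  by apply/funext => z; rewrite partialM//; exact: smooth_differentiable.
rewrite iter_partialD; [|by apply: smoothM => //; exact: smooth_partial..].
apply: (le_trans (ler_normD _ _)); rewrite exprS -mulrA mulr2n mulrDl mul1r.
have f' t z : (size t <= k)%N -> `|iter_partial t f z| <= A.
  by move=> tk; apply: fA; exact: leqW.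
have g' t z : (size t <= k)%N -> `|iter_partial t g z| <= B.
  by move=> tk; apply: gB; exact: leqW.
apply: lerD.
  apply: IH => //; first exact: smooth_partial.
  by move=> t z tk; rewrite -iter_partial_rcons; apply: gB; rewrite size_rcons.
rewrite [A * B]mulrC; apply: IH => //; first exact: smooth_partial.
by move=> t z tk; rewrite -iter_partial_rcons; apply: fA; rewrite size_rcons.
Qed.

End iterated_partials.

(** * The walk and the growth of jets in one step *)

Section walk.
Context {R : realType} (d : nat).
Hypothesis d_gt0 : (0 < d)%N.
Variables (c : 'cV[R]_d -> R) (b : 'cV[R]_d -> 'cV[R]_d) (sigma : 'cV[R]_d -> 'M[R]_d).

(** One of the d columns is chosen uniformly, so that the noise has covariance (r^2 / d) sigma
    sigma^T; this fixes r^2 / d as the time during which the drift acts. *)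
Definition walk_map (i : 'I_d) (r : R) (x : 'cV[R]_d) : 'cV[R]_d :=
  x + (r * r / d%:R) *: b x + r *: col i (sigma x).

Definition walk_factor (r : R) (x : 'cV[R]_d) : R := 1 + r * r * (d%:R^-1 * c x).

(* One step of length h = r^2 / d of a random walk approximating the semigroup
   generated by c + b . grad + 1/2 sigma sigma^T : D^2. *)
Definition walk (r : R) (f : 'cV[R]_d -> R) (x : 'cV[R]_d) : R :=
  \sum_(i < d) (2 * d%:R)^-1 * (walk_factor r x * f (walk_map i r x) +
    walk_factor (- r) x * f (walk_map i (- r) x)).

Hypothesis Cc : Cb_infty c.
Hypothesis Cb_b : Cb_infty_mx b.
Hypothesis Cb_sigma : Cb_infty_mx sigma.

Lemma walk_mapE i r x l : walk_map i r x l ord0 =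
  x l ord0 + r * r / d%:R * b x l ord0 + r * sigma x l i.
Proof. by rewrite !mxE. Qed.

Lemma smooth_walk_map i r l : smooth (fun x => walk_map i r x l ord0).
Proof.
under [fun x => _]funext do rewrite walk_mapE.
apply: smoothD.
  apply: smoothD; first exact: smooth_coord.
  by apply: smoothM; [exact: smooth_cst|apply: Cb_smooth; exact: Cb_b].
by apply: smoothM; [exact: smooth_cst|apply: Cb_smooth; exact: Cb_sigma].
Qed.

Lemma partial_walk_map i j l r : partial j (fun x => walk_map i r x l ord0) =
  fun x => ((l == j)%:R + r * r * (d%:R^-1 * partial j (fun z => b z l ord0) x)) +
           r * partial j (fun z => sigma z l i) x.
Proof.
under [fun x => _]funext do rewrite walk_mapE.
have db x : differentiable (fun z => b z l ord0) x by have [+ _] := Cb_b l ord0 [::].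
have ds x : differentiable (fun z => sigma z l i) x by have [+ _] := Cb_sigma l i [::].
have dc x : differentiable (fun z : 'cV[R]_d => z l ord0) x by exact: differentiable_coord.
apply/funext => x.
have dcst (k : R) : differentiable (fun=> k : R) x by exact: differentiable_cst.
rewrite partialD//; [|by apply: differentiableD => //; exact: differentiableM|exact: differentiableM].
rewrite partialD//; last exact: differentiableM.
by rewrite !partialM// !partial_cst partial_coord !(mulr0, addr0) !mulrA.
Qed.

Lemma pf_walk_map i j l :
  poly_family (fun r => partial j (fun x => walk_map i r x l ord0)).
Proof.
under [fun r => _]funext do rewrite partial_walk_map.
apply: pf_add; [apply: pf_add; [|apply: pf_mul]|apply: pf_mul].
- by apply: (pf_cst (f := fun=> _)); exact: Cb_cst.
- by apply: pf_mul; exact: pf_id.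
- apply: (pf_cst (f := fun x => _)); apply: CbM; first exact: Cb_cst.
  by apply: Cb_partial; exact: Cb_b.
- exact: pf_id.
- by apply: (pf_cst (f := fun x => _)); apply: Cb_partial; exact: Cb_sigma.
Qed.

Lemma pf_walk_factor : poly_family walk_factor.
Proof.
apply: pf_add; first by apply: (pf_cst (f := fun=> _)); exact: Cb_cst.
apply: pf_mul; first by apply: pf_mul; exact: pf_id.
by apply: (pf_cst (f := fun x => _)); apply: CbM; [exact: Cb_cst|].
Qed.

Lemma smooth_walk_factor r : smooth (walk_factor r).
Proof. by apply: Cb_smooth; exact: pf_Cb pf_walk_factor. Qed.

Lemma smooth_walk r f : smooth f -> smooth (walk r f).
Proof.
move=> sf; apply: smooth_sum => i; apply: smoothM; first exact: smooth_cst.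
by apply: smoothD; (apply: smoothM; [exact: smooth_walk_factor|
  apply: smooth_chain => // l; exact: smooth_walk_map]).
Qed.

(** The jets of f for the two signs are taken at different points, so that the linear terms would
    not cancel if the average were squared directly. Instead one factor of q, the sum of squares of
    the new jet y, is expanded and the coefficients are transposed onto the other factor y, which is
    common to both signs. [dual_average] and Young's inequality then give q <= (1 + K1 r^2) q / 2 +
    Q / 2, which is solved for q. *)
Lemma walk_jet : exists2 K : R, 0 < K & forall r f Q, `|r| <= 1 -> K * r ^+ 2 <= 1 ->
  smooth f -> (forall x, jet_sq f x <= Q) ->
  forall x, jet_sq (walk r f) x <= (1 + K * r ^+ 2) * Q.
Proof.
pose W := words d 4.
pose m i s t (r : R) := pullback_coef (walk_factor r) (walk_map i r) s t.
have pm i s t : poly_family (m i s t).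
  by apply: pf_pullback => *; [exact: pf_walk_factor|exact: pf_walk_map].
have m0 i s t x : m i s t 0 x = (s == t)%:R.
  rewrite /m pullback_coef_id//.
    by apply/funext => z; rewrite /walk_factor !mul0r addr0.
  move=> j l; rewrite partial_walk_map; apply/funext => z.
  by rewrite !mul0r !addr0.
have /choice[C /choice[B0 /choice[B1 CB]]] :
    forall p : 'I_d * seq 'I_d * seq 'I_d, exists C B0 B1, 0 <= C /\
    forall r x, `|r| <= 1 -> [/\ m p.1.1 p.1.2 p.2 r x =
       (p.1.2 == p.2)%:R + r * B0 x + r ^+ 2 * B1 r x, `|B0 x| <= C & `|B1 r x| <= C].
  move=> [[i s] t]; have [C [B0 [B1 [C0 H]]]] := pf_expand (pm i s t).
  exists C, B0, B1; split=> // r x r1; have [-> _ ? ?] := H r x r1.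
  by rewrite m0.
pose CC := \sum_i \sum_(s <- W) \sum_(t <- W) C (i, s, t).
have Cle i s t : s \in W -> t \in W -> C (i, s, t) <= CC.
  have C0 p : 0 <= C p by have [] := CB p.
  move=> sW tW; rewrite /CC (bigD1 i)//= (bigD1_seq s) ?uniq_words//=.
  rewrite (bigD1_seq t) ?uniq_words//= -!addrA lerDl.
  by rewrite !addr_ge0// ?sumr_ge0// => *; rewrite ?sumr_ge0// => *; rewrite ?sumr_ge0.
have CC0 : 0 <= CC.
  by apply: sumr_ge0 => i _; apply: sumr_ge0 => s _; apply: sumr_ge0 => t _; have [] := CB (i, s, t).
pose K1 := 1 + 5 * (CC * (size W)%:R) ^+ 2.
have K1_gt0 : 0 < K1 by rewrite ltr_pwDl// mulr_ge0// sqr_ge0.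
(* With e = K1 r^2 <= 1/2, the bound (1 - e) q <= Q implies q <= (1 + 2 e) Q, because (1 + 2 e) (1 -
   e) >= 1. *)
exists (2 * K1); first exact: mulr_gt0.
move=> r f Q r1 Kr sf fQ x.
have r1' : `|- r| <= 1 by rewrite normrN.
pose y s := iter_partial s (walk r f) x.
pose D i r t := iter_partial t f (walk_map i r x).
have yE s : s \in W -> y s = \sum_i (2 * d%:R)^-1 *
    (\sum_(t <- W) m i s t r x * D i r t + \sum_(t <- W) m i s t (- r) x * D i (- r) t).
  rewrite mem_words => s4; rewrite /y /walk.
  have sm i e : smooth (fun x => walk_factor e x * f (walk_map i e x)).
    apply: smoothM; first exact: smooth_walk_factor.
    by apply: smooth_chain => // l; exact: smooth_walk_map.
  rewrite iter_partial_sum; last first.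
    by move=> i; apply: smoothM; [exact: smooth_cst|exact: smoothD].
  apply: eq_bigr => i _; rewrite iter_partialZ; last exact: smoothD.
  rewrite iter_partialD//; congr (_ * (_ + _));
    by apply: iter_partial_pullback => // [|l]; [exact: smooth_walk_factor|exact: smooth_walk_map].
set q := jet_sq _ _.
have q0 : 0 <= q by apply: sumr_ge0 => s _; exact: sqr_ge0.
pose Z i e t := \sum_(s <- W) y s * m i s t e x.
have qE : q = \sum_i (2 * d%:R)^-1 *
    (\sum_(t <- W) Z i r t * D i r t + \sum_(t <- W) Z i (- r) t * D i (- r) t).
  have swap i e : \sum_(t <- W) Z i e t * D i e t =
      \sum_(s <- W) y s * \sum_(t <- W) m i s t e x * D i e t.
    under eq_bigr do rewrite mulr_suml.
    rewrite exchange_big/=; apply: eq_bigr => s _; rewrite mulr_sumr.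
    by apply: eq_bigr => t _; rewrite mulrA.
  transitivity (\sum_(s <- W) y s * y s); first by apply: eq_bigr => s _; rewrite expr2.
  rewrite big_seq; under eq_bigr => s sW do rewrite {2}(yE s sW) mulr_sumr.
  rewrite -big_seq exchange_big/=; apply: eq_bigr => i _.
  rewrite !swap -big_split/= mulr_sumr; apply: eq_bigr => s _.
  by rewrite mulrCA mulrDr.
have dn0 : d%:R != 0 :> R by rewrite pnatr_eq0 -lt0n.
have main : q <= (1 + K1 * r ^+ 2) * q / 2 + Q / 2.
  rewrite {1}qE.
  apply: (@le_trans _ _ (\sum_(i < d) d%:R^-1 * ((1 + K1 * r ^+ 2) * q / 2 + Q / 2))); last first.
    by rewrite sumr_const card_ord -[_ *+ d]mulr_natl mulrA divff// mul1r.
  apply: ler_sum => i _; rewrite invfM [2^-1 * _]mulrC -[in leLHS]mulrA ler_wpM2l ?invr_ge0//.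
  have young e : \sum_(t <- W) Z i e t * D i e t <=
      (\sum_(t <- W) Z i e t ^+ 2) / 2 + Q / 2.
    apply: (@le_trans _ _ ((\sum_(t <- W) Z i e t ^+ 2) / 2 + jet_sq f (walk_map i e x) / 2)).
      rewrite !mulr_suml -big_split/=; apply: ler_sum => t _.
      have := sqr_ge0 (Z i e t - D i e t); rewrite /D; lra.
    by rewrite lerD2l ler_wpM2r.
  have := @dual_average R _ W (uniq_words d 4) y (fun s t => B0 (i, s, t) x)
    (fun s t => B1 (i, s, t) r x) (fun s t => B1 (i, s, t) (- r) x) CC r CC0 r1.
  rewrite (_ : \sum_(s <- W) y s ^+ 2 = q)// -/K1.
  have H s t : s \in W -> t \in W -> [/\ `|B0 (i, s, t) x| <= CC,
      `|B1 (i, s, t) r x| <= CC & `|B1 (i, s, t) (- r) x| <= CC].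
    move=> sW tW; have [_ H] := CB (i, s, t); have Ci := Cle i s t sW tW.
    have [_ h1 h2] := H r x r1; have [_ _ h3] := H _ x r1'.
    by split; apply: le_trans Ci.
  move=> /(_ H) dual.
  have dual' : (\sum_(t <- W) Z i r t ^+ 2 + \sum_(t <- W) Z i (- r) t ^+ 2) / 2 <=
      (1 + K1 * r ^+ 2) * q.
    apply: le_trans dual; rewrite -big_split/= mulr_suml.
    rewrite le_eqVlt; apply/orP; left; apply/eqP; apply: eq_bigr => t _.
    congr ((_ ^+ 2 + _ ^+ 2) / _); apply: eq_bigr => s _; congr (_ * _).
      by have [_ H'] := CB (i, s, t); have [-> _ _] := H' r x r1.
    by have [_ H'] := CB (i, s, t); have [-> _ _] := H' _ x r1'; rewrite sqrrN mulNr.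
  have := young r; have := young (- r); lra.
have Q0 : 0 <= Q.
  by apply: le_trans (fQ x); apply: sumr_ge0 => s _; exact: sqr_ge0.
have e0 : 0 <= K1 * r ^+ 2 by rewrite mulr_ge0 ?sqr_ge0// ltW.
have E : 2 * K1 * r ^+ 2 = 2 * (K1 * r ^+ 2) by rewrite mulrA.
rewrite E in Kr *; move: (K1 * r ^+ 2) e0 main Kr => e e0 main Kr.
have h : (1 - e) * q <= Q by lra.
have e2 : 0 <= 1 + 2 * e by lra.
have e3 : 0 <= q * (e * (1 - 2 * e)) by rewrite !mulr_ge0//; lra.
by have := ler_wpM2l e2 h; lra.
Qed.

End walk.

(** * Taylor expansions and the generator *)

Section taylor.
Context {R : realType}.

Lemma derive_bounded_le (g g' : R -> R) (M : R) :
  (forall t : R, is_derive t (1 : R) g (g' t)) ->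
  (forall t, 0 <= t <= 1 -> `|g' t| <= M) ->
  forall t, 0 <= t <= 1 -> `|g t - g 0| <= M.
Proof.
move=> dg gM t /andP[t0 t1].
have M0 : 0 <= M by apply: le_trans (gM 0 _); rewrite ?lexx ?ler01.
have cg : {within `[0, t], continuous g}.
  apply: continuous_subspaceT => x; apply: differentiable_continuous.
  by apply/derivable1_diffP; have [] := dg x.
have [u + ->] := @MVT_segment R g g' 0 t t0 (fun x _ => dg x) cg.
rewrite in_itv/= => /andP[u0 ut]; rewrite subr0 normrM (ger0_norm t0).
rewrite -[leRHS]mulr1; apply: ler_pM => //.
by apply: gM; rewrite u0 (le_trans ut).
Qed.

(** The remainder is measured by the oscillation of the second derivative, in order to apply to
    functions that are only C^2. *)
Lemma taylor2_le (g g1 g2 : R -> R) (e : R) :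
  (forall t : R, is_derive t (1 : R) g (g1 t)) -> (forall t : R, is_derive t (1 : R) g1 (g2 t)) ->
  (forall t, 0 <= t <= 1 -> `|g2 t - g2 0| <= e) ->
  `|g 1 - g 0 - g1 0 - g2 0 / 2| <= e.
Proof.
move=> dg dg1 g2e.
have I01 : ((0 : R) <= 1) && ((1 : R) <= 1) by rewrite ler01 lexx.
have r1 t : 0 <= t <= 1 -> `|g1 t - g1 0 - t * g2 0| <= e.
  move=> t01.
  have := @derive_bounded_le (fun t => g1 t - t * g2 0) (fun t => g2 t - g2 0) e _ g2e t t01.
  rewrite mul0r subr0 [_ - _ - g1 0]addrAC; apply=> s.
  by apply: is_derive_eq; rewrite scaler0 add0r [g2 0 *: 1]mulr1.
have := @derive_bounded_le (fun t => g t - t * g1 0 - t ^+ 2 * (g2 0 / 2))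
  (fun t => g1 t - g1 0 - t * g2 0) e _ r1 1 I01.
rewrite !mul1r expr1n mul1r expr0n !mul0r !subr0.
rewrite (_ : _ - g 0 = g 1 - g 0 - g1 0 - g2 0 / 2); last by ring.
apply=> s; apply: is_derive_eq.
by rewrite !scaler0 !add0r [g1 0 *: 1]mulr1 /GRing.scale/= mulr1; field.
Qed.

Lemma taylor4_le (g g1 g2 g3 g4 : R -> R) (M : R) :
  (forall t : R, is_derive t (1 : R) g (g1 t)) -> (forall t : R, is_derive t (1 : R) g1 (g2 t)) ->
  (forall t : R, is_derive t (1 : R) g2 (g3 t)) -> (forall t : R, is_derive t (1 : R) g3 (g4 t)) ->
  (forall t, `|g4 t| <= M) ->
  `|g 1 - g 0 - g1 0 - g2 0 / 2 - g3 0 / 6| <= M.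
Proof.
move=> d0 d1 d2 d3 g4M.
have r3 t : 0 <= t <= 1 -> `|g3 t - g3 0| <= M.
  by move=> t01; apply: (@derive_bounded_le g3 g4).
have := @taylor2_le (fun t => g t - t ^+ 3 * (g3 0 / 6))
  (fun t => g1 t - t ^+ 2 * (g3 0 / 2)) (fun t => g2 t - t * g3 0) M.
rewrite expr1n !expr0n !mul0r !mul1r !subr0.
rewrite (_ : g 1 - _ - g 0 - _ - _ = g 1 - g 0 - g1 0 - g2 0 / 2 - g3 0 / 6); last by ring.
apply=> [t|t|t t01].
- by apply: is_derive_eq; rewrite !scaler0 !add0r /GRing.scale/= mulr1; field.
- by apply: is_derive_eq; rewrite !scaler0 !add0r /GRing.scale/= mulr1; field.
- have := @derive_bounded_le (fun t => g2 t - t * g3 0) (fun t => g3 t - g3 0) M _ r3 t t01.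
  rewrite mul0r subr0; apply=> s.
  by apply: is_derive_eq; rewrite scaler0 add0r [g3 0 *: 1]mulr1.
Qed.

End taylor.

(** * Directional derivatives and expansions along lines *)

Section directional.
Context {R : realType} (n : nat).
Implicit Types (f g : 'cV[R]_n -> R) (u v : 'cV[R]_n).

Definition norm1 v : R := \sum_l `|v l ord0|.

Lemma norm1_ge0 v : 0 <= norm1 v.
Proof. exact: sumr_ge0. Qed.

Lemma norm1D u v : norm1 (u + v) <= norm1 u + norm1 v.
Proof.
rewrite /norm1 -big_split/=; apply: ler_sum => l _; rewrite mxE.
exact: ler_normD.
Qed.

Lemma norm1N v : norm1 (- v) = norm1 v.
Proof. by apply: eq_bigr => l _; rewrite mxE normrN. Qed.

Lemma norm1Z (k : R) v : norm1 (k *: v) = `|k| * norm1 v.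
Proof. by rewrite mulr_sumr; apply: eq_bigr => l _; rewrite mxE normrM. Qed.

Definition dird v f x : R := \sum_l v l ord0 * partial l f x.

Lemma dirdDl u v f : dird (u + v) f = fun x => dird u f x + dird v f x.
Proof.
apply/funext => x; rewrite -big_split/=; apply: eq_bigr => l _.
by rewrite mxE mulrDl.
Qed.

Lemma dirdZl (k : R) v f x : dird (k *: v) f x = k * dird v f x.
Proof. by rewrite mulr_sumr; apply: eq_bigr => l _; rewrite mxE mulrA. Qed.

Lemma dirdNl v f : dird (- v) f = fun x => - dird v f x.
Proof. by apply/funext => x; rewrite -scaleN1r dirdZl mulN1r. Qed.

Lemma smooth_dird v f : smooth f -> smooth (dird v f).
Proof.
move=> sf; apply: smooth_sum => l; apply: smoothM; first exact: smooth_cst.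
exact: smooth_partial.
Qed.

Lemma dirdD v f g : smooth f -> smooth g ->
  dird v (fun x => f x + g x) = fun x => dird v f x + dird v g x.
Proof.
move=> sf sg; apply/funext => x; rewrite -big_split/=; apply: eq_bigr => l _.
by rewrite partialD ?mulrDr//; exact: smooth_differentiable.
Qed.

Lemma dirdN v f : smooth f -> dird v (fun x => - f x) = fun x => - dird v f x.
Proof.
move=> sf; apply/funext => x; rewrite -sumrN; apply: eq_bigr => l _.
rewrite -mulrN; congr (_ * _); apply: deriveN.
exact/diff_derivable/smooth_differentiable.
Qed.

Lemma is_derive_line f x v (t : R) : differentiable f (x + t *: v) ->
  is_derive t (1 : R) (fun t => f (x + t *: v)) (dird v f (x + t *: v)).
Proof.
move=> df.
have dl : is_diff t (fun t : R => x + t *: v) (fun h => h *: v).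
  have := is_diffD (is_diff_cst x t) (is_diff_scalel t v).
  by rewrite (_ : cst x + _ = (fun t : R => x + t *: v))// => H; apply: is_diff_eq; rewrite ?add0r.
have df' : differentiable (f \o (fun t : R => x + t *: v)) t.
  by apply: differentiable_comp.
apply: DeriveDef; first exact/derivable1_diffP.
rewrite (_ : (fun t => _) = f \o (fun t : R => x + t *: v))// deriveE// diff_comp//=.
by rewrite diff_val scale1r diff_partial.
Qed.

Lemma foldr_dird_rcons f vs v :
  foldr dird f (rcons vs v) = foldr dird (dird v f) vs.
Proof. exact: foldr_rcons. Qed.

Lemma dirds_le f vs (M : R) : smooth f ->
  (forall s x, size s = size vs -> `|iter_partial s f x| <= M) ->
  forall x, `|foldr dird f vs x| <= \prod_(v <- vs) norm1 v * M.
Proof.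
elim/last_ind: vs f M => [|vs v IH] f M sf fM x.
  by rewrite big_nil mul1r; exact: (fM [::]).
rewrite foldr_dird_rcons -cats1 big_cat big_seq1 -mulrA; apply: IH => [|s y sv].
  exact: smooth_dird.
rewrite /dird iter_partial_sum; last first.
  by move=> l; apply: smoothM; [exact: smooth_cst|exact: smooth_partial].
apply: (le_trans (ler_norm_sum _ _ _)); rewrite mulr_suml; apply: ler_sum => l _.
rewrite iter_partialZ; last exact: smooth_partial.
rewrite normrM ler_wpM2l// -iter_partial_rcons; apply: fM.
by rewrite !size_rcons sv.
Qed.

Lemma taylor2_line f x v (e : R) :
  (forall y, differentiable f y) -> (forall l y, differentiable (partial l f) y) ->
  (forall t, 0 <= t <= 1 -> `|dird v (dird v f) (x + t *: v) - dird v (dird v f) x| <= e) ->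
  `|f (x + v) - f x - dird v f x - dird v (dird v f) x / 2| <= e.
Proof.
move=> df dpf fe.
have dd y : differentiable (dird v f) y.
  by apply: differentiable_sumF => l; apply: differentiableM => //; exact: differentiable_cst.
have := @taylor2_le R (fun t => f (x + t *: v)) (fun t => dird v f (x + t *: v))
  (fun t => dird v (dird v f) (x + t *: v)) e.
rewrite !scale0r !addr0 !scale1r; apply => // t; exact: is_derive_line.
Qed.

Lemma taylor1_line f x v (M : R) : smooth f ->
  (forall s y, (size s <= 2)%N -> `|iter_partial s f y| <= M) ->
  `|f (x + v) - f x - dird v f x| <= norm1 v ^+ 2 * M * 2.
Proof.
move=> sf fM.
have H y : `|dird v (dird v f) y| <= norm1 v ^+ 2 * M.
  have := @dirds_le f [:: v; v] M sf _ y; rewrite !big_cons big_nil mulr1.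
  by apply => s z /= s2; apply: fM; rewrite s2.
have T := @taylor2_line f x v (norm1 v ^+ 2 * M *+ 2).
have {}T : `|f (x + v) - f x - dird v f x - dird v (dird v f) x / 2| <= norm1 v ^+ 2 * M *+ 2.
  apply: T => [y|l y|t _].
  - exact: smooth_differentiable.
  - exact/smooth_differentiable/smooth_partial.
  - by rewrite mulr2n; apply: (le_trans (ler_normB _ _)); apply: lerD.
have {}T : `|f (x + v) - f x - dird v f x| <= norm1 v ^+ 2 * M.
  have := @derive_bounded_le R (fun t => f (x + t *: v) - t * dird v f x)
    (fun t => dird v f (x + t *: v) - dird v f x) (norm1 v ^+ 2 * M).
  have I01 : ((0 : R) <= 1) && ((1 : R) <= 1) by rewrite ler01 lexx.
  have d0 g (t : R) : smooth g -> is_derive t (1 : R) (fun t : R => g (x + t *: v)) (dird v g (x + t *: v)).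
    by move=> sg; apply: is_derive_line; exact: smooth_differentiable.
  move=> /(_ _ _ 1 I01); rewrite scale1r scale0r mul0r mul1r subr0 addr0 addrAC.
  apply=> t.
    have := d0 f t sf => ?; apply: is_derive_eq.
    by rewrite scaler0 add0r [dird v f x *: 1]mulr1.
  move=> t01; have := @derive_bounded_le R (fun t => dird v f (x + t *: v)) _ (norm1 v ^+ 2 * M)
    (fun t => d0 _ t (smooth_dird v sf)) (fun t _ => H _) t t01.
  by rewrite scale0r addr0.
apply: (le_trans T); rewrite mulr_natr mulr2n lerDl.
exact: le_trans (H x).
Qed.

Lemma taylor4_line f x v (M : R) : smooth f -> jet_le f M ->
  `|f (x + v) - f x - dird v f x - dird v (dird v f) x / 2 -
    dird v (dird v (dird v f)) x / 6| <= norm1 v ^+ 4 * M.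
Proof.
move=> sf fM.
have H y : `|dird v (dird v (dird v (dird v f))) y| <= norm1 v ^+ 4 * M.
  have := @dirds_le f [:: v; v; v; v] M sf _ y; rewrite !big_cons big_nil mulr1.
  by rewrite !exprS expr0 mulr1; apply => s z /= s2; apply: fM; rewrite s2.
have d0 g (t : R) : smooth g -> is_derive t (1 : R) (fun t : R => g (x + t *: v)) (dird v g (x + t *: v)).
  by move=> sg; apply: is_derive_line; exact: smooth_differentiable.
have s1 := smooth_dird v sf; have s2 := smooth_dird v s1; have s3 := smooth_dird v s2.
have := @taylor4_le R (fun t => f (x + t *: v)) _ _ _ _ (norm1 v ^+ 4 * M)
  (fun t => d0 f t sf) (fun t => d0 _ t s1) (fun t => d0 _ t s2) (fun t => d0 _ t s3) (fun t => H _).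
by rewrite !scale0r !addr0 scale1r.
Qed.

Local Opaque dird.

(** In the sum of the expansions along be + eta and be - eta, the terms odd in eta cancel. Apart
    from the displayed ones, the terms of order two and three contain be twice, three times, or once
    together with eta twice. If be is of order t and eta of order t^(1/2), all of them and the
    fourth order remainder are of order t^2. *)
Lemma symmetric_taylor f x be eta (M : R) : smooth f -> jet_le f M ->
  `|f (x + be + eta) + f (x + be - eta) - 2 * f x - 2 * dird be f x -
    dird eta (dird eta f) x| <=
  M * (norm1 be ^+ 2 + (norm1 be ^+ 3 + 3 * norm1 be * norm1 eta ^+ 2) / 3 +
       2 * (norm1 be + norm1 eta) ^+ 4).
Proof.
move=> sf fM; set B := norm1 be; set H := norm1 eta.
have M0 : 0 <= M by exact: le_trans (fM [::] x isT).
have [p pE] : {p | p = be + eta} by exists (be + eta).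
have [me meE] : {me | me = - eta} by exists (- eta).
have [m mE] : {m | m = be + me} by exists (be + me).
have -> : x + be + eta = x + p by rewrite pE addrA.
have -> : x + be - eta = x + m by rewrite mE meE addrA.
have T1 := taylor4_line x p sf fM; have T2 := taylor4_line x m sf fM.
have sd v g : smooth g -> smooth (dird v g) by exact: smooth_dird.
have b4 v : norm1 v <= B + H -> norm1 v ^+ 4 * M <= (B + H) ^+ 4 * M.
  by move=> vBH; rewrite ler_wpM2r// lerXn2r ?nnegrE ?norm1_ge0// addr_ge0 ?norm1_ge0.
have {}T1 := le_trans T1 (b4 p _); have {}T2 := le_trans T2 (b4 m _).
have pBH : norm1 p <= B + H by rewrite pE; exact: norm1D.
have mBH : norm1 m <= B + H.
  by rewrite mE meE /H -(norm1N eta); exact: norm1D.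
move: (T1 pBH) (T2 mBH) => {}T1 {}T2.
have D2 (v w q : 'cV[R]_n) : q = v + w -> [/\ dird q f x = dird v f x + dird w f x,
    dird q (dird q f) x = dird v (dird v f) x + dird v (dird w f) x +
      dird w (dird v f) x + dird w (dird w f) x &
    dird q (dird q (dird q f)) x =
      dird v (dird v (dird v f)) x + dird v (dird v (dird w f)) x +
      dird v (dird w (dird v f)) x + dird v (dird w (dird w f)) x +
      dird w (dird v (dird v f)) x + dird w (dird v (dird w f)) x +
      dird w (dird w (dird v f)) x + dird w (dird w (dird w f)) x].
  move=> qE.
  have L g : dird q g = fun x => dird v g x + dird w g x by rewrite qE dirdDl.
  have E g : smooth g -> dird q (dird q g) =
      fun x => (dird v (dird v g) x + dird v (dird w g) x) +
      (dird w (dird v g) x + dird w (dird w g) x).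
    by move=> sg; rewrite (L (dird q g)) (L g) !dirdD//; exact: sd.
  split; first by rewrite L.
  - by rewrite E// !addrA.
  - rewrite E; last exact: sd.
    have F u u' : dird u (dird u' (dird q f)) x =
        dird u (dird u' (dird v f)) x + dird u (dird u' (dird w f)) x.
      rewrite (L f) dirdD; [|exact: sd..].
      by rewrite dirdD; [|exact/sd/sd..].
    have G (z z' z1 z2 z3 z4 z5 z6 z7 z8 a1 a2 : R) : z = z1 + z2 -> z' = z3 + z4 ->
        a1 = z5 + z6 -> a2 = z7 + z8 ->
        z + z' + (a1 + a2) = z1 + z2 + z3 + z4 + z5 + z6 + z7 + z8.
      by move=> -> -> -> ->; rewrite !addrA.
    exact: (G _ _ _ _ _ _ _ _ _ _ _ _ (F v v) (F v w) (F w v) (F w w)).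
have [p1 p2 p3] := D2 be eta p pE; have [m1 m2 m3] := D2 be me m mE.
have N g : dird me g = fun x => - dird eta g x by rewrite meE dirdNl.
have Nd u g : smooth g -> dird u (dird me g) = fun x => - dird u (dird eta g) x.
  by move=> sg; rewrite N dirdN//; exact: sd.
have Ndd u v g : smooth g ->
    dird u (dird v (dird me g)) = fun x => - dird u (dird v (dird eta g)) x.
  by move=> sg; rewrite Nd// dirdN//; exact/sd/sd.
have ev (g h : 'cV[R]_n -> R) : g = h -> g x = h x by move=> ->.
have evN (g h : 'cV[R]_n -> R) (z : R) : g = (fun x => - h x) -> h x = - z -> g x = z.
  by move=> -> ->; rewrite opprK.
have se := sd eta f sf; have sb := sd be f sf.
have k1 := ev _ _ (N f).
have k2 := ev _ _ (Nd be f sf).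
have k3 := ev _ _ (N (dird be f)).
have k4 := evN _ _ _ (Nd me f sf) (ev _ _ (N (dird eta f))).
have k5 := ev _ _ (Ndd be be f sf).
have k6 := ev _ _ (Nd be (dird be f) sb).
have k7 := ev _ _ (N (dird be (dird be f))).
have k8 := evN _ _ _ (Ndd be me f sf) (ev _ _ (Nd be (dird eta f) se)).
have k9 := evN _ _ _ (Ndd me be f sf) (ev _ _ (N (dird be (dird eta f)))).
have k10 := evN _ _ _ (Nd me (dird be f) sb) (ev _ _ (N (dird eta (dird be f)))).
have k11 := evN _ _ _ (Ndd me me f sf) (ev _ _ (Nd me (dird eta f) se)).
have k12 := ev _ _ (N (dird eta (dird eta f))).
rewrite k12 in k11.
have := le_trans (ler_normD _ _) (lerD T1 T2).
rewrite p1 p2 p3 m1 m2 m3 k1 k2 k3 k4 k5 k6 k7 k8 k9 k10 k11.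
have B3 u v w : `|dird u (dird v (dird w f)) x| <= norm1 u * (norm1 v * norm1 w) * M.
  have := @dirds_le f [:: u; v; w] M sf _ x; rewrite !big_cons big_nil mulr1.
  by apply => s z /= s2; apply: fM; rewrite s2.
have B2 u v : `|dird u (dird v f) x| <= norm1 u * norm1 v * M.
  have := @dirds_le f [:: u; v] M sf _ x; rewrite !big_cons big_nil mulr1.
  by apply => s z /= s2; apply: fM; rewrite s2.
move: (B2 be be) (B3 be be be) (B3 be eta eta) (B3 eta be eta) (B3 eta eta be).
rewrite -/B -/H.
move: (dird be (dird be f) x) (dird be (dird be (dird be f)) x)
  (dird be (dird eta (dird eta f)) x) (dird eta (dird be (dird eta f)) x)
  (dird eta (dird eta (dird be f)) x) (dird be (dird be (dird eta f)) x)
  (dird be (dird eta (dird be f)) x) (dird eta (dird be (dird be f)) x)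
  (dird eta (dird eta (dird eta f)) x) (dird be (dird eta f) x)
  (dird eta (dird be f) x) (dird eta (dird eta f) x) (dird be f x) (dird eta f x)
  (f (x + p)) (f (x + m)) (f x) => q1 q2 q3 q4 q5
  q6 q7 q8 q9 o1 o2 o3 o4 o5 o6 o7 o8 h1 h2 h3 h4 h5.
clear -h1 h2 h3 h4 h5; clearbody B H.
set X := (X in `|X| <= _ -> _) => XM.
rewrite (_ : _ - _ = X + (q1 + (q2 + q3 + q4 + q5) / 3)); last by rewrite /X; field.
apply: (le_trans (ler_normD _ _)); apply: (le_trans (lerD XM (ler_normD _ _))).
have h6 : `|(q2 + q3 + q4 + q5) / 3| <= (B * (B * B) + 3 * (B * (H * H))) * M / 3.
  rewrite normrM (ger0_norm (_ : 0 <= 3^-1))// ler_wpM2r//.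
  apply: (le_trans (ler_normD _ _)); apply: (le_trans (lerD (ler_normD _ _) (lexx _))).
  apply: (le_trans (lerD (lerD (ler_normD _ _) (lexx _)) (lexx _))); lra.
lra.
Qed.

Local Transparent dird.

End directional.

(** * The generator and the consistency of one step of the walk *)

Section generator.
Context {R : realType} (d : nat).
Hypothesis d_gt0 : (0 < d)%N.
Variables (c : 'cV[R]_d -> R) (b : 'cV[R]_d -> 'cV[R]_d) (sigma : 'cV[R]_d -> 'M[R]_d).
Hypothesis Cc : Cb_infty c.
Hypothesis Cb_b : Cb_infty_mx b.
Hypothesis Cb_sigma : Cb_infty_mx sigma.

(** This is A_b + F_b when F_b is multiplication by c. *)
Definition gen (f : 'cV[R]_d -> R) (x : 'cV[R]_d) : R := c x * f x + op_A sigma b f x.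

Lemma dird2E (u v : 'cV[R]_d) f x : (forall l, differentiable (partial l f) x) ->
  dird u (dird v f) x =
  \sum_k \sum_l u k ord0 * v l ord0 * partial k (partial l f) x.
Proof.
move=> df; apply: eq_bigr => k _; rewrite /dird partial_sumF; last first.
  by move=> l; apply: differentiableM => //; exact: differentiable_cst.
rewrite mulr_sumr; apply: eq_bigr => l _.
by rewrite partialM ?partial_cst ?mulr0 ?addr0 ?mulrA//; exact: differentiable_cst.
Qed.

Lemma dirdZ (k : R) (u : 'cV[R]_d) f x : smooth f ->
  dird u (fun z => k * f z) x = k * dird u f x.
Proof.
move=> sf; rewrite mulr_sumr; apply: eq_bigr => l _.
rewrite mulrCA; congr (_ * _); rewrite partialM; last 2 first.
- exact: differentiable_cst.
- exact: smooth_differentiable.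
by rewrite partial_cst mulr0 addr0.
Qed.

(** The directions are frozen at x and are not differentiated: this is the Ito form of the second
    order part, as a sum of squares along the columns of sigma. *)
Lemma op_A_dird f x : (forall l, differentiable (partial l f) x) ->
  op_A sigma b f x = dird (b x) f x +
    2^-1 * \sum_i dird (col i (sigma x)) (dird (col i (sigma x)) f) x.
Proof.
move=> df; rewrite /op_A addrC; congr (_ + _ * _).
under [RHS]eq_bigr do rewrite dird2E//.
rewrite [RHS]exchange_big/=; apply: eq_bigr => k _.
rewrite [RHS]exchange_big/=; apply: eq_bigr => l _.
rewrite /diffusion_coef /diffusion_mx mxE mulr_suml; apply: eq_bigr => i _.
by rewrite !mxE.
Qed.

Lemma Cb_diffusion_coef i j : Cb_infty (diffusion_coef sigma i j).
Proof.
rewrite (_ : diffusion_coef sigma i j = fun x => \sum_k sigma x i k * sigma x j k).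
  by apply: Cb_sum => k; apply: CbM; exact: Cb_sigma.
by apply/funext => x; rewrite /diffusion_coef /diffusion_mx mxE; apply: eq_bigr => k _; rewrite mxE.
Qed.

Lemma smooth_gen f : smooth f -> smooth (gen f).
Proof.
move=> sf; apply: smoothD; first by apply: smoothM => //; exact: Cb_smooth.
apply: smoothD.
  apply: smoothM; first exact: smooth_cst.
  apply: smooth_sum => i; apply: smooth_sum => j; apply: smoothM.
    by apply: Cb_smooth; exact: Cb_diffusion_coef.
  by do 2?apply: smooth_partial.
apply: smooth_sum => i; apply: smoothM; first by apply: Cb_smooth; exact: Cb_b.
exact: smooth_partial.
Qed.

Lemma Cb_jet_bound k (f : 'cV[R]_d -> R) : Cb_infty f -> exists2 M : R, 0 <= M &
  forall s x, (size s <= k)%N -> `|iter_partial s f x| <= M.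
Proof.
move=> Cf.
have /choice[B BP] : forall s, exists B : R, 0 <= B /\ forall x, `|iter_partial s f x| <= B.
  move=> s; have [_ [B sB]] := Cf s; exists B; split => //.
  exact: le_trans (sB 0).
exists (\sum_(s <- words d k) B s) => [|s x sk].
  by apply: sumr_ge0 => s _; have [] := BP s.
rewrite (bigD1_seq s) ?uniq_words ?mem_words//=.
apply: (@le_trans _ _ (B s)); first by have [_] := BP s.
by rewrite lerDl; apply: sumr_ge0 => t _; have [] := BP t.
Qed.

Lemma gen_jet : exists2 C : R, 0 <= C & forall f M, smooth f -> jet_le f M ->
  forall s x, (size s <= 2)%N -> `|iter_partial s (gen f) x| <= C * M.
Proof.
have [Mc Mc0 cM] := Cb_jet_bound 2 Cc.
have /choice[Mb MbP] : forall i, exists B : R, 0 <= B /\ forall s x, (size s <= 2)%N ->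
    `|iter_partial s (fun x => b x i ord0) x| <= B.
  by move=> i; have [B B0 BP] := Cb_jet_bound 2 (Cb_b i ord0); exists B.
have /choice[Ma MaP] : forall p, exists B : R, 0 <= B /\ forall s x, (size s <= 2)%N ->
    `|iter_partial s (diffusion_coef sigma p.1 p.2) x| <= B.
  by move=> p; have [B B0 BP] := Cb_jet_bound 2 (Cb_diffusion_coef p.1 p.2); exists B.
exists (4 * Mc + (2^-1 * (\sum_i \sum_j 4 * Ma (i, j)) + \sum_i 4 * Mb i)) => [|f M sf fM s x s2].
  rewrite !addr_ge0 ?mulr_ge0 ?sumr_ge0// => i _.
    by apply: sumr_ge0 => j _; rewrite mulr_ge0//; have [] := MaP (i, j).
  by rewrite mulr_ge0//; have [] := MbP i.
have P g h A : smooth g -> smooth h ->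
    (forall s x, (size s <= 2)%N -> `|iter_partial s g x| <= A) ->
    (forall s x, (size s <= 2)%N -> `|iter_partial s h x| <= M) ->
    `|iter_partial s (fun x => g x * h x) x| <= 4 * A * M.
  move=> sg sh gA hM; have := @iter_partialM_le R d 2 g h A M sg sh gA hM s x s2.
  by rewrite -mulrA expr2 (_ : 2 * 2 = 4 :> R)//; ring.
have fM1 i t z : (size t <= 2)%N -> `|iter_partial t (partial i f) z| <= M.
  by move=> t2; rewrite -iter_partial_rcons; apply: fM; rewrite size_rcons ltnS (leq_trans t2).
have fM2 i j t z : (size t <= 2)%N -> `|iter_partial t (partial i (partial j f)) z| <= M.
  by move=> t2; rewrite -!iter_partial_rcons; apply: fM; rewrite !size_rcons !ltnS.
have sb i : smooth (fun x => b x i ord0) by apply: Cb_smooth; exact: Cb_b.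
have sa i j : smooth (diffusion_coef sigma i j).
  by apply: Cb_smooth; exact: Cb_diffusion_coef.
have s1 i : smooth (partial i f) by exact: smooth_partial.
have s2' i j : smooth (partial i (partial j f)) by exact/smooth_partial/s1.
have sS i : smooth (fun x => \sum_j diffusion_coef sigma i j x * partial i (partial j f) x).
  by apply: smooth_sum => j; exact: smoothM.
have sSS := smooth_sum (index_enum 'I_d) sS.
have sBi i : smooth (fun x => b x i ord0 * partial i f x) by exact: smoothM.
have sB := smooth_sum (index_enum 'I_d) sBi.
rewrite /gen /op_A iter_partialD; first last.
- by apply: smoothD => //; apply: smoothM => //; exact: smooth_cst.
- by apply: smoothM => //; exact: Cb_smooth.
rewrite iter_partialD//; last by apply: smoothM => //; exact: smooth_cst.
rewrite iter_partialZ// (iter_partial_sum _ _ sS) (iter_partial_sum _ _ sBi).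
apply: (le_trans (ler_normD _ _)); rewrite mulrDl; apply: lerD.
  apply: P => //; first exact: Cb_smooth.
  by move=> t z t2; apply: fM; rewrite (leq_trans t2).
apply: (le_trans (ler_normD _ _)); rewrite mulrDl; apply: lerD.
  rewrite normrM ger0_norm// -mulrA ler_wpM2l//.
  apply: (le_trans (ler_norm_sum _ _ _)); rewrite mulr_suml; apply: ler_sum => i _.
  rewrite iter_partial_sum; last by move=> j; exact: smoothM.
  apply: (le_trans (ler_norm_sum _ _ _)); rewrite mulr_suml; apply: ler_sum => j _.
  by have [_ H] := MaP (i, j); exact: (P _ _ _ (sa i j) (s2' i j) H (fM2 i j)).
apply: (le_trans (ler_norm_sum _ _ _)); rewrite mulr_suml; apply: ler_sum => i _.
by have [_ H] := MbP i; exact: (P _ _ _ (sb i) (s1 i) H (fM1 i)).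
Qed.

Lemma coef_bound : exists2 La : R, 1 <= La & forall x,
  [/\ `|c x| <= La, norm1 (b x) <= La & forall i, norm1 (col i (sigma x)) <= La].
Proof.
have [Mc Mc0 cM] := Cb_bounded Cc.
have /choice[Mb MbP] : forall i, exists B : R, 0 <= B /\ forall x, `|b x i ord0| <= B.
  by move=> i; have [B B0 BP] := Cb_bounded (Cb_b i ord0); exists B; split => //; exact: ltW.
have /choice[Ms MsP] : forall p, exists B : R, 0 <= B /\ forall x, `|sigma x p.1 p.2| <= B.
  move=> p; have [B B0 BP] := Cb_bounded (Cb_sigma p.1 p.2).
  by exists B; split => //; exact: ltW.
have Sb0 : 0 <= \sum_i Mb i by apply: sumr_ge0 => i _; have [] := MbP i.
have Ss0 : 0 <= \sum_i \sum_l Ms (l, i).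
  by apply: sumr_ge0 => i _; apply: sumr_ge0 => l _; have [] := MsP (l, i).
exists (1 + Mc + \sum_i Mb i + \sum_i \sum_l Ms (l, i)) => [|x].
  by rewrite -!addrA lerDl !addr_ge0// ltW.
have Mc0' := ltW Mc0; split.
- have := cM x; lra.
- apply: (@le_trans _ _ (\sum_i Mb i)); last by lra.
  by apply: ler_sum => i _; have [_ H] := MbP i; exact: H.
- move=> i; apply: (@le_trans _ _ (\sum_i \sum_l Ms (l, i))); last by lra.
  rewrite (bigD1 i)//=; apply: (@le_trans _ _ (\sum_l Ms (l, i))).
    by apply: ler_sum => l _; rewrite mxE; have [_ H] := MsP (l, i); exact: H.
  rewrite lerDl; apply: sumr_ge0 => j _; apply: sumr_ge0 => l _.
  by have [] := MsP (l, j).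
Qed.

Local Notation walk := (walk c b sigma).
Local Notation dR := (d%:R : R).

Let d0 : 0 < dR. Proof. by rewrite ltr0n. Qed.

Lemma step_ge0 r : 0 <= r * r / dR.
Proof. by rewrite mulr_ge0 ?invr_ge0// -expr2 sqr_ge0. Qed.

Lemma walkE r f x : walk r f x = (1 + r * r / dR * c x) *
  \sum_(i < d) (2 * dR)^-1 * (f (walk_map b sigma i r x) + f (walk_map b sigma i (- r) x)).
Proof.
rewrite mulr_sumr; apply: eq_bigr => i _.
by rewrite /walk_factor mulrNN -mulrDr mulrCA -[_ / _ * c x]mulrA.
Qed.

Lemma walk_lin r f g e (k : R) x :
  walk r (fun z => f z + k * g z + e z) x = walk r f x + k * walk r g x + walk r e x.
Proof.
rewrite mulr_sumr -!big_split/=; apply: eq_bigr => i _; ring.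
Qed.

Lemma mean_cst (k : R) : \sum_(i < d) (2 * dR)^-1 * (2 * k) = k.
Proof.
rewrite sumr_const card_ord -[_ *+ d]mulr_natl; field.
by rewrite lt0r_neq0.
Qed.

Lemma walk_le La r f M x : (forall x, `|c x| <= La) ->
  (forall z, `|f z| <= M) -> `|walk r f x| <= (1 + r * r / dR * La) * M.
Proof.
move=> cLa fM; rewrite walkE normrM; apply: ler_pM => //.
  have h0 := step_ge0 r.
  apply: (le_trans (ler_normD _ _)); rewrite normr1 lerD2l normrM (ger0_norm h0).
  exact: ler_wpM2l.
apply: (le_trans (ler_norm_sum _ _ _)); rewrite -[leRHS](mean_cst M).
apply: ler_sum => i _; rewrite normrM ger0_norm; last by rewrite invr_ge0 mulr_ge0.
apply: ler_wpM2l; first by rewrite invr_ge0 mulr_ge0.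
by apply: (le_trans (ler_normD _ _)); rewrite mulr2n mulrDl mul1r lerD.
Qed.

Lemma walk_map_sum i r x : walk_map b sigma i r x =
  x + (r * r / dR) *: b x + r *: col i (sigma x).
Proof. by []. Qed.

Local Opaque dird.

(** [symmetric_taylor] is applied with be = h b(x) and eta = r sigma_i(x), where r^2 = d h, and
    averaged over i; every term of its remainder is of order h^2. The weight 1 + h c contributes the
    potential and further products of order h^2. *)
Lemma walk_consistent : exists2 C : R, 0 <= C & forall r f M x, `|r| <= 1 ->
  smooth f -> jet_le f M ->
  `|walk r f x - f x - r * r / dR * gen f x| <= C * M * (r * r / dR) ^+ 2.
Proof.
have [La La1 LaP] := coef_bound.
have La0 : 0 <= La by apply: le_trans La1.
pose C0 := La ^+ 2 + (La ^+ 3 + 3 * La * (dR * La ^+ 2)) / 3 + 2 * (16 * La ^+ 4 * dR ^+ 2).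
have C00 : 0 <= C0 by do ?[apply: addr_ge0 | apply: mulr_ge0 | apply: exprn_ge0].
pose C1 := La + 2^-1 * (dR * La ^+ 2).
exists (C0 + La * C1 + La * C0) => [|r f M x r1 sf fM].
  by do ?[apply: addr_ge0 | apply: mulr_ge0 | apply: exprn_ge0].
have M0 : 0 <= M by exact: le_trans (fM [::] x isT).
set h := r * r / dR.
have h0 : 0 <= h by exact: step_ge0.
have rr : r * r = dR * h by rewrite /h; field; rewrite lt0r_neq0.
have d1 : 1 <= dR by rewrite ler1n.
have hr2 : h <= r * r by rewrite rr ler_peMl.
have hr : h <= `|r|.
  apply: (le_trans hr2); rewrite -expr2 -real_normK ?num_real//.
  by rewrite expr2 -[leRHS]mulr1 ler_wpM2l.
have h1 : h <= 1 by exact: le_trans r1.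
have [cLa bLa sLa] := LaP x.
pose A := op_A sigma b f x.
pose D i := f (walk_map b sigma i r x) + f (walk_map b sigma i (- r) x) - 2 * f x
   - 2 * (h * dird (b x) f x) -
   r * r * dird (col i (sigma x)) (dird (col i (sigma x)) f) x.
have DM i : `|D i| <= C0 * M * h ^+ 2.
  have := symmetric_taylor x (h *: b x) (r *: col i (sigma x)) sf fM.
  rewrite dirdZl (_ : dird (r *: _) _ _ =
     r * r * dird (col i (sigma x)) (dird (col i (sigma x)) f) x); last first.
    rewrite dirdZl (_ : dird (r *: col i (sigma x)) f = fun z => r * dird (col i (sigma x)) f z).
      by rewrite dirdZ ?mulrA//; exact: smooth_dird.
    by apply/funext => z; rewrite dirdZl.
  rewrite -scaleNr => /le_trans; rewrite /D !walk_map_sum mulrNN -/h; apply.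
  rewrite !norm1Z (ger0_norm h0).
  have -> : C0 * M * h ^+ 2 = M * (h ^+ 2 * C0) by rewrite mulrAC mulrC [C0 * _]mulrC.
  apply: ler_wpM2l => //.
  set B := norm1 (b x) in bLa *; set H := norm1 (col i _).
  have HLa : H <= La by exact: sLa.
  have B0 : 0 <= B by exact: norm1_ge0.
  have H0 : 0 <= H by exact: norm1_ge0.
  have r0 : 0 <= `|r| by [].
  have rr' : `|r| ^+ 2 = dR * h by rewrite real_normK ?num_real// expr2.
  have e1 : h * B <= h * La by exact: ler_wpM2l.
  have e2 : `|r| * H <= `|r| * La by exact: ler_wpM2l.
  have e1' : 0 <= h * B by exact: mulr_ge0.
  have e2' : 0 <= `|r| * H by exact: mulr_ge0.
  have hLa0 : 0 <= h * La by exact: mulr_ge0.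
  have a1 : (h * B) ^+ 2 <= h ^+ 2 * La ^+ 2.
    by rewrite -exprMn lerXn2r ?nnegrE.
  have a2 : (h * B) ^+ 3 <= h ^+ 2 * La ^+ 3.
    apply: (@le_trans _ _ ((h * La) ^+ 3)); first by rewrite lerXn2r ?nnegrE.
    by rewrite (exprMn _ h) ler_wpM2r ?exprn_ge0// ler_wiXn2l.
  have a3 : 3 * (h * B) * (`|r| * H) ^+ 2 <= h ^+ 2 * (3 * La * (dR * La ^+ 2)).
    apply: (@le_trans _ _ (3 * (h * La) * (`|r| * La) ^+ 2)).
      have b1 : 3 * (h * B) <= 3 * (h * La) by rewrite ler_wpM2l.
      have b2 : (`|r| * H) ^+ 2 <= (`|r| * La) ^+ 2.
        by rewrite lerXn2r ?nnegrE// mulr_ge0.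
      by apply: ler_pM => //; [exact: mulr_ge0|exact: exprn_ge0].
    by rewrite (exprMn _ `|r|) rr' le_eqVlt; apply/orP; left; apply/eqP; ring.
  have a4 : (h * B + `|r| * H) ^+ 4 <= h ^+ 2 * (16 * La ^+ 4 * dR ^+ 2).
    apply: (@le_trans _ _ ((2 * (`|r| * La)) ^+ 4)).
      apply: lerXn2r; rewrite ?nnegrE; [exact: addr_ge0|by rewrite !mulr_ge0|].
      have e3 : h * La <= `|r| * La by rewrite ler_wpM2r.
      by apply: (le_trans (lerD e1 e2)); rewrite mulr2n mulrDl mul1r lerD2r.
    rewrite (exprMn _ 2) (exprMn _ `|r|) (_ : `|r| ^+ 4 = (`|r| ^+ 2) ^+ 2); last by rewrite -exprM.
    rewrite rr' le_eqVlt; apply/orP; left; apply/eqP; ring.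
  rewrite /C0; move: ((h * B) ^+ 2) ((h * B) ^+ 3)
    (3 * (h * B) * (`|r| * H) ^+ 2) ((h * B + `|r| * H) ^+ 4) a1 a2 a3 a4.
  by move=> *; lra.
have AM : `|A| <= C1 * M.
  rewrite /A op_A_dird; last by move=> l; exact/smooth_differentiable/smooth_partial.
  have B1 v : norm1 v <= La -> `|dird v f x| <= La * M.
    move=> vLa; have := @dirds_le R d f [:: v] M sf _ x.
    rewrite big_cons big_nil mulr1 => H; apply: le_trans (H _) _.
      by move=> s z s2; apply: fM; rewrite s2.
    exact: ler_wpM2r.
  have B2 v : norm1 v <= La -> `|dird v (dird v f) x| <= La ^+ 2 * M.
    move=> vLa; have := @dirds_le R d f [:: v; v] M sf _ x.
    rewrite !big_cons big_nil mulr1 -expr2 => H; apply: le_trans (H _) _.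
      by move=> s z s2; apply: fM; rewrite s2.
    by rewrite ler_wpM2r// lerXn2r ?nnegrE ?norm1_ge0.
  apply: (le_trans (ler_normD _ _)); rewrite mulrDl lerD ?B1//.
  rewrite normrM ger0_norm// -!mulrA ler_wpM2l//.
  apply: (le_trans (ler_norm_sum _ _ _)).
  apply: (@le_trans _ _ (\sum_(i < d) La ^+ 2 * M)); first by apply: ler_sum => i _; exact: B2.
  by rewrite sumr_const card_ord -[_ *+ d]mulr_natl expr2 -[La * La * M]mulrA.
pose E := \sum_(i < d) (2 * dR)^-1 * D i.
have EM : `|E| <= C0 * M * h ^+ 2.
  apply: (@le_trans _ _ (C0 * M * h ^+ 2 / 2)); last first.
    have X0 : 0 <= C0 * M * h ^+ 2 by exact: mulr_ge0 (mulr_ge0 C00 M0) (exprn_ge0 _ h0).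
    by rewrite ler_pdivrMr// mulr_natr mulr2n lerDl.
  rewrite -(mean_cst (C0 * M * h ^+ 2 / 2)); apply: (le_trans (ler_norm_sum _ _ _)).
  have i0 : 0 <= (2 * dR)^-1 by rewrite invr_ge0 mulr_ge0.
  apply: ler_sum => i _; rewrite normrM (ger0_norm i0); apply: ler_wpM2l => //.
  by rewrite mulrC divfK.
have wE : walk r f x = (1 + h * c x) * (f x + h * A + E).
  rewrite walkE -/h; congr (_ * _).
  rewrite /A op_A_dird; last by move=> l; exact/smooth_differentiable/smooth_partial.
  rewrite mulrDr (_ : h * (2^-1 * _) = \sum_(i < d) (2 * dR)^-1 *
     (r * r * dird (col i (sigma x)) (dird (col i (sigma x)) f) x)); last first.
    rewrite mulrA mulr_sumr; apply: eq_bigr => i _; rewrite rr; field.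
    by rewrite lt0r_neq0.
  rewrite -[f x]mean_cst -[h * dird _ _ _]mean_cst /E -!big_split/=.
  apply: eq_bigr => i _; rewrite /D.
  move: (dird (col i _) _ x) (dird (b x) f x) (f (walk_map b sigma i r x)) (f (walk_map b sigma i (- r) x)) (f x).
  by move=> *; ring.
rewrite wE /gen -/A; clearbody E; clearbody A; clear D DM wE; clearbody C1; clearbody C0; clearbody h.
rewrite (_ : _ - _ - _ = E + h * c x * (h * A) + h * c x * E); last by ring.
apply: (le_trans (ler_normD _ _)); apply: (le_trans (lerD (ler_normD _ _) (lexx _))).
rewrite !mulrDl; apply: lerD; first apply: lerD => //.
  rewrite !normrM (ger0_norm h0).
  rewrite (_ : h * _ * (h * _) = h ^+ 2 * (`|c x| * `|A|)); last by ring.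
  by rewrite [leRHS]mulrC ler_wpM2l ?exprn_ge0// -mulrA ler_pM.
rewrite normrM -!mulrA; apply: ler_pM => //; last by rewrite mulrA.
rewrite normrM (ger0_norm h0) -[leRHS]mul1r; exact: ler_pM.
Qed.

Local Transparent dird.

End generator.

(** * Consistency over many steps of the walk *)

Section iterated_walk.
Context {R : realType} (d : nat).
Hypothesis d_gt0 : (0 < d)%N.
Variables (c : 'cV[R]_d -> R) (b : 'cV[R]_d -> 'cV[R]_d) (sigma : 'cV[R]_d -> 'M[R]_d).
Hypothesis Cc : Cb_infty c.
Hypothesis Cb_b : Cb_infty_mx b.
Hypothesis Cb_sigma : Cb_infty_mx sigma.

Local Notation gen := (gen c b sigma).
Local Notation walk := (walk c b sigma).
Local Notation dR := (d%:R : R).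

Local Opaque dird.

(** The first order terms in r cancel between the signs, so two bounded derivatives give an
    increment of order h. The intended argument is [gen f], for which two of the four derivatives of
    f have been spent. *)
Lemma walk_near : exists2 C : R, 0 <= C & forall r f M x, `|r| <= 1 -> smooth f ->
  (forall s x, (size s <= 2)%N -> `|iter_partial s f x| <= M) ->
  `|walk r f x - f x| <= C * M * (r * r / dR).
Proof.
have [La La1 LaP] := coef_bound Cc Cb_b Cb_sigma.
have La0 : 0 <= La by apply: le_trans La1.
pose C0 := 16 * (dR * La ^+ 2) + 2 * La.
have C00 : 0 <= C0 by do ?[apply: addr_ge0 | apply: mulr_ge0 | apply: exprn_ge0].
exists (C0 + La + La * C0) => [|r f M x r1 sf fM].
  exact: addr_ge0 (addr_ge0 C00 La0) (mulr_ge0 La0 C00).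
have M0 : 0 <= M by exact: le_trans (fM [::] x isT).
set h := r * r / dR.
have h0 : 0 <= h by exact: step_ge0.
have d0 : 0 < dR by rewrite ltr0n.
have rr : r * r = dR * h by rewrite /h; field; rewrite lt0r_neq0.
have d1 : 1 <= dR by rewrite ler1n.
have hr2 : h <= r * r by rewrite rr ler_peMl.
have hr : h <= `|r|.
  apply: (le_trans hr2); rewrite -expr2 -real_normK ?num_real//.
  by rewrite expr2 -[leRHS]mulr1 ler_wpM2l.
have h1 : h <= 1 by exact: le_trans r1.
have [cLa bLa sLa] := LaP x.
pose D i := f (walk_map b sigma i r x) + f (walk_map b sigma i (- r) x) - 2 * f x.
have DM i : `|D i| <= C0 * M * h.
  have T e : `|e| = `|r| -> `|f (x + (h *: b x + e *: col i (sigma x))) - f x -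
      (h * dird (b x) f x + e * dird (col i (sigma x)) f x)| <= 8 * (dR * La ^+ 2) * M * h.
    move=> er; have := taylor1_line x (h *: b x + e *: col i (sigma x)) sf fM.
    rewrite dirdDl !dirdZl => /le_trans; apply.
    have n1 : norm1 (h *: b x + e *: col i (sigma x)) <= 2 * (`|r| * La).
      apply: (le_trans (norm1D _ _)); rewrite !norm1Z (ger0_norm h0) er.
      by rewrite mulr2n mulrDl mul1r lerD// ler_pM// norm1_ge0.
    have n2 : norm1 (h *: b x + e *: col i (sigma x)) ^+ 2 <= (2 * (`|r| * La)) ^+ 2.
      by apply: lerXn2r; rewrite ?nnegrE ?norm1_ge0// !mulr_ge0.
    rewrite -(mulrA _ M); apply: (@le_trans _ _ ((2 * (`|r| * La)) ^+ 2 * (M * 2))).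
      by rewrite ler_wpM2r// mulr_ge0.
    rewrite (exprMn _ 2) (exprMn _ `|r|) real_normK ?num_real// [r ^+ 2]expr2 rr.
    by rewrite le_eqVlt; apply/orP; left; apply/eqP; clearbody h; ring.
  have T1 := T r erefl; have T2 := T (- r) (normrN r).
  have B1 : `|dird (b x) f x| <= La * M.
    have := @dirds_le R d f [:: b x] M sf _ x.
    rewrite big_cons big_nil mulr1 => H; apply: le_trans (H _) _.
      by move=> s z s2; apply: fM; rewrite s2.
    exact: ler_wpM2r.
  rewrite /D !walk_map_sum mulrNN -/h -!addrA; move: B1 T1 T2.
  have -> : C0 * M * h = 2 * (8 * (dR * La ^+ 2) * M * h) + 2 * (h * (La * M)).
    by rewrite /C0; clearbody h; ring.
  move: (f (x + (h *: b x + r *: col i (sigma x)))) (f (x + (h *: b x + - r *: col i (sigma x))))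
    (f x) (dird (b x) f x) (dird (col i (sigma x)) f x) (8 * _ * M * h) (La * M).
  move=> f1 f2 f0 D1 D2 Q V DV T1 T2.
  have -> : f1 + (f2 - 2 * f0) = (f1 - f0 - (h * D1 + r * D2)) +
    (f2 - f0 - (h * D1 + - r * D2)) + 2 * (h * D1) by clearbody h; ring.
  apply: (le_trans (ler_normD _ _)); apply: lerD.
    by apply: (le_trans (ler_normD _ _)); rewrite mulr2n mulrDl mul1r lerD.
  by rewrite normrM (normrM h) (ger0_norm h0) ger0_norm// ler_wpM2l// ler_wpM2l.
pose E := \sum_(i < d) (2 * dR)^-1 * D i.
have EM : `|E| <= C0 * M * h.
  apply: (@le_trans _ _ (C0 * M * h / 2)); last first.
    have X0 : 0 <= C0 * M * h by exact: mulr_ge0 (mulr_ge0 C00 M0) h0.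
    by rewrite ler_pdivrMr// mulr_natr mulr2n lerDl.
  rewrite -(mean_cst d_gt0 (C0 * M * h / 2)); apply: (le_trans (ler_norm_sum _ _ _)).
  have i0 : 0 <= (2 * dR)^-1 by rewrite invr_ge0 mulr_ge0// ltW.
  apply: ler_sum => i _; rewrite normrM (ger0_norm i0); apply: ler_wpM2l => //.
  by rewrite mulrC divfK.
have wE : walk r f x = (1 + h * c x) * (f x + E).
  rewrite walkE -/h; congr (_ * _).
  rewrite -[f x](mean_cst d_gt0) /E -!big_split/=.
  by apply: eq_bigr => i _; rewrite /D -mulrDr [in RHS]addrC subrK.
have fx : `|f x| <= M by exact: (fM [::]).
rewrite wE; clearbody E; clear D DM wE; clearbody C0; clearbody h.
move: (f x) fx => f0 f0M.
rewrite (_ : _ - f0 = E + h * c x * f0 + h * c x * E); last by ring.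
apply: (le_trans (ler_normD _ _)); apply: (le_trans (lerD (ler_normD _ _) (lexx _))).
rewrite !mulrDl; apply: lerD; first apply: lerD => //.
  rewrite !normrM (ger0_norm h0) [leRHS]mulrC -mulrA; apply: ler_wpM2l => //.
  exact: ler_pM.
rewrite normrM -!mulrA; apply: ler_pM => //; last by rewrite mulrA.
rewrite normrM (ger0_norm h0) -[leRHS]mul1r; exact: ler_pM.
Qed.

Lemma jet_le0 (f : 'cV[R]_d -> R) M : jet_le f M -> 0 <= M.
Proof. by move=> fM; exact: le_trans (fM [::] 0 isT). Qed.

Lemma expr1D_le (x : R) n : 0 <= x -> (1 + x) ^+ n <= expR (n%:R * x).
Proof.
move=> x0; rewrite expRM_natl lerXn2r ?nnegrE ?addr_ge0 ?expR_ge0//.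
exact: expR_ge1Dx.
Qed.

(** The error depends on m and r only through the elapsed time m h, hence is uniform in r once m h =
    tau. In the induction the walk is applied to f + k h [gen f] + e: the step on f errs by order
    h^2, the step on [gen f], multiplied by k h, by order k h^2, and (k h)^2 grows by (2 k + 1)
    h^2. *)
Lemma iter_walk_consistent : exists2 C : R, 0 <= C & forall r m f M x, `|r| <= 1 ->
  m%:R * (r * r / dR) <= 1 -> smooth f -> jet_le f M ->
  `|iter m (walk r) f x - f x - m%:R * (r * r / dR) * gen f x| <=
    C * M * (m%:R * (r * r / dR)) ^+ 2.
Proof.
have [La La1 LaP] := coef_bound Cc Cb_b Cb_sigma.
have La0 : 0 <= La by apply: le_trans La1.
have [C1 C10 C1P] := walk_consistent d_gt0 Cc Cb_b Cb_sigma.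
have [C2 C20 C2P] := walk_near.
have [C3 C30 C3P] := gen_jet Cc Cb_b Cb_sigma.
have [C CE] : {C | C = C1 + C2 * C3} by exists (C1 + C2 * C3).
have C0 : 0 <= C by rewrite CE addr_ge0// mulr_ge0.
exists (expR La * C) => [|r m f M x r1 mh1 sf fM]; first by rewrite mulr_ge0 ?expR_ge0.
have M0 := jet_le0 fM.
have h0 := step_ge0 d r.
have [h hE] : {h | h = r * r / dR} by exists (r * r / dR).
rewrite -hE in mh1 h0 *.
have cLa z : `|c z| <= La by have [] := LaP z.
suff H k y : `|iter k (walk r) f y - f y - k%:R * h * gen f y| <=
    (1 + h * La) ^+ k * (C * M * (k%:R * h) ^+ 2).
  apply: (le_trans (H m x)); rewrite -!mulrA; apply: ler_wpM2r.
    by rewrite mulr_ge0// mulr_ge0// exprn_ge0// mulr_ge0.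
  have hLa : 0 <= h * La by exact: mulr_ge0.
  apply: (le_trans (expr1D_le m hLa)); rewrite ler_expR mulrA -[leRHS]mul1r.
  exact: ler_wpM2r.
elim: k y => [|k IH] y.
  by rewrite /= subrr !mul0r subrr normr0 expr0n !mulr0.
pose e z := iter k (walk r) f z - f z - k%:R * h * gen f z.
have -> : iter k.+1 (walk r) f y = walk r f y + k%:R * h * walk r (gen f) y + walk r e y.
  rewrite -walk_lin /=; congr (walk r _ y); apply/funext => z; rewrite /e.
  by move: (iter k _ _ _) (gen f z) (f z) => *; ring.
have e1 := C1P r f M y r1 sf fM.
have e2 := C2P r (gen f) _ y r1 (smooth_gen Cc Cb_b Cb_sigma sf) (C3P f M sf fM).
have e3 : `|walk r e y| <= (1 + r * r / dR * La) * ((1 + h * La) ^+ k * (C * M * (k%:R * h) ^+ 2)) :=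
  walk_le d_gt0 b sigma r y cLa IH.
rewrite -!hE in e1 e2 e3.
move: e1 e2 e3; move: (walk r f y) (walk r (gen f) y) (gen f y) (f y).
move: (walk r e y) => we wf wg g0 f0 e1 e2 e3.
have -> : wf + k%:R * h * wg + we - f0 - k.+1%:R * h * g0 =
    (wf - f0 - h * g0) + k%:R * h * (wg - g0) + we.
  by rewrite -natr1; ring.
apply: (le_trans (ler_normD _ _)); apply: (le_trans (lerD (ler_normD _ _) (lexx _))).
have kh0 : 0 <= k%:R * h by rewrite mulr_ge0.
have e2' : `|k%:R * h * (wg - g0)| <= k%:R * h * (C2 * (C3 * M) * h).
  by rewrite normrM (ger0_norm kh0) ler_wpM2l.
apply: (le_trans (lerD (lerD e1 e2') e3)).
have P1 : 1 <= (1 + h * La) ^+ k.+1 by rewrite exprn_ege1// lerDl mulr_ge0.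
have k0 : (0 : R) <= k%:R by [].
rewrite [(1 + h * La) * _]mulrA -exprS -natr1; move: ((1 + h * La) ^+ k.+1) P1 => P P1.
have -> : ((k%:R + 1) * h) ^+ 2 = (k%:R * h) ^+ 2 + (2 * k%:R + 1) * h ^+ 2.
  by ring.
rewrite !mulrDr addrC lerD2l.
apply: (@le_trans _ _ (1 * (C * M * ((2 * k%:R + 1) * h ^+ 2)))); last first.
  apply: ler_wpM2r => //.
  by do ?[apply: mulr_ge0 | apply: addr_ge0 | apply: exprn_ge0].
rewrite mul1r CE.
have a1 : 0 <= C1 * M * h ^+ 2 * k%:R by rewrite !mulr_ge0// exprn_ge0.
have a2 : 0 <= C2 * C3 * M * h ^+ 2 * k%:R by rewrite !mulr_ge0// exprn_ge0.
have a3 : 0 <= C2 * C3 * M * h ^+ 2 by rewrite !mulr_ge0// exprn_ge0.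
by rewrite -subr_ge0 (_ : _ - _ = 2 * (C1 * M * h ^+ 2 * k%:R) +
  C2 * C3 * M * h ^+ 2 * k%:R + C2 * C3 * M * h ^+ 2); [lra|ring].
Qed.

End iterated_walk.

(** * Solutions of the Fokker-Planck recursion *)

Section uniform_continuity.
Context {R : realType}.

(** Heine's theorem with only the first point confined to the compact set, since a step of the walk
    may leave it. *)
Lemma uniformly_continuous_within (X : pseudoMetricType R) (A K : set X) (g : X -> R) :
  compact K -> K `<=` A -> {within A, continuous g} ->
  forall e : R, 0 < e -> exists2 de : R, 0 < de &
    forall z z', K z -> A z' -> ball z de z' -> `|g z - g z'| < e.
Proof.
move=> cK KA /subspace_continuousP cg e e0.
have /near_covering_withinP := (compact_near_coveringP K).1 cK.
move=> /(_ R (0 : R)^'+ (fun de z => forall z', A z' -> ball z de z' -> `|g z - g z'| < e)).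
have loc z : K z -> exists2 r : R, 0 < r & forall z', A z' -> ball z r z' -> `|g z - g z'| < e / 2.
  move=> Kz; have /cvgrPdist_lt/(_ (e / 2)) := cg z (KA _ Kz).
  rewrite divr_gt0// => /(_ isT); rewrite near_withinE => /nbhs_ballP[r /= r0 H].
  by exists r => // z' Az' zz'; apply: H.
have cover : forall x, K x -> \forall x' \near x & i \near (0 : R)^'+,
    K x' -> forall z', A z' -> ball x' i z' -> `|g x' - g z'| < e.
  move=> z Kz; have [r r0 H] := loc z Kz.
  have r2 : 0 < r / 2 by rewrite divr_gt0.
  near=> z1 i => /= Kz1 z' Az' z1z'.
  have zz1 : ball z (r / 2) z1 by near: z1; exact: nbhsx_ballx.
  have ir : i <= r / 2 by near: i; exact: nbhs_right_le.
  rewrite -(subrKA (g z)); apply: (le_lt_trans (ler_normD _ _)).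
  rewrite [e]splitr; apply: ltrD.
    rewrite distrC; apply: H; first exact: KA.
    by apply: (@le_ball _ _ _ (r / 2)) => //; rewrite ler_pdivrMr// ler_peMr ?ler1n// ltW.
  apply: H => //; rewrite [r]splitr; apply: ball_triangle zz1 _.
  exact: (le_ball ir).
move=> /(_ _ cover) H.
near ((0 : R)^'+) => de.
exists de => [//|z z' Kz]; exact: (near H de).
Unshelve. all: by end_near.
Qed.

Lemma compact_cV_box n (rho : R) :
  compact [set x : 'cV[R]_n | forall i, `|x i ord0| <= rho].
Proof.
pose B := [set v : 'rV[R]_n | forall i, `[- rho, rho]%classic (v ord0 i)].
have cB : compact B by apply: (@rV_compact R n (fun=> `[- rho, rho]%classic)) => _; exact: segment_compact.
have tr_cont : continuous (fun v : 'rV[R]_n => v^T : 'cV[R]_n).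
  move=> v A /nbhs_ballP[e /= e0 eA]; apply/nbhs_ballP; exists e => // w [_ H].
  by apply: eA; split => // i j; rewrite !mxE; exact: H.
rewrite (_ : [set x | _] = (fun v : 'rV[R]_n => v^T : 'cV[R]_n) @` B).
  by apply: continuous_compact => //; exact: continuous_subspaceT.
apply/seteqP; split => [x xr|_ [v vB <-] i].
  by exists x^T; [move=> i /=; rewrite mxE in_itv/= -ler_norml|rewrite trmxK].
by rewrite mxE ler_norml; have := vB i; rewrite /= in_itv.
Qed.

Lemma cV_ballP n (x y : 'cV[R]_n) (e : R) : 0 < e ->
  (forall i, `|x i ord0 - y i ord0| < e) -> ball x e y.
Proof. by move=> e0 H; split => // i j; rewrite ord1; exact: H. Qed.

Section regular.
Variables (d : nat) (t0 t1 : R) (u : R -> 'cV[R]_d -> R).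
Hypothesis ru : regular_on `[t0, t1] u.

Let box (rho : R) := [set x : 'cV[R]_d | forall i, `|x i ord0| <= rho].

Lemma regular_modulus (rho e : R) : 0 < e -> exists2 de : R, 0 < de &
  forall s t t' (x x' : 'cV[R]_d), (size s <= 2)%N -> t \in `[t0, t1] -> t' \in `[t0, t1] ->
    (forall i, `|x i ord0| <= rho) -> `|t - t'| < de ->
    (forall i, `|x i ord0 - x' i ord0| < de) ->
    `|iter_partial s (u t) x - iter_partial s (u t') x'| < e.
Proof.
move=> e0; have [_ _ cu] := ru.
have cK : compact (`[t0, t1]%classic `*` box rho).
  by apply: compact_setX; [exact: segment_compact|exact: compact_cV_box].
have sub : `[t0, t1]%classic `*` box rho `<=` `[t0, t1]%classic `*` [set: 'cV[R]_d].
  by move=> z [].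
suff : forall l : seq (seq 'I_d), (forall s, s \in l -> (size s <= 2)%N) ->
    exists2 de : R, 0 < de &
    forall s t t' (x x' : 'cV[R]_d), s \in l -> t \in `[t0, t1] -> t' \in `[t0, t1] ->
    (forall i, `|x i ord0| <= rho) -> `|t - t'| < de ->
    (forall i, `|x i ord0 - x' i ord0| < de) ->
    `|iter_partial s (u t) x - iter_partial s (u t') x'| < e.
  move=> /(_ (words d 2)) [s|de de0 H]; first by rewrite mem_words.
  by exists de => // s t t' x x' s2; apply: H; rewrite mem_words.
elim=> [_|s l IH sl]; first by exists 1.
have [|de de0 H] := IH; first by move=> s' s'l; apply: sl; rewrite inE s'l orbT.
have s2 : (size s <= 2)%N by apply: sl; rewrite mem_head.
have [de' de'0 H'] := uniformly_continuous_within cK sub (cu s s2) e0.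
exists (Num.min de de'); first by rewrite lt_min de0.
move=> s' t t' x x'; rewrite inE => /orP[/eqP ->|s'l] tI t'I xr.
  rewrite lt_min => /andP[_ tt'] xx'.
  apply: (H' (t, x) (t', x')) => //; split => //=.
  by apply: cV_ballP => // i; have := xx' i; rewrite lt_min => /andP[].
rewrite lt_min => /andP[tt' _] xx'.
by apply: H => // i; have := xx' i; rewrite lt_min => /andP[].
Qed.

Lemma regular_bounded (rho : R) : exists2 M : R, 0 <= M &
  forall s t (x : 'cV[R]_d), (size s <= 2)%N -> t \in `[t0, t1] -> (forall i, `|x i ord0| <= rho) ->
    `|iter_partial s (u t) x| <= M.
Proof.
have [_ _ cu] := ru.
have cK : compact (`[t0, t1]%classic `*` box rho).
  by apply: compact_setX; [exact: segment_compact|exact: compact_cV_box].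
have sub : `[t0, t1]%classic `*` box rho `<=` `[t0, t1]%classic `*` [set: 'cV[R]_d].
  by move=> z [].
suff : forall l : seq (seq 'I_d), (forall s, s \in l -> (size s <= 2)%N) ->
    exists2 M : R, 0 <= M & forall s t (x : 'cV[R]_d), s \in l -> t \in `[t0, t1] ->
    (forall i, `|x i ord0| <= rho) -> `|iter_partial s (u t) x| <= M.
  move=> /(_ (words d 2)) [s|M M0 H]; first by rewrite mem_words.
  by exists M => // s t x s2; apply: H; rewrite mem_words.
elim=> [_|s l IH sl]; first by exists 0.
have [|M M0 H] := IH; first by move=> s' s'l; apply: sl; rewrite inE s'l orbT.
have s2 : (size s <= 2)%N by apply: sl; rewrite mem_head.
have /compact_bounded[M' [_ H']] :
    compact ((fun z : R * 'cV[R]_d => iter_partial s (u z.1) z.2) @`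
      (`[t0, t1]%classic `*` box rho)).
  apply: continuous_compact => //; apply: continuous_subspaceW (cu s s2); exact: sub.
exists (M + (`|M'| + 1)); first by rewrite !addr_ge0.
move=> s' t x; rewrite inE => /orP[/eqP ->|s'l] tI xr.
  apply: (@le_trans _ _ (`|M'| + 1)); last by rewrite lerDr.
  apply: H'; last by exists (t, x).
  by rewrite (le_lt_trans (ler_norm _))// ltrDl.
by apply: (le_trans (H _ _ _ s'l tI xr)); rewrite lerDl addr_ge0.
Qed.

End regular.
End uniform_continuity.

(** * The generator and the walk on functions that are only C^2 *)

Section maximum_principle.
Context {R : realType} (d : nat).
Hypothesis d_gt0 : (0 < d)%N.
Variables (c : 'cV[R]_d -> R) (b : 'cV[R]_d -> 'cV[R]_d) (sigma : 'cV[R]_d -> 'M[R]_d).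
Hypothesis Cc : Cb_infty c.
Hypothesis Cb_b : Cb_infty_mx b.
Hypothesis Cb_sigma : Cb_infty_mx sigma.

Local Notation gen := (gen c b sigma).
Local Notation walk := (walk c b sigma).
Local Notation dR := (d%:R : R).

Let d0 : 0 < dR. Proof. by rewrite ltr0n. Qed.

(** [gen] as a linear form in a formal jet, into which differences of jets at different times can be
    inserted. *)
Definition gen_symbol (x : 'cV[R]_d) (j : seq 'I_d -> R) : R :=
  c x * j [::] + (2^-1 * (\sum_(k < d) \sum_(l < d) diffusion_coef sigma k l x * j [:: k; l]) +
  \sum_(k < d) b x k ord0 * j [:: k]).

Lemma gen_symbolE f x : gen f x = gen_symbol x (fun s => iter_partial s f x).
Proof. by []. Qed.

Lemma gen_symbolB x j1 j2 :
  gen_symbol x (fun s => j1 s - j2 s) = gen_symbol x j1 - gen_symbol x j2.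
Proof.
rewrite /gen_symbol.
under eq_bigr do under eq_bigr do rewrite mulrBr.
under eq_bigr do rewrite sumrB.
under [X in _ + (_ + X)]eq_bigr do rewrite mulrBr.
by rewrite !sumrB; ring.
Qed.

Lemma gen_symbol_le : exists2 C : R, 0 <= C & forall x j (e : R),
  (forall s, (size s <= 2)%N -> `|j s| <= e) -> `|gen_symbol x j| <= C * e.
Proof.
have [Mc Mc0 cM] := Cb_bounded Cc.
have /choice[Mb MbP] : forall i, exists B : R, 0 <= B /\ forall x, `|b x i ord0| <= B.
  by move=> i; have [B B0 BP] := Cb_bounded (Cb_b i ord0); exists B; split => //; exact: ltW.
have /choice[Ma MaP] : forall p, exists B : R, 0 <= B /\
    forall x, `|diffusion_coef sigma p.1 p.2 x| <= B.
  move=> p; have [B B0 BP] := Cb_bounded (Cb_diffusion_coef Cb_sigma p.1 p.2).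
  by exists B; split => //; exact: ltW.
exists (Mc + (2^-1 * (\sum_i \sum_j Ma (i, j)) + \sum_i Mb i)) => [|x j e je].
  rewrite !addr_ge0 ?mulr_ge0 ?sumr_ge0// ?(ltW Mc0)// => i _.
    by apply: sumr_ge0 => j _; have [] := MaP (i, j).
  by have [] := MbP i.
apply: (le_trans (ler_normD _ _)); rewrite mulrDl; apply: lerD.
  by rewrite normrM; apply: ler_pM => //; exact: je.
apply: (le_trans (ler_normD _ _)); rewrite mulrDl; apply: lerD.
  rewrite normrM ger0_norm// -mulrA ler_wpM2l//.
  apply: (le_trans (ler_norm_sum _ _ _)); rewrite mulr_suml; apply: ler_sum => k _.
  apply: (le_trans (ler_norm_sum _ _ _)); rewrite mulr_suml; apply: ler_sum => l _.
  by rewrite normrM; apply: ler_pM => //; [have [_ H] := MaP (k, l); exact: H|exact: je].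
apply: (le_trans (ler_norm_sum _ _ _)); rewrite mulr_suml; apply: ler_sum => k _.
by rewrite normrM; apply: ler_pM => //; [have [_ H] := MbP k; exact: H|exact: je].
Qed.

Lemma walk_expand r f x (La B de : R) (S : 'I_d -> R) : `|c x| <= La -> 0 <= La ->
  `|r| <= 1 ->
  (forall i, `|f (walk_map b sigma i r x) + f (walk_map b sigma i (- r) x) - 2 * f x
   - 2 * (r * r / dR * B) - r * r * S i| <= de) ->
  `|walk r f x - (1 + r * r / dR * c x) * (f x + r * r / dR * (B + 2^-1 * \sum_i S i))|
    <= (1 + La) * de.
Proof.
move=> cLa La0 r1 Sde.
have h0 := step_ge0 d r.
have h1 : r * r / dR <= 1.
  rewrite ler_pdivrMr// mul1r (@le_trans _ _ 1)//; last by rewrite ler1n.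
  by rewrite -expr2 -real_normK ?num_real// expr_le1.
have rr : r * r = dR * (r * r / dR) by rewrite [RHS]mulrC divfK// lt0r_neq0.
pose D i := f (walk_map b sigma i r x) + f (walk_map b sigma i (- r) x) - 2 * f x
   - 2 * (r * r / dR * B) - r * r * S i.
pose E := \sum_(i < d) (2 * dR)^-1 * D i.
have i0 : 0 <= (2 * dR)^-1 by rewrite invr_ge0 mulr_ge0// ltW.
have de0 : 0 <= de by exact: le_trans (Sde (Ordinal d_gt0)).
have EM : `|E| <= de.
  apply: (@le_trans _ _ (de / 2)); last by rewrite ler_pdivrMr// mulr_natr mulr2n lerDl.
  rewrite -(mean_cst d_gt0 (de / 2)); apply: (le_trans (ler_norm_sum _ _ _)).
  apply: ler_sum => i _; rewrite normrM (ger0_norm i0); apply: ler_wpM2l => //.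
  by rewrite mulrC divfK//; exact: Sde.
have -> : walk r f x = (1 + r * r / dR * c x) *
    (f x + r * r / dR * (B + 2^-1 * \sum_i S i) + E).
  rewrite walkE; congr (_ * _).
  rewrite mulrDr (_ : r * r / dR * (2^-1 * _) = \sum_(i < d) (2 * dR)^-1 * (r * r * S i)); last first.
    rewrite mulrA mulr_sumr; apply: eq_bigr => i _; field.
    by rewrite lt0r_neq0.
  rewrite -[f x](mean_cst d_gt0) -[_ * B](mean_cst d_gt0) /E -!big_split/=.
  apply: eq_bigr => i _; rewrite /D.
  move: (f (walk_map b sigma i r x)) (f (walk_map b sigma i (- r) x)) (f x) (_ * B) => *.
  by field; rewrite lt0r_neq0.
rewrite mulrDr addrC addKr normrM; apply: ler_pM => //.
apply: (le_trans (ler_normD _ _)); rewrite normr1 lerD2l normrM (ger0_norm h0).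
by rewrite -[leRHS]mul1r; apply: ler_pM.
Qed.

Local Opaque dird.

(** The solution of the equation has two continuous derivatives in x, so the error of a step is h
    times the oscillation e of the second derivatives within reach of the step. Being o(h), it
    suffices for convergence of the walk. *)
Lemma walk_C2 : exists2 C : R, 0 <= C & forall r (f : 'cV[R]_d -> R) x (e M : R), `|r| <= 1 ->
  (forall y, differentiable f y) -> (forall l y, differentiable (partial l f) y) ->
  (forall s, (size s <= 2)%N -> `|iter_partial s f x| <= M) ->
  (forall k l (v : 'cV[R]_d), (forall i, `|v i ord0| <= C * `|r|) ->
     `|partial k (partial l f) (x + v) - partial k (partial l f) x| <= e) ->
  `|walk r f x - f x - r * r / dR * gen f x| <=
    C * (r * r / dR * e + (r * r / dR) ^+ 2 * M).
Proof.
have [La La1 LaP] := coef_bound Cc Cb_b Cb_sigma.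
have La0 : 0 <= La by apply: le_trans La1.
have [C1 C10 C1P] := gen_symbol_le.
have [C0 C0E] : {C0 | C0 = 8 * (dR * La ^+ 2) + La ^+ 2} by exists (8 * (dR * La ^+ 2) + La ^+ 2).
have C00 : 0 <= C0 by rewrite C0E; do ?[apply: addr_ge0 | apply: mulr_ge0 | apply: exprn_ge0].
have C3 : 0 <= (1 + La) * C0 + La * (C1 + La) + 2 * La.
  by do ?[apply: addr_ge0 | apply: mulr_ge0].
(* The constant also serves as the reach of a step: coordinates move by at most 2 * La * [|r|]. *)
exists ((1 + La) * C0 + La * (C1 + La) + 2 * La) => // r f x e M r1 df dpf fM fe.
have M0 : 0 <= M by exact: le_trans (fM [::] isT).
have h0 := step_ge0 d r.
have rr : r * r = dR * (r * r / dR) by rewrite [RHS]mulrC divfK// lt0r_neq0.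
have [h hE] : {h | h = r * r / dR} by exists (r * r / dR).
rewrite -hE in h0 rr *.
have d1 : 1 <= dR by rewrite ler1n.
have hr2 : h <= r * r by rewrite rr ler_peMl.
have hr : h <= `|r|.
  apply: (le_trans hr2); rewrite -expr2 -real_normK ?num_real//.
  by rewrite expr2 -[leRHS]mulr1 ler_wpM2l.
have [cLa bLa sLa] := LaP x.
have e0 : 0 <= e.
  by apply: le_trans (fe (Ordinal d_gt0) (Ordinal d_gt0) 0 _) => // i; rewrite mxE normr0 mulr_ge0.
have vle (v : 'cV[R]_d) i : `|v i ord0| <= norm1 v.
  by rewrite /norm1 (bigD1 i)//= lerDl sumr_ge0.
have T (v : 'cV[R]_d) : norm1 v <= 2 * (`|r| * La) ->
    `|f (x + v) - f x - dird v f x - dird v (dird v f) x / 2| <= 4 * (dR * La ^+ 2) * (h * e).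
  move=> vr.
  apply: (@le_trans _ _ (norm1 v ^+ 2 * e)); last first.
    rewrite (_ : 4 * _ * _ = (2 * (`|r| * La)) ^+ 2 * e); last first.
      by rewrite (exprMn _ 2) (exprMn _ `|r|) real_normK ?num_real// expr2 [r ^+ 2]expr2 rr; ring.
    apply: ler_wpM2r => //; apply: lerXn2r; rewrite ?nnegrE ?norm1_ge0//.
    by rewrite !mulr_ge0.
  apply: taylor2_line => // t /andP[t0 t1].
  rewrite !dird2E// -sumrB.
  have -> : norm1 v ^+ 2 * e = \sum_k \sum_l `|v k ord0| * `|v l ord0| * e.
    rewrite expr2 /norm1 big_distrlr/= mulr_suml; apply: eq_bigr => k _.
    by rewrite mulr_suml.
  apply: (le_trans (ler_norm_sum _ _ _)); apply: ler_sum => k _; rewrite -sumrB.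
  apply: (le_trans (ler_norm_sum _ _ _)); apply: ler_sum => l _.
  rewrite -mulrBr !normrM ler_wpM2l// fe// => i.
  rewrite mxE normrM (ger0_norm t0).
  apply: (@le_trans _ _ (1 * norm1 v)); first exact: ler_pM.
  rewrite mul1r (le_trans vr)// mulrCA mulrC ler_wpM2r//.
  by rewrite lerDr addr_ge0// mulr_ge0// addr_ge0.
have D2M (v : 'cV[R]_d) : norm1 v <= La -> `|dird v (dird v f) x| <= La ^+ 2 * M.
  move=> vLa; rewrite dird2E//.
  apply: (@le_trans _ _ (norm1 v ^+ 2 * M)); last first.
    by rewrite ler_wpM2r// lerXn2r ?nnegrE ?norm1_ge0.
  rewrite expr2 /norm1 big_distrlr/= mulr_suml.
  apply: (le_trans (ler_norm_sum _ _ _)); apply: ler_sum => k _; rewrite mulr_suml.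
  apply: (le_trans (ler_norm_sum _ _ _)); apply: ler_sum => l _.
  by rewrite !normrM ler_wpM2l//; exact: (fM [:: k; l]).
have := @walk_expand r f x La (dird (b x) f x) (C0 * (h * e + h ^+ 2 * M))
  (fun i => dird (col i (sigma x)) (dird (col i (sigma x)) f) x) cLa La0 r1.
rewrite -op_A_dird// -hE => WE.
have {}WE : `|walk r f x - (1 + h * c x) * (f x + h * op_A sigma b f x)| <=
    (1 + La) * (C0 * (h * e + h ^+ 2 * M)).
  apply: WE => i; rewrite !walk_map_sum mulrNN -hE -!addrA.
  have v1 s : `|s| = `|r| -> norm1 (h *: b x + s *: col i (sigma x)) <= 2 * (`|r| * La).
    move=> sr; apply: (le_trans (norm1D _ _)); rewrite !norm1Z (ger0_norm h0) sr.
    by rewrite mulr2n mulrDl mul1r lerD// ler_pM// norm1_ge0.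
  have T1 := T _ (v1 r erefl); have T2 := T _ (v1 (- r) (normrN r)).
  have S1 s : dird (h *: b x + s *: col i (sigma x)) f x =
      h * dird (b x) f x + s * dird (col i (sigma x)) f x by rewrite dirdDl !dirdZl.
  (* Parallelogram identity for the quadratic form of second derivatives: the mixed terms of drift
     and noise cancel. *)
  have S2 : dird (h *: b x + r *: col i (sigma x)) (dird (h *: b x + r *: col i (sigma x)) f) x
     + dird (h *: b x + - r *: col i (sigma x)) (dird (h *: b x + - r *: col i (sigma x)) f) x =
     2 * (h ^+ 2 * dird (b x) (dird (b x) f) x) +
     2 * (r * r * dird (col i (sigma x)) (dird (col i (sigma x)) f) x).
    rewrite !dird2E// !mulr_sumr -!big_split/=; apply: eq_bigr => k _.
    rewrite !mulr_sumr -!big_split/=; apply: eq_bigr => l _.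
    rewrite !mxE; move: (partial k _ x) => pk; ring.
  have B2 := D2M _ bLa.
  rewrite !S1 in T1 T2; move: T1 T2 S2 B2.
  move: (f (x + (h *: b x + r *: col i (sigma x)))) (f (x + (h *: b x + - r *: col i (sigma x))))
    (f x) (dird (b x) f x) (dird (col i (sigma x)) f x)
    (dird (h *: b x + r *: col i (sigma x)) (dird (h *: b x + r *: col i (sigma x)) f) x)
    (dird (h *: b x + - r *: col i (sigma x)) (dird (h *: b x + - r *: col i (sigma x)) f) x)
    (dird (col i (sigma x)) (dird (col i (sigma x)) f) x) (dird (b x) (dird (b x) f) x).
  move=> f1 f2 f0 Db Ds Q1 Q2 DS DB T1 T2 Q12 DBM.
  rewrite (_ : f1 + _ = (f1 - f0 - (h * Db + r * Ds) - Q1 / 2) +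
    (f2 - f0 - (h * Db + - r * Ds) - Q2 / 2) + h ^+ 2 * DB); last first.
    have -> : Q1 = 2 * (h ^+ 2 * DB) + 2 * (r * r * DS) - Q2 by rewrite -Q12 addrK.
    by field.
  apply: (le_trans (ler_normD _ _)); apply: (le_trans (lerD (ler_normD _ _) (lexx _))).
  apply: (le_trans (lerD (lerD T1 T2) (lexx _))).
  rewrite normrM ger0_norm ?exprn_ge0// C0E.
  have hM : 0 <= h ^+ 2 * M by rewrite mulr_ge0 ?exprn_ge0.
  have he : 0 <= h * e by exact: mulr_ge0.
  have L2 : 0 <= La ^+ 2 by exact: exprn_ge0.
  have := ler_wpM2l (exprn_ge0 2 h0) DBM => DBM'.
  apply: (le_trans (lerD (lexx _) DBM')).
  rewrite mulrDl !mulrDr -subr_ge0.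
  rewrite (_ : _ - _ = 8 * (dR * La ^+ 2) * (h ^+ 2 * M) + La ^+ 2 * (h * e)); last by ring.
  by rewrite addr_ge0 ?mulr_ge0// mulr_ge0// ltW.
have AM : `|op_A sigma b f x| <= (C1 + La) * M.
  have -> : op_A sigma b f x = gen f x - c x * f x by rewrite /gen addrC addKr.
  apply: (le_trans (ler_normB _ _)); rewrite mulrDl lerD//.
    by rewrite gen_symbolE C1P.
  by rewrite normrM; apply: ler_pM => //; exact: (fM [::]).
rewrite (_ : _ - _ - _ = walk r f x - (1 + h * c x) * (f x + h * op_A sigma b f x) +
   h ^+ 2 * (c x * op_A sigma b f x)); last first.
  by rewrite /gen; move: (walk r f x) (op_A sigma b f x) (f x) (c x) => *; ring.
apply: (le_trans (ler_normD _ _)).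
have X1 : `|h ^+ 2 * (c x * op_A sigma b f x)| <= h ^+ 2 * (La * ((C1 + La) * M)).
  by rewrite normrM ger0_norm ?exprn_ge0// ler_wpM2l ?exprn_ge0// normrM ler_pM.
apply: (le_trans (lerD WE X1)).
have hM : 0 <= h ^+ 2 * M by rewrite mulr_ge0 ?exprn_ge0.
have he : 0 <= h * e by exact: mulr_ge0.
rewrite -subr_ge0 (_ : _ - _ = La * (C1 + La) * (h * e) + 2 * La * (h * e + h ^+ 2 * M)); last by ring.
by rewrite addr_ge0// ?mulr_ge0// addr_ge0.
Qed.

End maximum_principle.

Section integral_increment.
Context {R : realType}.
Local Notation mu := (@lebesgue_measure R).

Lemma integral_increment (G : R -> R) (t0 t1 t s v e : R) :
  {within `[t0, t1], continuous G} -> t0 <= t -> t < s -> s <= t1 ->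
  (forall y, t <= y <= s -> `|G y - v| <= e) ->
  `|\int[mu]_(y in `[t0, s]) G y - \int[mu]_(y in `[t0, t]) G y - (s - t) * v|
    <= (s - t) * e.
Proof.
move=> cG t0t ts st1 Gv.
have iG : mu.-integrable `[t0, t1] (EFin \o G).
  by apply: continuous_compact_integrable => //; exact: segment_compact.
have iGs : mu.-integrable `[t0, s] (EFin \o G).
  apply: integrableS iG => // y; rewrite /= !in_itv/= => /andP[-> ys].
  exact: le_trans st1.
have iGts : mu.-integrable `]t, s] (EFin \o G).
  apply: integrableS iG => // y; rewrite /= !in_itv/= => /andP[ty ys].
  by rewrite (le_trans t0t (ltW ty)) (le_trans ys).
rewrite Rintegral_itvB ?bnd_simp//; last exact: ltW.
have mts : fine (mu `]t, s]) = s - t.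
  by rewrite lebesgue_measure_itv/= lte_fin ts -EFinD.
have ic (k : R) : mu.-integrable `]t, s] (EFin \o (fun=> k)).
  apply: (@integrableS _ _ _ mu `[t0, t1]) => // [y|].
    rewrite /= !in_itv/= => /andP[ty ys].
    by rewrite (le_trans t0t (ltW ty)) (le_trans ys).
  apply: continuous_compact_integrable; first exact: segment_compact.
  by apply: continuous_subspaceT => y; exact: cst_continuous.
have lo : (s - t) * (v - e) <= \int[mu]_(y in `]t, s]) G y.
  rewrite mulrC -mts -Rintegral_cst//; apply: le_Rintegral => // y.
  rewrite /= in_itv/= => /andP[ty ys].
  have := Gv y; rewrite (ltW ty) ys => /(_ isT); rewrite ler_distl => /andP[].
  by [].
have hi : \int[mu]_(y in `]t, s]) G y <= (s - t) * (v + e).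
  rewrite mulrC -mts -Rintegral_cst//; apply: le_Rintegral => // y.
  rewrite /= in_itv/= => /andP[ty ys].
  by have := Gv y; rewrite (ltW ty) ys => /(_ isT); rewrite ler_distl => /andP[].
rewrite ler_distl; move: lo hi; rewrite mulrBr mulrDr.
by move: (Rintegral _ _ _) ((s - t) * v) ((s - t) * e) => I V E lo hi; apply/andP.
Qed.

End integral_increment.

(** * Convergence of the walk to the solution in a weighted norm *)

Section solution_walk.
Context {R : realType} (d : nat).
Hypothesis d_gt0 : (0 < d)%N.
Variables (c : 'cV[R]_d -> R) (b : 'cV[R]_d -> 'cV[R]_d) (sigma : 'cV[R]_d -> 'M[R]_d).
Hypothesis Cc : Cb_infty c.
Hypothesis Cb_b : Cb_infty_mx b.
Hypothesis Cb_sigma : Cb_infty_mx sigma.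

Local Notation gen := (gen c b sigma).
Local Notation walk := (walk c b sigma).
Local Notation dR := (d%:R : R).
Local Notation mu := (@lebesgue_measure R).

Let d0 : 0 < dR. Proof. by rewrite ltr0n. Qed.

(** Bounds on the derivatives of the solution and their moduli are uniform on bounded sets only. A
    weight that grows at infinity absorbs the bounded functions to be compared outside a large
    box. *)
Definition weight (x : 'cV[R]_d) : R := 1 + \sum_l x l ord0 ^+ 2.

Lemma weight_ge1 x : 1 <= weight x.
Proof. by rewrite lerDl sumr_ge0// => l _; exact: sqr_ge0. Qed.

Lemma walk_weight : exists2 K : R, 0 <= K & forall r g (k : R) x, `|r| <= 1 -> 0 <= k ->
  (forall z, `|g z| <= k * weight z) ->
  `|walk r g x| <= (1 + K * (r * r / dR)) * (k * weight x).
Proof.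
have [La La1 LaP] := coef_bound Cc Cb_b Cb_sigma.
have La0 : 0 <= La by apply: le_trans La1.
have [C CE] : {C | C = 1 + 2 * dR * La ^+ 2 + dR ^+ 2 * La ^+ 2} by eexists.
have C0 : 0 <= C by rewrite CE; do ?[apply: addr_ge0 | apply: mulr_ge0 | apply: exprn_ge0].
exists (La + C + La * C) => [|r g k x r1 k0 gk]; first by rewrite !addr_ge0// mulr_ge0.
have h0 := step_ge0 d r.
have rr : r * r = dR * (r * r / dR) by rewrite [RHS]mulrC divfK// lt0r_neq0.
have h1 : r * r / dR <= 1.
  rewrite ler_pdivrMr// mul1r (@le_trans _ _ 1)//; last by rewrite ler1n.
  by rewrite -expr2 -real_normK ?num_real// expr_le1.
have [cLa bLa sLa] := LaP x.
have vle (v : 'cV[R]_d) i : `|v i ord0| <= norm1 v.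
  by rewrite /norm1 (bigD1 i)//= lerDl sumr_ge0.
have sq (v : 'cV[R]_d) i : norm1 v <= La -> v i ord0 ^+ 2 <= La ^+ 2.
  by move=> vLa; rewrite -real_normK ?num_real// lerXn2r ?nnegrE// (le_trans (vle v i)).
have W i : weight (walk_map b sigma i r x) + weight (walk_map b sigma i (- r) x) <=
    2 * ((1 + C * (r * r / dR)) * weight x).
  have E : weight (walk_map b sigma i r x) + weight (walk_map b sigma i (- r) x) =
    2 + \sum_l (2 * (x l ord0 + r * r / dR * b x l ord0) ^+ 2 + 2 * (r * r * sigma x l i ^+ 2)).
    rewrite /weight addrACA -big_split/=; congr (_ + _).
    apply: eq_bigr => l _; rewrite !walk_mapE mulrNN; ring.
  rewrite E; move: (r * r / dR) h0 h1 rr => h h0 h1 rr.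
  apply: (@le_trans _ _ (2 + \sum_(l < d) (2 * ((1 + h) * x l ord0 ^+ 2) +
      (4 * (h * La ^+ 2) + 2 * (dR * h * La ^+ 2))))).
    rewrite lerD2l; apply: ler_sum => l _; rewrite -rr.
    have s1 : sigma x l i ^+ 2 <= La ^+ 2 by have := sq _ l (sLa i); rewrite mxE.
    have s2 : b x l ord0 ^+ 2 <= La ^+ 2 by exact: sq.
    have s3 : r * r * sigma x l i ^+ 2 <= r * r * La ^+ 2.
      by rewrite ler_wpM2l// -expr2 sqr_ge0.
    have s4 : h * b x l ord0 ^+ 2 <= h * La ^+ 2 by rewrite ler_wpM2l.
    have s5 : h ^+ 2 * b x l ord0 ^+ 2 <= h * La ^+ 2.
      apply: le_trans s4; rewrite ler_wpM2r ?sqr_ge0// expr2.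
      by rewrite -[leRHS]mulr1 ler_wpM2l.
    have s6 : 0 <= h * (x l ord0 - b x l ord0) ^+ 2 by rewrite mulr_ge0// sqr_ge0.
    have -> : (x l ord0 + h * b x l ord0) ^+ 2 = (1 + h) * x l ord0 ^+ 2 +
      h * b x l ord0 ^+ 2 + h ^+ 2 * b x l ord0 ^+ 2 - h * (x l ord0 - b x l ord0) ^+ 2 by ring.
    move: (h * (x l ord0 - b x l ord0) ^+ 2) (h * b x l ord0 ^+ 2) (h ^+ 2 * b x l ord0 ^+ 2)
      (h * La ^+ 2) (r * r * La ^+ 2) (r * r * sigma x l i ^+ 2) ((1 + h) * x l ord0 ^+ 2)
      s3 s4 s5 s6 => *; lra.
  rewrite big_split/= -mulr_sumr -mulr_sumr sumr_const card_ord -[_ *+ d]mulr_natl.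
  rewrite /weight; have : 0 <= \sum_(l < d) x l ord0 ^+ 2 by apply: sumr_ge0 => l _; exact: sqr_ge0.
  move: (\sum_(l < d) _) => S S0.
  have L2 : 0 <= La ^+ 2 by exact: exprn_ge0.
  rewrite CE -subr_ge0 (_ : _ - _ = 2 * h + 2 * h * (2 * dR * La ^+ 2 + dR ^+ 2 * La ^+ 2) * S); last by ring.
  by do ?[apply: addr_ge0 | apply: mulr_ge0 | apply: exprn_ge0].
rewrite walkE normrM; move: (r * r / dR) h0 h1 rr W => h h0 h1 rr W.
have kw : 0 <= k * weight x by rewrite mulr_ge0// (le_trans _ (weight_ge1 x)).
apply: (@le_trans _ _ ((1 + h * La) * ((1 + C * h) * (k * weight x)))); last first.
  rewrite mulrA ler_wpM2r// -subr_ge0 (_ : _ - _ = La * C * h * (1 - h)); last by ring.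
  by rewrite !mulr_ge0// subr_ge0.
apply: ler_pM => //.
  apply: (le_trans (ler_normD _ _)); rewrite normr1 lerD2l normrM (ger0_norm h0).
  exact: ler_wpM2l.
apply: (le_trans (ler_norm_sum _ _ _)); rewrite -(mean_cst d_gt0 (_ * (k * _))).
apply: ler_sum => i _.
have i0 : 0 <= (2 * dR)^-1 by rewrite invr_ge0 mulr_ge0// ltW.
rewrite normrM (ger0_norm i0); apply: ler_wpM2l => //.
apply: (le_trans (ler_normD _ _)); apply: (le_trans (lerD (gk _) (gk _))).
have -> : 2 * ((1 + C * h) * (k * weight x)) = k * (2 * ((1 + C * h) * weight x)) by ring.
by rewrite -mulrDr ler_wpM2l.
Qed.

Lemma walkB r f g x : walk r (fun z => f z - g z) x = walk r f x - walk r g x.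
Proof. by rewrite -sumrB; apply: eq_bigr => i _; ring. Qed.

Lemma iter_walk_le La r f M n x : 0 <= La -> (forall x, `|c x| <= La) ->
  (forall z, `|f z| <= M) ->
  `|iter n (walk r) f x| <= expR (n%:R * (r * r / dR * La)) * M.
Proof.
move=> La0 cLa fM; have M0 : 0 <= M by exact: le_trans (fM 0).
have hLa : 0 <= r * r / dR * La by rewrite mulr_ge0// step_ge0.
apply: (@le_trans _ _ ((1 + r * r / dR * La) ^+ n * M)); last first.
  by rewrite ler_wpM2r// expr1D_le.
elim: n x => [|n IH] x; first by rewrite mul1r.
by rewrite exprS -mulrA; exact: walk_le.
Qed.

Section solution.
Variables (t0 t1 : R) (u : R -> 'cV[R]_d -> R).
Hypothesis ru : regular_on `[t0, t1] u.
Hypothesis eq_u : forall t x, t0 < t <= t1 ->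
  u t x = u t0 x + \int[mu]_(s in `[t0, t]) gen (u s) x.

Lemma gen_modulus (rho e : R) : 0 < e -> exists2 de : R, 0 < de &
  forall t t' (x : 'cV[R]_d), t \in `[t0, t1] -> t' \in `[t0, t1] ->
    (forall i, `|x i ord0| <= rho) -> `|t - t'| < de -> `|gen (u t) x - gen (u t') x| <= e.
Proof.
have [C C0 CP] := gen_symbol_le Cc Cb_b Cb_sigma.
move=> e0; have e' : 0 < e / (C + 1) by rewrite divr_gt0// ltr_wpDl.
have [de de0 H] := regular_modulus ru rho e'; exists de => // t t' x tI t'I xr tt'.
rewrite !gen_symbolE -gen_symbolB; apply: (@le_trans _ _ (C * (e / (C + 1)))).
  apply: CP => s s2; apply: ltW; apply: H => // i.
  by rewrite subrr normr0.
by rewrite mulrCA ler_piMr ?ltW// ltr_pdivrMr ?ltr_wpDl// mul1r ltrDl.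
Qed.

Lemma continuous_gen x : {within `[t0, t1], continuous (fun t => gen (u t) x)}.
Proof.
apply/subspace_continuousP => t tI; apply/cvgrPdist_le => e e0.
have [de de0 H] := gen_modulus (norm1 x) e0.
rewrite near_withinE; apply/nbhs_ballP; exists de => // t' tt' t'I.
apply: H => // i; by rewrite /norm1 (bigD1 i)//= lerDl sumr_ge0.
Qed.

Lemma solution_increment x (t h e : R) : t0 <= t -> 0 < h -> t + h <= t1 ->
  (forall s, t <= s <= t + h -> `|gen (u s) x - gen (u t) x| <= e) ->
  `|u (t + h) x - u t x - h * gen (u t) x| <= h * e.
Proof.
move=> t0t h0 tht1 Ge.
have th : t < t + h by rewrite ltrDl.
(* At s = t0 the equation is not part of the hypothesis, but there the integral is over a point. *)
have E s : t0 <= s -> s <= t1 -> u s x = u t0 x + \int[mu]_(y in `[t0, s]) gen (u y) x.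
  rewrite le_eqVlt => /predU1P[<- _|ts st1]; last by apply: eq_u; rewrite ts.
  by rewrite set_itv1 Rintegral_set1 addr0.
rewrite (E (t + h)) ?(le_trans t0t (ltW th))// (E t) ?(le_trans (ltW th))//.
have := integral_increment (@continuous_gen x) t0t th tht1 Ge.
rewrite [t + h - t]addrC addKr; apply: le_trans.
by rewrite le_eqVlt; apply/orP; left; apply/eqP; congr `|_ - _|; ring.
Qed.

End solution.

(** A discrete maximum principle for the difference in the weighted norm. Outside the box of radius
    [rho] the difference is below e times the weight because both functions are bounded. Inside,
    solution and walk make the same increment h [gen u] up to an error less than h e; the weight
    grows at rate K, and the additional 1 in the exponent K + 1 pays for these local errors. *)
Lemma solution_walk : exists2 K : R, 0 <= K & forall t0 t1 u, t0 <= t1 ->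
  regular_on `[t0, t1] u ->
  (forall t x, t0 < t <= t1 -> u t x = u t0 x + \int[mu]_(s in `[t0, t]) gen (u s) x) ->
  forall M e : R, 0 < e -> exists2 de : R, 0 < de & forall r n f, 0 < r <= de ->
    t0 + n%:R * (r * r / dR) <= t1 -> (forall x, `|f x| <= M) ->
    (forall x, `|u t0 x - f x| <= e * weight x) ->
    forall x, `|u (t0 + n%:R * (r * r / dR)) x - iter n (walk r) f x| <=
      expR (K * (t1 - t0)) * (e * weight x).
Proof.
have [La La1 LaP] := coef_bound Cc Cb_b Cb_sigma.
have La0 : 0 <= La by apply: le_trans La1.
have [K K0 KP] := walk_weight.
have [C C0 CP] := walk_C2 d_gt0 Cc Cb_b Cb_sigma.
exists (K + 1) => [|t0 t1 u t01 ru eq_u M e e0]; first by rewrite addr_ge0.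
have [[Mu Mu_le] du _] := ru.
pose B := `|Mu| + expR (La * (t1 - t0)) * `|M|.
have B0 : 0 <= B by rewrite addr_ge0// mulr_ge0// expR_ge0.
(* If a coordinate exceeds [rho], then the weight exceeds [rho ^+ 2], which is at least B / e. *)
pose rho := B / e + 1.
have rho1 : 1 <= rho by rewrite lerDr divr_ge0// ltW.
have [de1 de10 H1] := gen_modulus ru rho (divr_gt0 e0 (ltr0n R 4)).
have C1 : 0 < C + 1 by rewrite ltr_wpDl.
have e3 : 0 < e / (4 * (C + 1)) by rewrite divr_gt0// mulr_gt0.
have [de2 de20 H2] := regular_modulus ru rho e3.
have [M2 M20 H3] := regular_bounded ru rho.
have M21 : 0 < C * M2 + 1 by rewrite ltr_wpDl// mulr_ge0.
(* [de3] keeps the reach of one step below [de2], and [de4] makes the error C * M2 * h^2 at most h *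
   e / 4. *)
pose de3 := de2 / (C + 1) / 2; pose de4 := e / (4 * (C * M2 + 1)).
exists (Num.min (Num.min 1 (de1 / 2)) (Num.min de3 de4)).
  by rewrite !lt_min ltr01 /de3 /de4 !divr_gt0// mulr_gt0.
move=> r n f /andP[r0]; rewrite !le_min => /andP[/andP[r1 rde1] /andP[rde3 rde4]].
have nr : `|r| = r by rewrite gtr0_norm.
have h0 : 0 < r * r / dR by rewrite divr_gt0// mulr_gt0.
have hr : r * r / dR <= r.
  rewrite ler_pdivrMr// (@le_trans _ _ (r * 1))//; rewrite ler_wpM2l ?(ltW r0)//.
  by rewrite ler1n.
have [h hE] : {h | h = r * r / dR} by eexists.
rewrite -hE in h0 hr * => nh fM uf x.
have h0' := ltW h0.
have nh' k : (k <= n)%N -> k%:R * h <= t1 - t0.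
  move=> kn; apply: (@le_trans _ _ (n%:R * h)); last by rewrite lerBrDl.
  by rewrite ler_wpM2r// ler_nat.
suff H k : (k <= n)%N -> forall x, `|u (t0 + k%:R * h) x - iter k (walk r) f x| <=
    (1 + (K + 1) * h) ^+ k * (e * weight x).
  apply: (le_trans (H n (leqnn n) x)); rewrite ler_wpM2r//.
    by rewrite mulr_ge0 ?(ltW e0)// (le_trans _ (weight_ge1 x)).
  have Kh : 0 <= (K + 1) * h by rewrite mulr_ge0// addr_ge0.
  apply: (le_trans (expr1D_le n Kh)); rewrite ler_expR mulrCA ler_wpM2l ?addr_ge0//.
  exact: nh'.
elim: k => [_|k IH kn] {}x; first by rewrite mul0r addr0 mul1r; exact: uf.
have {}IH := IH (ltnW kn).
have w1 := weight_ge1 x.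
have ew : 0 < e * weight x by rewrite mulr_gt0// (lt_le_trans _ w1).
have P1 : 1 <= (1 + (K + 1) * h) ^+ k.
  by rewrite exprn_ege1// lerDl mulr_ge0// addr_ge0.
have PS1 : 1 <= (1 + (K + 1) * h) ^+ k.+1.
  by rewrite exprn_ege1// lerDl mulr_ge0// addr_ge0.
set t := t0 + k%:R * h.
have tS : t0 + k.+1%:R * h = t + h by rewrite /t -natr1; ring.
have t0t : t0 <= t by rewrite /t lerDl mulr_ge0.
have tht1 : t + h <= t1 by rewrite -tS addrC -lerBrDr nh'.
have tI : t \in `[t0, t1] by rewrite in_itv/= t0t (le_trans _ tht1)// lerDl.
have thI : t + h \in `[t0, t1] by rewrite in_itv/= tht1 andbT (le_trans t0t)// lerDl.
rewrite tS.
have [/forallP xr|] := boolP [forall i, `|x i ord0| <= rho]; last first.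
  rewrite negb_forall => /existsP[i]; rewrite -ltNge => xi.
  apply: (@le_trans _ _ B).
    apply: (le_trans (ler_normB _ _)); apply: lerD.
      exact: le_trans (Mu_le _ _ thI) (ler_norm _).
    have cLa z : `|c z| <= La by have [] := LaP z.
    apply: (le_trans (iter_walk_le r k.+1 x La0 cLa (fun z => le_trans (fM z) (ler_norm M)))).
    rewrite ler_wpM2r// ler_expR -hE mulrA mulrC ler_wpM2l//.
    exact: nh'.
  apply: (@le_trans _ _ (1 * (e * weight x))); last by rewrite ler_wpM2r ?(ltW ew).
  rewrite mul1r -ler_pdivrMl// mulrC.
  apply: (@le_trans _ _ rho); first by rewrite lerDl.
  apply: (@le_trans _ _ (rho ^+ 2)); first by rewrite expr2 ler_peMr// (le_trans _ rho1).
  apply: (@le_trans _ _ (x i ord0 ^+ 2)).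
    by rewrite -[leRHS]real_normK ?num_real// lerXn2r ?nnegrE ?(ltW xi)// (le_trans _ rho1).
  rewrite /weight (bigD1 i)//= addrCA lerDl addr_ge0// sumr_ge0// => j _.
  exact: sqr_ge0.
have rho0 : 0 <= rho by rewrite (le_trans _ rho1).
have a1 : `|u (t + h) x - u t x - h * gen (u t) x| <= h * (e / 4).
  apply: (solution_increment ru eq_u) => // s /andP[ts sth].
  apply: H1 => //.
    by rewrite in_itv/= (le_trans t0t ts) (le_trans sth).
  rewrite ger0_norm ?subr_ge0//.
  apply: (@le_lt_trans _ _ h); first by rewrite lerBlDl.
  apply: (le_lt_trans hr); apply: (le_lt_trans rde1).
  by rewrite ltr_pdivrMr// ltr_pMr// ltr1n.
have a2 : `|walk r (u t) x - u t x - h * gen (u t) x| <=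
    C * (h * (e / (4 * (C + 1))) + h ^+ 2 * M2).
  rewrite hE; apply: CP => [|y|l y|s s2|k' l v vr].
  - by rewrite nr.
  - exact: (du [::]).
  - exact: (du [:: l]).
  - exact: H3.
  - apply: ltW; rewrite distrC.
    apply: (H2 [:: k'; l] t t x (x + v)) => // [|i]; first by rewrite subrr normr0.
    rewrite mxE opprD addNKr normrN; apply: (le_lt_trans (vr i)); rewrite nr.
    apply: (@le_lt_trans _ _ (C * de3)); first by rewrite ler_wpM2l.
    rewrite /de3 mulrA ltr_pdivrMr// mulrA ltr_pdivrMr//.
    by rewrite -subr_gt0 (_ : _ - _ = de2 * (C + 2)); [rewrite mulr_gt0// ltr_wpDl|ring].
have a3 : `|walk r (fun z => u t z - iter k (walk r) f z) x| <=
    (1 + K * h) * ((1 + (K + 1) * h) ^+ k * e * weight x).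
  rewrite hE; apply: KP => [||z].
  - by rewrite nr.
  - by rewrite mulr_ge0 ?(ltW e0)// -?hE (le_trans _ P1).
  - by rewrite -hE -mulrA; exact: IH.
rewrite /= (_ : _ - _ = (u (t + h) x - u t x - h * gen (u t) x) -
  (walk r (u t) x - u t x - h * gen (u t) x) +
  walk r (fun z => u t z - iter k (walk r) f z) x); last first.
  by rewrite walkB; move: (walk r _ x) (walk r _ x) (gen _ x) => *; ring.
apply: (le_trans (ler_normD _ _)); apply: (le_trans (lerD (ler_normB _ _) (lexx _))).
apply: (le_trans (lerD (lerD a1 a2) a3)).
have b1 : C * (h * (e / (4 * (C + 1)))) <= h * (e / 4).
  rewrite invfM mulrCA ler_wpM2l// mulrCA ler_wpM2l ?(ltW e0)// mulrCA ler_piMr//.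
  by rewrite ler_pdivrMr// mul1r lerDl.
have b2 : C * (h ^+ 2 * M2) <= h * (e / 4).
  have hde4 : h <= de4 by exact: le_trans rde4.
  have hC : h * (4 * (C * M2 + 1)) <= e by rewrite -ler_pdivlMr// mulr_gt0.
  rewrite (_ : C * _ = h * (h * (C * M2))); last by ring.
  rewrite ler_wpM2l// ler_pdivlMr//; apply: le_trans hC.
  by rewrite -subr_ge0 (_ : _ - _ = 4 * h); [rewrite mulr_ge0|ring].
have b3 : h * e <= h * ((1 + (K + 1) * h) ^+ k * (e * weight x)).
  rewrite ler_wpM2l// (@le_trans _ _ (1 * (e * weight x)))//.
    by rewrite mul1r ler_peMr// ltW.
  by rewrite ler_wpM2r// ltW.
have he : 0 <= h * (e / 4) by rewrite mulr_ge0// ltW// divr_gt0.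
rewrite (exprS _ k); move: ((1 + (K + 1) * h) ^+ k) b3 => P b3.
have -> : (1 + (K + 1) * h) * P * (e * weight x) =
  (1 + K * h) * (P * e * weight x) + h * (P * (e * weight x)) by ring.
rewrite addrC lerD2l mulrDr; apply: le_trans b3.
apply: (le_trans (lerD (lexx _) (lerD b1 b2))).
have -> : h * e = 4 * (h * (e / 4)) by field.
by move: (h * (e / 4)) he => z z0; lra.
Qed.

End solution_walk.

(** * Error accumulation over all observation intervals *)

Section scheme_error.
Context {R : realType} (d : nat).
Hypothesis d_gt0 : (0 < d)%N.
Variables (c : 'cV[R]_d -> R) (b : 'cV[R]_d -> 'cV[R]_d) (sigma : 'cV[R]_d -> 'M[R]_d).
Hypothesis Cc : Cb_infty c.
Hypothesis Cb_b : Cb_infty_mx b.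
Hypothesis Cb_sigma : Cb_infty_mx sigma.

Local Notation gen := (gen c b sigma).
Local Notation walk := (walk c b sigma).
Local Notation dR := (d%:R : R).
Local Notation mu := (@lebesgue_measure R).

Let d0 : 0 < dR. Proof. by rewrite ltr0n. Qed.

Lemma smooth_iter_walk r n f : smooth f -> smooth (iter n (walk r) f).
Proof. by move=> sf; elim: n => //= n; exact: smooth_walk. Qed.

Lemma iter_walk_jet (T : R) : 0 < T -> exists2 A : R, 1 <= A & exists2 r0 : R, 0 < r0 &
  forall r n f M, `|r| <= r0 -> n%:R * (r * r / dR) <= T -> smooth f -> jet_le f M ->
  jet_le (iter n (walk r) f) (A * M).
Proof.
move=> T0; have [K K0 KP] := walk_jet d_gt0 Cc Cb_b Cb_sigma.
pose w : R := (size (words d 4))%:R.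
have w1 : 1 <= w by rewrite ler1n.
pose E := expR (K * (dR * T)).
have E1 : 1 <= E by rewrite -expR0 ler_expR mulr_ge0 ?(ltW K0)// mulr_ge0 ?(ltW T0)// ltW.
have A1 : 1 <= E * w by rewrite -[leLHS]mul1r ler_pM.
exists (E * w) => //.
pose r0 := Num.min 1 K^-1.
exists r0; first by rewrite lt_min ltr01 invr_gt0.
move=> r n f M; rewrite le_min => /andP[r1 rK] nh sf fM.
have M0 : 0 <= M by exact: le_trans (fM [::] 0 isT).
have Kr : K * r ^+ 2 <= 1.
  rewrite -ler_pdivlMl// mulr1; apply: le_trans rK.
  by rewrite -real_normK ?num_real// expr2 ler_piMr.
have Kr0 : 0 <= K * r ^+ 2 by rewrite mulr_ge0 ?sqr_ge0// ltW.
apply: jet_sq_le => [|x]; first by rewrite mulr_ge0// (le_trans _ A1).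
apply: (@le_trans _ _ ((1 + K * r ^+ 2) ^+ n * (w * M ^+ 2))).
  elim: n {nh} x => [|n IH] x; first by rewrite mul1r; exact: jet_le_sq.
  rewrite exprS -mulrA; apply: KP => //; exact: smooth_iter_walk.
apply: (@le_trans _ _ (E * (w * M ^+ 2))).
  rewrite ler_wpM2r ?mulr_ge0 ?exprn_ge0//.
  apply: (le_trans (expr1D_le n Kr0)); rewrite ler_expR mulrCA ler_wpM2l ?(ltW K0)//.
  by move: nh; rewrite mulrA ler_pdivrMr// -expr2 [T * _]mulrC.
rewrite exprMn mulrA ler_wpM2r ?exprn_ge0// expr2 -{1}[E * w]mulr1.
by rewrite ler_wpM2l// (le_trans _ A1).
Qed.

Variables (T : R) (K : nat).
Hypotheses (T_gt0 : 0 < T) (K_gt0 : (0 < K)%N).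

Let Kn0 : K%:R != 0 :> R. Proof. by rewrite pnatr_eq0 -lt0n. Qed.

Lemma time_step_gt0 N : (0 < N)%N -> 0 < time_step T K N.
Proof. by move=> N0; rewrite divr_gt0// ltr0n muln_gt0 K_gt0. Qed.

Lemma obs_timeS N k : (0 < N)%N ->
  obs_time T K k.+1 = obs_time T K k + N%:R * time_step T K N.
Proof.
move=> N0; have Nn0 : N%:R != 0 :> R by rewrite pnatr_eq0 -lt0n.
rewrite /obs_time /time_step natrM -natr1; field.
by rewrite Nn0 Kn0.
Qed.

Lemma N_time_step N : (0 < N)%N -> N%:R * time_step T K N <= T.
Proof.
move=> N0; rewrite /time_step natrM invfM mulrCA [K%:R^-1 * _]mulrC mulVKf ?pnatr_eq0 -?lt0n//.
by rewrite ler_piMr ?(ltW T_gt0)// invf_le1 ?ltr0n// ler1n.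
Qed.

(* The fine chain, observation by observation: the walk runs for M steps
   between two observations. *)
Fixpoint fine_start (r : R) (M : nat) (f0 : 'cV[R]_d -> R) (ell : nat -> 'cV[R]_d -> R)
    (k : nat) : 'cV[R]_d -> R :=
  if k is k'.+1 then fun x => iter M (walk r) (fine_start r M f0 ell k') x * ell k x
  else f0.

(** The scheme psi enters only through a one-step property relative to any smooth g within distance
    e: stability in e and consistency in the jet of g. With the fine chain as g, the scheme itself
    is never differentiated, and the bound between scheme and chain does not involve r; the distance
    of the chain from p vanishes as r -> 0. *)
Lemma scheme_error (La CS ML M0 : R) : 0 <= La -> 0 <= CS -> 1 <= ML -> 0 <= M0 ->
  exists2 C : R, 0 < C & forall N f0 (ell : nat -> 'cV[R]_d -> R)
    (psi : nat -> nat -> 'cV[R]_d -> R) (p : nat -> R -> 'cV[R]_d -> R),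
  let tau := time_step T K N in
  (0 < N)%N -> tau <= 1 ->
  smooth f0 -> jet_le f0 M0 -> (forall k, smooth (ell k)) -> (forall k, jet_le (ell k) ML) ->
  (forall x, psi 0%N 0%N x = f0 x) ->
  (forall k x, (k < K)%N -> psi k.+1 0%N x = psi k N x * ell k.+1 x) ->
  (forall k n g M e, (k < K)%N -> (n < N)%N -> smooth g -> jet_le g M ->
     (forall x, `|psi k n x - g x| <= e) ->
     forall x, `|psi k n.+1 x - (g x + tau * gen g x)| <= (1 + tau * La) * e + CS * M * tau ^+ 2) ->
  (forall x, p 0%N 0 x = f0 x) ->
  (forall k x, (k < K)%N ->
     p k.+1 (obs_time T K k.+1) x = p k (obs_time T K k.+1) x * ell k.+1 x) ->
  (forall k, (k < K)%N -> regular_on `[obs_time T K k, obs_time T K k.+1] (p k)) ->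
  (forall k t x, (k < K)%N -> obs_time T K k < t <= obs_time T K k.+1 ->
     p k t x = p k (obs_time T K k) x +
       \int[mu]_(s in `[obs_time T K k, t]) gen (p k s) x) ->
  forall k n, grid_index K N (k, n) -> forall x,
    `|p k (grid_time T K N k n) x - psi k n x| <= C * tau.
Proof.
move=> La0 CS0 ML1 M00.
have ML0 : 0 <= ML by apply: le_trans ML1.
have [A A1 [r0 r00 AP]] := iter_walk_jet T_gt0.
have A0 : 0 <= A by apply: le_trans A1.
have [CW CW0 CWP] := iter_walk_consistent d_gt0 Cc Cb_b Cb_sigma.
have [K2 K20 K2P] := solution_walk d_gt0 Cc Cb_b Cb_sigma.
(* Growth of the jet bound in one observation interval: A for the walk, ML for the likelihood, and
   16 = 2^4 for the Leibniz rule. [MM] below bounds the jets of the chain throughout. *)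
pose G := 16 * (A * ML).
have AML1 : 1 <= A * ML by rewrite -[leLHS]mul1r; apply: ler_pM.
have G1 : 1 <= G by rewrite -[leLHS]mul1r; apply: ler_pM => //; rewrite ler1n.
have G0 : 0 <= G by apply: le_trans G1.
pose MM := A * (M0 * G ^+ K).
have MM0 : 0 <= MM by rewrite !mulr_ge0// exprn_ge0.
pose D := (CS + CW) * MM.
have D0 : 0 <= D by rewrite mulr_ge0// addr_ge0.
(* [E k * tau] bounds the error at the start of interval k: the error is amplified by at most exp(T
   La), local errors D tau^2 add up to at most T D tau, and the update multiplies by a likelihood
   bounded by ML. *)
pose E := fix E k : R := if k is k'.+1 then ML * (expR (T * La) * (E k' + T * D)) else 0.
have E0 k : 0 <= E k.
  by elim: k => //= k IH; rewrite !mulr_ge0 ?expR_ge0// addr_ge0// mulr_ge0// ltW.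
have eT1 : 1 <= expR (T * La) by rewrite -expR0 ler_expR mulr_ge0// ltW.
have TD : 0 <= T * D by rewrite mulr_ge0// ltW.
have Emono k : E k <= E k.+1.
  rewrite /= -[leLHS]mul1r; apply: ler_pM => //.
  by rewrite -[leLHS]mul1r; apply: ler_pM => //; rewrite lerDl.
have Ele k : (k <= K)%N -> E k <= E K.
  by move=> kK; rewrite -(subnK kK); elim: (K - k)%N => // j IH; rewrite addSn (le_trans IH).
pose C := expR (T * La) * (E K + T * D) + 1.
have C0 : 0 < C by rewrite ltr_wpDl// mulr_ge0 ?expR_ge0// addr_ge0.
exists C => // N f0 ell psi p tau N0 tau1 sf0 f0M sell ellM psi0 psiS psi_step p0 pS preg peq k n kn x.
have tau0 : 0 < tau by exact: time_step_gt0.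
have tau0' := ltW tau0.
have NtauT : N%:R * tau <= T by exact: N_time_step.
have wx0 : 0 < weight x by rewrite (lt_le_trans _ (weight_ge1 x)).
have jets r m j : `|r| <= r0 -> m%:R * (r * r / dR) = tau -> (j <= K)%N ->
    smooth (fine_start r (m * N) f0 ell j) /\
    jet_le (fine_start r (m * N) f0 ell j) (M0 * G ^+ j).
  move=> rr0 mh; have mNh : (m * N)%:R * (r * r / dR) <= T.
    by rewrite natrM mulrAC mh mulrC.
  elim: j => [_|j IH jK]; first by rewrite mulr1.
  have [sj jj] := IH (ltnW jK); split.
    by apply: smoothM => //; exact: smooth_iter_walk.
  move=> s y s4 /=.
  have := iter_partialM_le (k := 4) (smooth_iter_walk r (m * N) sj) (sell j.+1)
    (AP r (m * N)%N _ _ rr0 mNh sj jj) (ellM j.+1) y s4.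
  move=> /le_trans; apply; rewrite (exprS _ j) {2}/G le_eqVlt; apply/orP; left; apply/eqP; ring.
have psi_chi r m j i : `|r| <= r0 -> `|r| <= 1 -> m%:R * (r * r / dR) = tau -> (j < K)%N -> (i <= N)%N ->
    (forall y, `|psi j 0%N y - fine_start r (m * N) f0 ell j y| <= E j * tau) ->
    forall y, `|psi j i y - iter (m * i) (walk r) (fine_start r (m * N) f0 ell j) y| <=
      expR (T * La) * (E j + T * D) * tau.
  move=> rr0 r1 mh jK iN start y.
  have [sj jj] := jets r m j rr0 mh (ltnW jK).
  suff H l : (l <= N)%N -> forall y,
      `|psi j l y - iter (m * l) (walk r) (fine_start r (m * N) f0 ell j) y| <=
      (1 + tau * La) ^+ l * (E j * tau + l%:R * (D * tau ^+ 2)).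
    apply: (le_trans (H i iN y)); rewrite -mulrA.
    have itT : i%:R * tau <= T.
      by apply: le_trans NtauT; rewrite ler_wpM2r ?(ltW tau0)// ler_nat.
    apply: ler_pM => //.
    - by rewrite exprn_ge0// addr_ge0// mulr_ge0// ltW.
    - by apply: addr_ge0; [exact: mulr_ge0|rewrite mulr_ge0// mulr_ge0// exprn_ge0].
    - have tL : 0 <= tau * La by rewrite mulr_ge0// ltW.
      by apply: (le_trans (expr1D_le i tL)); rewrite ler_expR mulrA ler_wpM2r.
    - rewrite (mulrDl (E j)) lerD2l (_ : i%:R * _ = (i%:R * tau) * (D * tau)); last by ring.
      by rewrite -(mulrA T) ler_wpM2r// mulr_ge0.
  elim: l => [_|l IH lN] z.
    by rewrite muln0 mul1r mul0r addr0; exact: start.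
  set g := iter (m * l) (walk r) (fine_start r (m * N) f0 ell j).
  have sg : smooth g by exact: smooth_iter_walk.
  have gM : jet_le g MM.
    move=> s v s4; apply: (@le_trans _ _ (A * (M0 * G ^+ j))).
      apply: AP => //; rewrite natrM mulrAC mh mulrC.
      by apply: le_trans NtauT; rewrite ler_wpM2r ?(ltW tau0)// ler_nat ltnW.
    by rewrite ler_wpM2l// ler_wpM2l// ler_weXn2l// ltnW.
  have s1 := psi_step j l g MM _ jK lN sg gM (IH (ltnW lN)) z.
  have s2 : `|iter m (walk r) g z - g z - tau * gen g z| <= CW * MM * tau ^+ 2.
    by rewrite -mh; apply: CWP => //; rewrite mh.
  rewrite mulnS iterD -/g.
  rewrite (_ : _ - _ = (psi j l.+1 z - (g z + tau * gen g z)) -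
     (iter m (walk r) g z - g z - tau * gen g z)); last by move: (gen g z) => q; ring.
  apply: (le_trans (ler_normB _ _)); apply: (le_trans (lerD s1 s2)).
  have tL : 1 <= 1 + tau * La by rewrite lerDl mulr_ge0// ltW.
  have P1 : 1 <= (1 + tau * La) ^+ l.+1 by exact: exprn_ege1.
  rewrite -natr1 exprS in P1 *.
  have Dt0 : 0 <= D * tau ^+ 2 by rewrite mulr_ge0// exprn_ge0// ltW.
  apply: (@le_trans _ _ ((1 + tau * La) * (1 + tau * La) ^+ l *
     (E j * tau + l%:R * (D * tau ^+ 2)) + 1 * (D * tau ^+ 2))).
    by rewrite le_eqVlt; apply/orP; left; apply/eqP; rewrite /D; ring.
  rewrite (mulrDl l%:R) mul1r (addrA (E j * tau)) (mulrDr _ (E j * tau + _)) lerD2l.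
  by rewrite -[leLHS]mul1r ler_wpM2r.
have start r m j : `|r| <= r0 -> `|r| <= 1 -> m%:R * (r * r / dR) = tau -> (j <= K)%N ->
    forall y, `|psi j 0%N y - fine_start r (m * N) f0 ell j y| <= E j * tau.
  move=> rr0 r1 mh; elim: j => [_|j IH jK] y; first by rewrite psi0 subrr normr0 mul0r.
  rewrite psiS//= -mulrBl normrM mulrC -!mulrA.
  apply: ler_pM => //; first exact: (ellM _ [::]).
  by have := psi_chi r m j N rr0 r1 mh jK (leqnn N) (IH (ltnW jK)) y; rewrite mulrA.
have stage j : (j < K)%N ->
    (forall e, 0 < e -> exists2 de, 0 < de & forall r m, 0 < r <= de -> m%:R * (r * r / dR) = tau ->
       forall y, `|p j (obs_time T K j) y - fine_start r (m * N) f0 ell j y| <= e * weight y) ->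
    forall e, 0 < e -> exists2 de, 0 < de & forall r m i, 0 < r <= de -> m%:R * (r * r / dR) = tau ->
      (i <= N)%N -> forall y, `|p j (grid_time T K N j i) y -
        iter (m * i) (walk r) (fine_start r (m * N) f0 ell j) y| <= e * weight y.
  move=> jK IH e e0; set t0 := obs_time T K j in IH; set t1 := obs_time T K j.+1.
  have t01 : t0 <= t1 by rewrite /t1 (obs_timeS _ N0) lerDl mulr_ge0// ltW.
  pose X := expR (K2 * (t1 - t0)).
  have X0 : 0 < X by exact: expR_gt0.
  (* An interval amplifies the weighted error by X, so the tolerance at its start is e / X. *)
  have [de1 de10 H1] := IH _ (divr_gt0 e0 X0).
  have [de2 de20 H2] := K2P t0 t1 (p j) t01 (preg j jK) (fun t x => peq j t x jK) (M0 * G ^+ j)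
    _ (divr_gt0 e0 X0).
  exists (Num.min r0 (Num.min de1 de2)); first by rewrite !lt_min r00 de10.
  move=> r m i /andP[r_gt0]; rewrite !le_min => /andP[rr0 /andP[rde1 rde2]] mh iN y.
  have nr : `|r| = r by rewrite gtr0_norm.
  have [sj jj] : _ /\ _ := jets r m j (ltac:(by rewrite nr)) mh (ltnW jK).
  have mi : (m * i)%:R * (r * r / dR) = i%:R * tau by rewrite natrM mulrAC mh mulrC.
  have := H2 r (m * i)%N (fine_start r (m * N) f0 ell j).
  rewrite r_gt0 rde2 mi -/X => /(_ isT) H.
  have -> : grid_time T K N j i = t0 + i%:R * tau by [].
  have -> : e * weight y = X * (e / X * weight y) by rewrite mulrA [X * _]mulrC divfK ?gt_eqF.
  apply: H => [|z|z]; last by apply: H1 => //; rewrite r_gt0.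
    by rewrite /t1 (obs_timeS _ N0) lerD2l ler_wpM2r ?(ltW tau0)// ler_nat.
  exact: (jj [::]).
have conv j : (j <= K)%N -> forall e, 0 < e -> exists2 de, 0 < de &
    forall r m, 0 < r <= de -> m%:R * (r * r / dR) = tau ->
    forall y, `|p j (obs_time T K j) y - fine_start r (m * N) f0 ell j y| <= e * weight y.
  elim: j => [_ e e0|j IH jK e e0].
    exists 1 => // r m _ _ y; rewrite /obs_time mul0r mul0r p0 subrr normr0.
    by rewrite mulr_ge0 ?(ltW e0)// (le_trans _ (weight_ge1 y)).
  have ML_gt0 : 0 < ML by exact: lt_le_trans ML1.
  have [de de0 H] := stage j jK (IH (ltnW jK)) _ (divr_gt0 e0 ML_gt0).
  exists de => // r m rde mh y.
  have gE : obs_time T K j.+1 = grid_time T K N j N by rewrite (obs_timeS _ N0).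
  rewrite pS//= gE -mulrBl normrM.
  have -> : e * weight y = (e / ML * weight y) * ML.
    by rewrite mulrAC divfK ?gt_eqF.
  by apply: ler_pM => //; [exact: H|exact: (ellM _ [::])].
(* The choice r = (d tau / m)^(1/2) makes m steps of the walk last exactly tau, and a large m makes
   r small. *)
have pick_m de : 0 < de -> exists r m, 0 < r <= de /\ m%:R * (r * r / dR) = tau.
  move=> de0; pose m := (Num.bound (dR * tau / de ^+ 2)).+1.
  have q0 : 0 <= dR * tau / de ^+ 2.
    by rewrite divr_ge0 ?exprn_ge0 ?mulr_ge0 ?(ltW tau0) ?(ltW d0)// ltW.
  have m0 : 0 < m%:R :> R by [].
  have dm : 0 < dR * tau / m%:R by rewrite divr_gt0// mulr_gt0.
  exists (Num.sqrt (dR * tau / m%:R)), m; split.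
    rewrite sqrtr_gt0 dm/= -(ger0_norm (ltW de0)) -sqrtr_sqr ler_wsqrtr//.
    rewrite ler_pdivrMr// [de ^+ 2 * _]mulrC -ler_pdivrMr ?exprn_gt0//.
    by apply: (le_trans (ltW (archi_boundP q0))); rewrite ler_nat.
  rewrite -expr2 sqr_sqrtr ?(ltW dm)//; field.
  by rewrite !gt_eqF.
have main e : 0 < e -> `|p k (grid_time T K N k n) x - psi k n x| <= C * tau + e.
  (* At the fixed point x the weight is a constant and is divided out of the tolerance. *)
  move=> e0; have ew : 0 < e / weight x by rewrite divr_gt0.
  have Ck j : (j <= K)%N -> expR (T * La) * (E j + T * D) * tau <= C * tau.
    move=> jK; rewrite ler_wpM2r ?(ltW tau0)// /C.
    apply: (@le_trans _ _ (expR (T * La) * (E K + T * D))); last by rewrite lerDl.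
    by rewrite ler_wpM2l ?expR_ge0// lerD2r Ele.
  case: kn => [[/= kK nN]|[-> ->]].
    have [de de0 H] := stage k kK (conv k (ltnW kK)) _ ew.
    have min0 : 0 < Num.min de (Num.min r0 1) by rewrite !lt_min de0 r00 ltr01.
    have [r [m [/andP[r_gt0]]]] := pick_m _ min0.
    rewrite !le_min => /andP[rde /andP[rr0 r1]] mh.
    have nr : `|r| = r by rewrite gtr0_norm.
    have a1 : `|p k (grid_time T K N k n) x -
        iter (m * n) (walk r) (fine_start r (m * N) f0 ell k) x| <= e.
      have := H r m n; rewrite r_gt0 rde => /(_ isT mh nN x).
      by rewrite divfK ?gt_eqF.
    have a2 := psi_chi r m k n; rewrite nr in a2.
    have {}a2 := a2 rr0 r1 mh kK nN (start r m k (ltac:(by rewrite nr)) (ltac:(by rewrite nr)) mh (ltnW kK)) x.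
    rewrite [leRHS]addrC -(subrKA (iter (m * n) (walk r) (fine_start r (m * N) f0 ell k) x)).
    apply: (le_trans (ler_normD _ _)); apply: lerD => //.
    by rewrite distrC (le_trans a2)// Ck// ltnW.
  have [de de0 H] := conv K (leqnn K) _ ew.
  have min0 : 0 < Num.min de (Num.min r0 1) by rewrite !lt_min de0 r00 ltr01.
  have [r [m [/andP[r_gt0]]]] := pick_m _ min0.
  rewrite !le_min => /andP[rde /andP[rr0 r1]] mh.
  have nr : `|r| = r by rewrite gtr0_norm.
  rewrite /grid_time mul0r addr0.
  have a1 : `|p K (obs_time T K K) x - fine_start r (m * N) f0 ell K x| <= e.
    have := H r m; rewrite r_gt0 rde => /(_ isT mh x).
    by rewrite divfK ?gt_eqF.
  have a2 := start r m K; rewrite nr in a2.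
  have {}a2 := a2 rr0 r1 mh (leqnn K) x.
  rewrite [leRHS]addrC -(subrKA (fine_start r (m * N) f0 ell K x)).
  apply: (le_trans (ler_normD _ _)); apply: lerD => //.
  rewrite distrC (le_trans a2)// (le_trans _ (Ck K _))//.
  rewrite ler_wpM2r ?(ltW tau0)// -[leLHS]mul1r ler_pM//.
  by rewrite lerDl.
by apply/ler_addgt0Pr => e e0; exact: main.
Qed.

End scheme_error.

(** * Measurability *)

Section borel_matrices.
Context {R : realType} (m n : nat).
Implicit Types (A M : 'M[R]_(m, n)).

Definition mx_box M (e : R) := [set M' : 'M[R]_(m, n) | forall i j, `|M i j - M' i j| < e].

Lemma measurable_mx_box M e : measurable (mx_box M e).
Proof.
rewrite (_ : mx_box M e = \bigcap_(p in [set: 'I_m * 'I_n])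
    (fun M' : 'M[R]_(m, n) => M' p.1 p.2) @^-1` [set t | `|M p.1 p.2 - t| < e]).
  apply: fin_bigcap_measurable; first exact: finite_finset.
  move=> p _; rewrite -[X in measurable X]setTI; apply: measurable_entry => //.
  rewrite (_ : [set t | _] = `](M p.1 p.2 - e), (M p.1 p.2 + e)[%classic).
    exact: measurable_itv.
  by apply/seteqP; split => t /=; rewrite in_itv/= ltr_distlC.
by apply/seteqP; split => [M' H [i j] _|M' H i j]; [exact: H|exact: (H (i, j))].
Qed.

(** Boxes with rational centre and radius 1 / (k + 1) are a countable base of the topology. They
    belong to the sigma-algebra generated by the entries, which therefore contains all open sets. *)
Lemma mx_box_rat (U : set 'M[R]_(m, n)) M : open U -> U M ->
  exists p : 'M[rat]_(m, n) * nat,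
    mx_box (map_mx ratr p.1) p.2.+1%:R^-1 M /\
    mx_box (map_mx ratr p.1) p.2.+1%:R^-1 `<=` U.
Proof.
move=> oU UM; have /nbhs_ballP[e /= e0 eU] : nbhs M U by exact: open_nbhs_nbhs.
pose k := Num.bound (2 / e).
have k2 : 2 * (k.+1%:R^-1 : R) <= e.
  rewrite ler_pdivrMr// -ler_pdivrMl// mulrC.
  apply: (le_trans (ltW (archi_boundP _))); first by rewrite divr_ge0// ltW.
  by rewrite ler_nat.
have /choice[q qP] : forall p : 'I_m * 'I_n, exists q : rat,
    `|ratr q - M p.1 p.2| < k.+1%:R^-1.
  move=> p; have [|q] := @rat_in_itvoo R (M p.1 p.2 - k.+1%:R^-1) (M p.1 p.2 + k.+1%:R^-1).
    by rewrite ltrBlDr -addrA ltrDl addr_gt0// invr_gt0.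
  by rewrite in_itv/= => qI; exists q; rewrite distrC ltr_distlC.
exists (\matrix_(i, j) q (i, j), k); split => [i j|M' H]; first by rewrite !mxE; exact: (qP (i, j)).
apply: eU; split => // i j /=; apply: lt_le_trans k2; rewrite mulr2n mulrDl mul1r.
rewrite /ball/= -(subrKA (ratr (q (i, j)))); apply: (le_lt_trans (ler_normD _ _)).
apply: ltrD; first by rewrite distrC; exact: (qP (i, j)).
by have := H i j; rewrite !mxE.
Qed.

Lemma open_measurable_mx (U : set 'M[R]_(m, n)) : open U -> measurable U.
Proof.
move=> oU; pose F (p : 'M[rat]_(m, n) * nat) :=
  if pselect (mx_box (map_mx ratr p.1) p.2.+1%:R^-1 `<=` U)
  then mx_box (map_mx ratr p.1) p.2.+1%:R^-1 else set0.
rewrite (_ : U = \bigcup_p F p).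
  apply: countable_bigcupT_measurable => [|p]; first exact: countableP.
  by rewrite /F; case: pselect => ?; [exact: measurable_mx_box|exact: measurable0].
apply/seteqP; split => [M UM|M [p _]]; last by rewrite /F; case: pselect => // H; exact: H.
have [p [pM pU]] := mx_box_rat oU UM.
by exists p => //; rewrite /F; case: pselect.
Qed.

Lemma continuous_measurable_mx (f : 'M[R]_(m, n) -> R) :
  continuous f -> measurable_fun setT f.
Proof.
move=> /continuousP cf; apply: (measurability _ (RGenOpens.measurableE R)).
move=> _ [_ [a [b ->] <-]]; rewrite setTI; apply: open_measurable_mx.
exact/cf/interval_open.
Qed.

End borel_matrices.

Section strong_measurability.
Context {R : realType} (m n : nat).
Implicit Types (A M : 'M[R]_(m, n)).

(** Every point outside the support lies in a null box of the countable base, and countably many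
    null boxes form a null set. *)
Lemma msupport_ae (nu : {measure set 'M[R]_(m, n) -> \bar R}) :
  {ae nu, forall y, msupport nu y}.
Proof.
pose F (k : nat) : set 'M[R]_(m, n) := if unpickle k is Some p then
  let B := mx_box (map_mx ratr (p : 'M[rat]_(m, n) * nat).1) p.2.+1%:R^-1 in
  if nu B == 0 then B else set0 else set0.
have [N [mN N0 FN]] : nu.-negligible (\bigcup_k F k).
  apply: negligible_bigcup => k; rewrite /F; case: unpickle => [p|]; last exact: negligible_set0.
  case: ifPn => [/eqP nu0|_]; last exact: negligible_set0.
  by apply/negligibleP => //; exact: measurable_mx_box.
exists N; split => //; apply: subset_trans FN.
move=> y /= /existsNP[U /not_implyP[oU /not_implyP[Uy /negP nuU]]].
have [p [py pU]] := mx_box_rat oU Uy.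
exists (pickle p) => //; rewrite /F pickleK ifT// -measure_le0.
apply: (@le_trans _ _ (nu U)); last by rewrite leNgt.
apply: le_measure => //; rewrite inE; first exact: measurable_mx_box.
exact: open_measurable_mx.
Qed.

(* round r t lies on the grid of mesh 1/r of [-r, r] *)
Definition round_nat (r : nat) (t : R) : nat :=
  minn (Num.truncn (r%:R * (t + r%:R))) (2 * r * r).

Definition round (r : nat) (t : R) : R := (round_nat r t)%:R / r%:R - r%:R.

Definition round_mx r M : 'M[R]_(m, n) := \matrix_(i, j) round r (M i j).

Lemma round_close r t : (0 < r)%N -> `|t| <= r%:R -> `|round r t - t| <= r%:R^-1.
Proof.
move=> r0; rewrite ler_norml => /andP[rt tr].
have rR : 0 < r%:R :> R by rewrite ltr0n.
have x0 : 0 <= r%:R * (t + r%:R) by rewrite mulr_ge0// -lerBlDr sub0r.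
have xr : r%:R * (t + r%:R) <= (2 * r * r)%:R.
  have -> : (2 * r * r)%:R = r%:R * (r%:R + r%:R) :> R by rewrite !natrM; ring.
  by rewrite ler_wpM2l// lerD2r.
rewrite /round /round_nat (minn_idPl _); last first.
  by rewrite -(ler_nat R) (le_trans _ xr)// truncn_le.
have /andP[x1 x2] := truncn_itv x0.
rewrite -(ler_pM2l rR) divff ?gt_eqF// -{1}(gtr0_norm rR) -normrM.
rewrite (_ : r%:R * _ = (Num.truncn (r%:R * (t + r%:R)))%:R - r%:R * (t + r%:R)); last first.
  by field; rewrite gt_eqF.
by rewrite ler_distlC lerBlDr (le_trans x1) ?lerDl//= natr1 ltW// (lt_le_trans x2)// ler_nat.
Qed.

Lemma round_nat_le r (s t : R) : s <= t -> (round_nat r s <= round_nat r t)%N.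
Proof.
move=> st; rewrite leq_min geq_minr andbT (leq_trans (geq_minl _ _))//.
by apply: le_truncn; rewrite ler_wpM2l// lerD2r.
Qed.

Lemma measurable_round_nat r k : measurable [set t | round_nat r t = k].
Proof.
apply: is_interval_measurable => s t /= <- ts z /andP[sz zt].
by apply/eqP; rewrite eqn_leq -{1}ts !round_nat_le.
Qed.

Lemma finite_round_mx r : finite_set (range (round_mx r)).
Proof.
pose F (f : {ffun 'I_m * 'I_n -> 'I_(2 * r * r).+1}) : 'M[R]_(m, n) :=
  \matrix_(i, j) ((f (i, j))%:R / r%:R - r%:R).
apply: (@sub_finite_set _ _ (F @` setT)); last by apply: finite_image; exact: finite_finset.
move=> _ [M _ <-]; exists [ffun p => inord (round_nat r (M p.1 p.2))] => //.
apply/matrixP => i j; rewrite !mxE ffunE inordK//=.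
by rewrite ltnS geq_minr.
Qed.

Lemma measurable_round_mx r A : measurable [set M | round_mx r M = A].
Proof.
rewrite (_ : [set M | _] = \bigcap_(p in [set: 'I_m * 'I_n])
    (fun M : 'M[R]_(m, n) => M p.1 p.2) @^-1` [set t | round r t = A p.1 p.2]).
  apply: fin_bigcap_measurable; first exact: finite_finset.
  move=> p _; rewrite -[X in measurable X]setTI; apply: measurable_entry => //.
  rewrite (_ : [set t | _] = \bigcup_(k in [set k | k%:R / r%:R - r%:R = A p.1 p.2])
      [set t | round_nat r t = k]).
    by apply: bigcup_measurable => k _; exact: measurable_round_nat.
  by apply/seteqP; split => [t /= tA|t [k /= kA tk]]; [exists (round_nat r t)|rewrite /= /round tk].
apply/seteqP; split => [M /= <- p _ /=|M H /=]; first by rewrite mxE.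
by apply/matrixP => i j; rewrite mxE; exact: (H (i, j)).
Qed.

Definition norm1_mx M : R := \sum_i \sum_j `|M i j|.

Lemma norm1_mx_ge0 M : 0 <= norm1_mx M.
Proof. by apply: sumr_ge0 => i _; exact: sumr_ge0. Qed.

Lemma entry_le_norm1_mx M i j : `|M i j| <= norm1_mx M.
Proof.
rewrite /norm1_mx (bigD1 i)//= (bigD1 j)//= -addrA lerDl addr_ge0//.
  exact: sumr_ge0.
by apply: sumr_ge0 => k _; exact: sumr_ge0.
Qed.

Lemma round_mx_close r M : (0 < r)%N -> norm1_mx M <= r%:R ->
  norm1_mx (round_mx r M - M) <= (m * n)%:R / r%:R.
Proof.
move=> r0 Mr; apply: (@le_trans _ _ (\sum_(i < m) \sum_(j < n) r%:R^-1)).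
  apply: ler_sum => i _; apply: ler_sum => j _; rewrite !mxE; apply: round_close => //.
  by apply: le_trans Mr; exact: entry_le_norm1_mx.
rewrite sumr_const card_ord sumr_const card_ord -mulrnA mulnC -[_ *+ _]mulr_natr.
by rewrite mulrC.
Qed.

Context (d : nat) (nu : {measure set 'M[R]_(m, n) -> \bar R}).

(** Rounding y to a finite grid gives simple functions, and the Lipschitz bound in y, uniform in x,
    makes them converge in the supremum norm over x. *)
Lemma lipschitz_strongly_measurable (psi : 'M[R]_(m, n) -> 'cV[R]_d -> R) (B Ly : R) :
  (forall y, continuous (psi y)) -> (forall y x, `|psi y x| <= B) ->
  (forall y y' x, `|psi y x - psi y' x| <= Ly * norm1_mx (y - y')) ->
  strongly_measurable nu psi.
Proof.
move=> cpsi Bpsi Lpsi; exists (fun r y => psi (round_mx r y)) => [r|].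
  split => [|g|y]; last by split => //; exists B.
    apply: (@sub_finite_set _ _ (psi @` range (round_mx r))).
      by move=> _ [y _ <-]; exists (round_mx r y) => //; exists y.
    by apply: finite_image; exact: finite_round_mx.
  rewrite (_ : _ @^-1` _ = \bigcup_(A in [set A | range (round_mx r) A /\ psi A = g])
      [set M | round_mx r M = A]).
    apply: fin_bigcup_measurable => [|A _]; last exact: measurable_round_mx.
    by apply: (sub_finite_set _ (finite_round_mx r)) => A [].
  apply/seteqP; split => [y /= yg|y [A [_ Ag] /= ->]//].
  by exists (round_mx r y) => //; split => //; exists y.
apply: aeW => y e e0.
(* The sign of [Ly] is not prescribed; a negative value forces all norms to vanish. *)
have Ly0 : 0 <= Ly \/ forall z, norm1_mx z = 0.
  have [Ly0|Ly0] := leP 0 Ly; [by left|right] => z.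
  apply/eqP; rewrite eq_le norm1_mx_ge0 andbT -(nmulr_rge0 _ Ly0).
  by have := Lpsi z 0 0; rewrite subr0; exact: le_trans.
have [Ly0'|z0] := Ly0; last first.
  by exists 0%N => r _ x; rewrite (le_trans (Lpsi _ _ _))// z0 mulr0 ltW.
pose q : R := norm1_mx y + Ly * (m * n)%:R / e.
have q0 : 0 <= q by rewrite addr_ge0 ?norm1_mx_ge0// divr_ge0 ?mulr_ge0// ltW.
exists (Num.bound q).+1 => r qr x.
have r0 : (0 < r)%N by exact: leq_ltn_trans qr.
have rR : 0 < r%:R :> R by rewrite ltr0n.
have qr' : q <= r%:R.
  by apply: (le_trans (ltW (archi_boundP q0))); rewrite ler_nat ltnW.
apply: (le_trans (Lpsi _ _ _)).
apply: (@le_trans _ _ (Ly * ((m * n)%:R / r%:R))).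
  rewrite ler_wpM2l// round_mx_close// (le_trans _ qr')// lerDl.
  by rewrite divr_ge0 ?mulr_ge0// ltW.
rewrite mulrA ler_pdivrMr// [e * _]mulrC -ler_pdivrMr// (le_trans _ qr')// lerDr.
exact: norm1_mx_ge0.
Qed.

(** Fubini's theorem requires joint measurability in (y, x). A simple function has finitely many
    values, each a continuous function of x on a measurable set of y; the limit is taken after
    setting everything to 0 on the exceptional null set. *)
Lemma strongly_measurable_version (u : 'M[R]_(m, n) -> 'cV[R]_d -> R) :
  strongly_measurable nu u -> exists2 v : 'M[R]_(m, n) * 'cV[R]_d -> R,
    measurable_fun setT v & {ae nu, forall y, forall x, v (y, x) = u y x}.
Proof.
move=> [s simple_s [N [mN N0 sN]]].
have sub y : ~ N y -> forall e, 0 < e ->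
    exists r0, forall r, (r0 <= r)%N -> forall x, `|s r y x - u y x| <= e.
  by move=> Ny; apply: contrapT => H; apply: Ny; apply: sN.
pose v (z : 'M[R]_(m, n) * 'cV[R]_d) := if pselect (N z.1) then 0 else u z.1 z.2.
pose w r (z : 'M[R]_(m, n) * 'cV[R]_d) := if pselect (N z.1) then 0 else s r z.1 z.2.
exists v; last first.
  exists N; split => // y /= H; apply: contrapT => Ny; apply: H => x.
  by rewrite /v/=; case: pselect.
apply: (@measurable_fun_cvg _ _ _ _ w); last first.
  move=> z _; apply/cvgrPdist_le => e e0; rewrite /w /v.
  case: pselect => [Nz|Nz]; first by near=> r; rewrite subrr normr0 ltW.
  have [r0 H] := sub _ Nz _ e0; near=> r; rewrite distrC; apply: H.
  by near: r; exists r0.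
move=> r _ B mB; rewrite setTI.
have [fs ms cs] := simple_s r.
rewrite (_ : w r @^-1` B =
    ([set z | N z.1] `&` [set z | B 0]) `|`
    (~` [set z | N z.1] `&` \bigcup_(g in range (s r)) ((s r @^-1` [set g]) `*` (g @^-1` B)))).
  have mN' : measurable [set z : 'M[R]_(m, n) * 'cV[R]_d | N z.1].
    rewrite -[X in measurable X]setTI.
    exact: (measurable_fst (T1 := 'M[R]_(m, n)) (T2 := 'cV[R]_d)).
  apply: measurableU; apply: measurableI => //.
  - have [B0|nB0] := pselect (B 0).
      by rewrite (_ : [set z | _] = setT)//; apply/seteqP; split.
    by rewrite (_ : [set z | _] = set0)//; apply/seteqP; split.
  - exact: measurableC.
  - apply: fin_bigcup_measurable => // g [y _ <-]; apply: measurableX => //.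
    rewrite -[X in measurable X]setTI; apply: continuous_measurable_mx => //.
    by have [] := cs y.
apply/seteqP; split => [[y x] /=|[y x] /=]; rewrite /w/=; case: pselect => Ny.
- by left.
- by move=> H; right; split => //; exists (s r y); [exists y|].
- by move=> [[]|[]].
- by move=> [[]//|[_ [g [y' _ <-]] [/= -> ]]].
Unshelve. all: by end_near.
Qed.

End strong_measurability.

(** * Lower integrals, pi-systems and product laws *)

Section integration.
Context {R : realType} d (T : measurableType d).
Local Open Scope ereal_scope.
Import HBNNSimple.

(* f and g need not be measurable: the integral is then the lower integral. *)
Lemma ae_le_lower_integral (mu : {measure set T -> \bar R}) (f g : T -> \bar R) :
  (forall x, 0 <= f x) -> (forall x, 0 <= g x) ->
  {ae mu, forall x, f x <= g x} -> \int[mu]_x f x <= \int[mu]_x g x.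
Proof.
move=> f0 g0 [N [mN N0 fgN]].
rewrite !ge0_integralTE//; apply: ge_ereal_sup => _ [h hf <-].
have mNC : measurable (~` N) by exact: measurableC.
(* Cutting the simple function h off on the null set N keeps its integral and puts it below g
   everywhere. *)
have -> : sintegral mu h = sintegral mu (proj_nnsfun h mNC).
  rewrite -!integralT_nnsfun; apply: ge0_ae_eq_integral => //.
  - exact/measurable_EFinP.
  - exact/measurable_EFinP.
  - by move=> x _; rewrite lee_fin.
  - by move=> x _; rewrite lee_fin.
  - exists N; split => // x /=; apply: contra_notP => Nx _.
    by rewrite /= mindicE mem_set// mulr1.
apply: ereal_sup_ubound => /=; exists (proj_nnsfun h mNC) => // x.
rewrite /= mindicE; case: (boolP (x \in ~` N)) => [Nx|_]; last by rewrite mulr0; exact: g0.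
rewrite mulr1 (le_trans (hf x))//; apply: contrapT => fg.
by move: Nx; rewrite inE => Nx; apply/Nx/fgN.
Qed.

Lemma eq_measure_pi (G : set (set T)) (m1 m2 : {measure set T -> \bar R}) :
  @measurable _ T = <<s G >> -> setI_closed G -> G [set: T] -> m1 [set: T] < +oo ->
  (forall A, G A -> m1 A = m2 A) -> forall A, measurable A -> m1 A = m2 A.
Proof.
move=> GE GI GT m1T m12 A mA.
apply: (@g_sigma_algebra_measure_unique _ _ _ G _ (fun=> setT)) => //.
- by rewrite GE; exact: sub_sigma_algebra.
- by apply/seteqP; split => // x _; exists 0%N.
- by rewrite -GE.
Qed.

End integration.

Section independence.
Context {R : realType} d (Omega : measurableType d) (P : probability Omega R).
Local Open Scope ereal_scope.

(** Both sides are finite measures in A, and these are determined by their values on a pi-system. *)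
Lemma indep_event_pi d1 (T : measurableType d1) (X : Omega -> T) (G : set (set T)) E :
  measurable_fun setT X -> measurable E ->
  @measurable _ T = <<s G >> -> setI_closed G -> G [set: T] ->
  (forall A, G A -> P (X @^-1` A `&` E) = P (X @^-1` A) * P E) ->
  forall A, measurable A -> P (X @^-1` A `&` E) = P (X @^-1` A) * P E.
Proof.
move=> mX mE GE GI GT XE A mA.
have PE0 : (0 <= fine (P E))%R by exact: fine_ge0.
have PEfin : P E = (fine (P E))%:E by rewrite fineK// fin_num_measure.
pose m1 := measure_function_pushforward__canonical__measure_function_Measure (mrestr P mE) mX.
pose m2 := mscale (NngNum PE0)
  (measure_function_pushforward__canonical__measure_function_Measure P mX).
have : m1 A = m2 A.
  apply: (@eq_measure_pi R _ T G m1 m2) => //.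
    rewrite /m1/= /pushforward/= /mrestr preimage_setT setTI.
    by rewrite (le_lt_trans (probability_le1 P mE))// ltry.
  move=> B GB; change (P (X @^-1` B `&` E) = (fine (P E))%:E * P (X @^-1` B)).
  by rewrite -PEfin XE// muleC.
change (P (X @^-1` A `&` E) = (fine (P E))%:E * P (X @^-1` A) -> P (X @^-1` A `&` E) = P (X @^-1` A) * P E).
by move=> ->; rewrite -PEfin muleC.
Qed.

Lemma joint_law d1 d2 (T1 : measurableType d1) (T2 : measurableType d2)
    (X : {mfun Omega >-> T1}) (Y : {mfun Omega >-> T2}) :
  (forall A B, measurable A -> measurable B ->
     P (X @^-1` A `&` Y @^-1` B) = P (X @^-1` A) * P (Y @^-1` B)) ->
  forall f : T1 * T2 -> \bar R, measurable_fun setT f -> (forall z, 0 <= f z) ->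
  \int[P]_w f (X w, Y w) = \int[distribution P Y]_y \int[distribution P X]_x f (x, y).
Proof.
move=> XY f mf f0.
have mV : measurable_fun setT (fun w => (X w, Y w)) by exact: measurable_fun_pair.
pose V : {mfun Omega >-> (T1 * T2)%type} := HB.pack (fun w => (X w, Y w))
  (isMeasurableFun.Build _ _ _ _ _ mV).
transitivity (\int[distribution P V]_z f z); first by rewrite ge0_integral_distribution.
rewrite -fubini_tonelli2//; apply: eq_measure_integral => A mA _.
by apply/esym/product_measure_unique => // B1 B2 mB1 mB2; exact: XY.
Qed.

End independence.

(** * Gaussian vectors *)

Section normal_moments.
Context {R : realType}.
Local Notation leb := (@lebesgue_measure R).
Implicit Types (s a x : R).

Lemma ge0_integral_normal_prob s (f : R -> \bar R) :
  measurable_fun [set: measurableTypeR R] f -> (forall x, 0 <= f x)%E ->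
  (\int[normal_prob 0 s]_x f x = \int[leb]_x (f x * (normal_pdf 0 s x)%:E))%E.
Proof.
move=> mf f0; have dom := @normal_prob_dominates R 0 s.
have pm : measurable_fun [set: measurableTypeR R] (EFin \o normal_pdf 0 s).
  by apply/measurable_EFinP; exact: measurable_normal_pdf.
rewrite -(Radon_Nikodym_SigmaFinite.change_of_variables dom)//.
have gm := measurable_int _ (Radon_Nikodym_SigmaFinite.f_integrable dom).
have /ae_eq_sym gE : ae_eq leb setT (EFin \o normal_pdf 0 s)
    (Radon_Nikodym_SigmaFinite.f (normal_prob 0 s) leb).
  apply: integral_ae_eq => //; first exact: integrable_normal_pdf.
  by move=> E _ mE; rewrite -Radon_Nikodym_SigmaFinite.f_integral.
apply: ge0_ae_eq_integral => //.
- exact: emeasurable_funM.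
- exact: emeasurable_funM.
- by move=> x _; rewrite mule_ge0// Radon_Nikodym_SigmaFinite.f_ge0.
- by move=> x _; rewrite mule_ge0// lee_fin normal_pdf_ge0.
- exact: ae_eqe_mul2l.
Qed.

Lemma normal_pdf_scale s a x : 0 < s -> 0 < a ->
  normal_pdf 0 (s / a) x =
    a * normal_pdf 0 s x * expR ((1 - a ^+ 2) * x ^+ 2 / (s ^+ 2 *+ 2)).
Proof.
move=> s0 a0; have sa0 : 0 < s / a by rewrite divr_gt0.
rewrite !normal_pdfE ?gt_eqF//; have -> : normal_peak (s / a) = a * normal_peak s.
  rewrite /normal_peak; have -> : (s / a) ^+ 2 * pi *+ 2 = (a^-1) ^+ 2 * (s ^+ 2 * pi *+ 2).
    by rewrite !mulr2n exprMn; move: pi => q; ring.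
  by rewrite sqrtrM ?sqr_ge0// sqrtr_sqr gtr0_norm ?invr_gt0// invfM invrK.
rewrite -!mulrA; congr (_ * (_ * _)); rewrite /normal_fun -expRD; congr expR.
have ss : 0 < s ^+ 2 + s ^+ 2 by rewrite addr_gt0 ?exprn_gt0.
rewrite !subr0 !mulr2n; field.
by rewrite (gt_eqF ss) (gt_eqF a0).
Qed.

Lemma sqr_le_expR (t : R) : 0 <= t -> t ^+ 2 <= 4 * expR t.
Proof.
move=> t0; have -> : expR t = expR (t / 2) ^+ 2.
  by rewrite expr2 -expRD -splitr.
have := expR_ge1Dx (t / 2); nra.
Qed.

Let msq s : measurable_fun [set: measurableTypeR R] (fun x : R => x ^+ 2 * normal_pdf 0 s x).
Proof.
apply: measurable_funM; last exact: measurable_normal_pdf.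
by apply: measurable_funX; exact: measurable_id.
Qed.

(** The density of standard deviation 2 s is half that of standard deviation s times exp(3 x^2 / (8
    s^2)), which dominates powers of x. Moments are thus bounded by the total mass of the wider
    law. *)
Lemma normal_sqr_tail s x : 0 < s -> x ^+ 2 * normal_pdf 0 s x <= 6 * s ^+ 2 * normal_pdf 0 (s / 2^-1) x.
Proof.
move=> s0; rewrite (@normal_pdf_scale s 2^-1)//.
have := @normal_pdf_ge0 R 0 s x; move: (normal_pdf 0 s x) => p p0.
have s2 : 0 < s ^+ 2 by rewrite exprn_gt0.
have -> : (1 - 2^-1 ^+ 2) * x ^+ 2 / (s ^+ 2 *+ 2) = (3 / 8) * (x ^+ 2 / s ^+ 2).
  by rewrite mulr2n; field; rewrite gt_eqF.
have := expR_ge1Dx ((3 / 8) * (x ^+ 2 / s ^+ 2)); move: (expR _) => e.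
have -> : x ^+ 2 * p = s ^+ 2 * (x ^+ 2 / s ^+ 2) * p by field; rewrite gt_eqF.
have : 0 <= x ^+ 2 / s ^+ 2 by rewrite divr_ge0 ?sqr_ge0.
move: (x ^+ 2 / s ^+ 2) (s ^+ 2) s2 => t S S0 t0 te.
have -> : 6 * S * (2^-1 * p * e) = S * (3 * e) * p by field.
by rewrite ler_wpM2r// ler_wpM2l ?(ltW S0)//; lra.
Qed.

Lemma normal_quartic_tail s x : 0 < s -> x ^+ 4 * normal_pdf 0 s x <= 64 * s ^+ 4 * normal_pdf 0 (s / 2^-1) x.
Proof.
move=> s0; rewrite (@normal_pdf_scale s 2^-1)//.
have := @normal_pdf_ge0 R 0 s x; move: (normal_pdf 0 s x) => p p0.
have s2 : 0 < s ^+ 2 by rewrite exprn_gt0.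
have -> : (1 - 2^-1 ^+ 2) * x ^+ 2 / (s ^+ 2 *+ 2) = (3 / 8) * (x ^+ 2 / s ^+ 2).
  by rewrite mulr2n; field; rewrite gt_eqF.
have t0 : 0 <= x ^+ 2 / s ^+ 2 by rewrite divr_ge0 ?sqr_ge0.
have : ((3 / 8) * (x ^+ 2 / s ^+ 2)) ^+ 2 <= 4 * expR ((3 / 8) * (x ^+ 2 / s ^+ 2)).
  by apply: sqr_le_expR; rewrite mulr_ge0.
move: (expR _) => e.
have -> : x ^+ 4 * p = s ^+ 4 * (x ^+ 2 / s ^+ 2) ^+ 2 * p by field; rewrite gt_eqF.
have : 0 < s ^+ 4 by rewrite exprn_gt0.
move: (x ^+ 2 / s ^+ 2) t0 (s ^+ 4) => t t0 S S0 te.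
have -> : 64 * S * (2^-1 * p * e) = S * (32 * e) * p by field.
rewrite ler_wpM2r// ler_wpM2l ?(ltW S0)//.
have -> : t ^+ 2 = 64 / 9 * ((3 / 8) * t) ^+ 2 by field.
by move: te; move: ((3 / 8) * t) => u; have := sqr_ge0 u; lra.
Qed.

Lemma normal_fourth_moment_le s : 0 < s ->
  (\int[normal_prob 0 s]_x (x ^+ 4)%:E <= (64 * s ^+ 4)%:E)%E.
Proof.
move=> s0; rewrite ge0_integral_normal_prob; last 2 first.
- by apply/measurable_EFinP; apply: measurable_funX; exact: measurable_id.
- by move=> x; rewrite lee_fin (_ : 4%N = (2 * 2)%N)// exprM sqr_ge0.
apply: (@le_trans _ _ (\int[leb]_x ((64 * s ^+ 4)%:E * (normal_pdf 0 (s / 2^-1) x)%:E))%E).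
  apply: ge0_le_integral => //.
  - by move=> x _; rewrite -EFinM lee_fin mulr_ge0 ?normal_pdf_ge0// (_ : 4%N = (2 * 2)%N)// exprM sqr_ge0.
  - apply/measurable_EFinP; apply: measurable_funM; last exact: measurable_normal_pdf.
    by apply: measurable_funX; exact: measurable_id.
  - apply/measurable_EFinP; apply: measurable_funM => //; exact: measurable_normal_pdf.
  - by move=> x _; rewrite -!EFinM lee_fin normal_quartic_tail.
rewrite ge0_integralZl//=.
- by rewrite integral_normal_pdf mule1.
- by apply/measurable_EFinP; exact: measurable_normal_pdf.
- by move=> x _; rewrite lee_fin normal_pdf_ge0.
- by rewrite lee_fin mulr_ge0// exprn_ge0// ltW.
Qed.

(* Comparing the densities at standard deviations s and s/a through
   e^u >= 1 + u and letting a -> 1 from either side. *)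
Lemma normal_second_moment s : 0 < s -> (\int[normal_prob 0 s]_x (x ^+ 2)%:E = (s ^+ 2)%:E)%E.
Proof.
move=> s0; rewrite ge0_integral_normal_prob; last 2 first.
- by apply/measurable_EFinP; apply: measurable_funX; exact: measurable_id.
- by move=> x; rewrite lee_fin sqr_ge0.
have sq0 x : 0 <= x ^+ 2 * normal_pdf 0 s x by rewrite mulr_ge0 ?sqr_ge0 ?normal_pdf_ge0.
have S2 : 0 < s ^+ 2 by rewrite exprn_gt0.
have p0 s' x : (0 <= (normal_pdf 0 s' x)%:E)%E by rewrite lee_fin normal_pdf_ge0.
have mp s' : measurable_fun [set: measurableTypeR R] (EFin \o normal_pdf 0 s').
  by apply/measurable_EFinP; exact: measurable_normal_pdf.
have int0 : (0 <= \int[leb]_x (x ^+ 2 * normal_pdf 0 s x)%:E)%E.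
  by apply: integral_ge0 => x _; rewrite lee_fin.
have [k kE] : exists k : R, (\int[leb]_x (x ^+ 2 * normal_pdf 0 s x)%:E = k%:E)%E.
  exists (fine (\int[leb]_x (x ^+ 2 * normal_pdf 0 s x)%:E)%E).
  rewrite fineK// ge0_fin_numE//.
  apply: (@le_lt_trans _ _ (\int[leb]_x ((6 * s ^+ 2)%:E * (normal_pdf 0 (s / 2^-1) x)%:E))%E).
    apply: ge0_le_integral => //.
    - by move=> x _; rewrite lee_fin.
    - by apply/measurable_EFinP; exact: msq.
    - by apply/measurable_EFinP; apply: measurable_funM => //; exact: measurable_normal_pdf.
    - by move=> x _; rewrite -EFinM lee_fin normal_sqr_tail.
  rewrite ge0_integralZl//=; first by rewrite integral_normal_pdf mule1 ltry.
    exact: mp.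
  by rewrite lee_fin mulr_ge0// ltW.
under eq_integral do rewrite -EFinM; rewrite kE.
have k0 : 0 <= k by rewrite -lee_fin -kE.
have lin s' A B : 0 <= A -> 0 <= B ->
    (\int[leb]_x (A * normal_pdf 0 s' x + B * (x ^+ 2 * normal_pdf 0 s x))%:E = (A + B * k)%:E)%E.
  move=> A0 B0; under eq_integral do rewrite EFinD (EFinM A) (EFinM B).
  rewrite ge0_integralD//; last 4 first.
  - by move=> x _; rewrite mule_ge0.
  - by apply: measurable_funeM; exact: mp.
  - by move=> x _; rewrite mule_ge0 ?lee_fin.
  - by apply: measurable_funeM; apply/measurable_EFinP; exact: msq.
  rewrite [X in (X + _)%E]ge0_integralZl//; last exact: mp.
  rewrite ge0_integralZl//; last 2 first.
  - by apply/measurable_EFinP; exact: msq.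
  - by move=> x _; rewrite lee_fin.
  by rewrite integral_normal_pdf mule1 EFinD EFinM -kE.
(* Since e^u >= 1 + u, the density at s / a, divided by a, is at least 1 + (A - B) x^2 times the
   density at s. The coefficient is split as A - B with A and B nonnegative, so that only
   nonnegative functions are integrated. *)
have ineq a A B : 0 < a -> 0 <= A -> 0 <= B -> A - B = (1 - a ^+ 2) / (s ^+ 2 *+ 2) ->
    1 + A * k <= a^-1 + B * k.
  move=> a0 A0 B0 AB; rewrite -lee_fin -(lin s 1 A)// -(lin (s / a) a^-1 B)//; last first.
    by rewrite invr_ge0 ltW.
  apply: ge0_le_integral => //.
  - by move=> x _; rewrite lee_fin addr_ge0 // mulr_ge0 // normal_pdf_ge0.
  - apply/measurable_EFinP; apply: measurable_funD; apply: measurable_funM => //.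
    exact: measurable_normal_pdf.
  - apply/measurable_EFinP; apply: measurable_funD; apply: measurable_funM => //.
    exact: measurable_normal_pdf.
  - move=> x _; rewrite lee_fin normal_pdf_scale// mul1r -[a * normal_pdf 0 s x * _]mulrA mulKf ?gt_eqF//.
    have := expR_ge1Dx ((1 - a ^+ 2) * x ^+ 2 / (s ^+ 2 *+ 2)).
    rewrite mulrAC -AB; move: (expR _) => e eE.
    have := normal_pdf_ge0 0 s x; move: (normal_pdf 0 s x) => p pp.
    have -> : p + A * (x ^+ 2 * p) = (1 + (A - B) * x ^+ 2) * p + B * (x ^+ 2 * p) by ring.
    by rewrite lerD2r [p * e]mulrC ler_wpM2r.
congr EFin; apply/eqP; rewrite eq_le; apply/andP; split; rewrite leNgt; apply/negP => ks.
(* Here a = 1 - e, and a = 1 + e in the other case. As e is proportional to the gap between k and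
   s^2, the corrections left after division by e do not close the gap. *)
- pose e := (k - s ^+ 2) / (2 * k).
  have kk : 0 < k by exact: lt_trans ks.
  have eE : e * k = (k - s ^+ 2) / 2 by rewrite /e; field; rewrite gt_eqF.
  have e0 : 0 < e by rewrite divr_gt0 ?subr_gt0 ?mulr_gt0.
  have e1 : e < 1 by rewrite ltr_pdivrMr ?mulr_gt0//; lra.
  have a0 : 0 < 1 - e by lra.
  have := @ineq (1 - e) ((1 - (1 - e) ^+ 2) / (s ^+ 2 *+ 2)) 0 a0.
  rewrite subr0 mul0r addr0 -[s ^+ 2 *+ 2]mulr_natl => /(_ _ (lexx _) erefl).
  have -> : 0 <= (1 - (1 - e) ^+ 2) / (2 * s ^+ 2).
    by rewrite divr_ge0 ?mulr_ge0 ?(ltW S2)//; nra.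
  move=> /(_ isT); rewrite -(ler_pM2r a0) mulVf ?gt_eqF// => H.
  have : ((1 - (1 - e) ^+ 2) / (2 * s ^+ 2) * k) * (1 - e) <= e.
    by move: H; rewrite mulrDl mul1r; lra.
  rewrite -(ler_pM2r (mulr_gt0 (ltr0n R 2) S2)).
  have -> : (1 - (1 - e) ^+ 2) / (2 * s ^+ 2) * k * (1 - e) * (2 * s ^+ 2) =
    (2 - e) * (1 - e) * k * e by field; rewrite gt_eqF.
  rewrite [leRHS]mulrC ler_pM2r//.
  have -> : (2 - e) * (1 - e) * k = 2 * k - 3 * (e * k) + e * (e * k) by ring.
  rewrite eE => {}H.
  have : 0 <= e * ((k - s ^+ 2) / 2) by apply: mulr_ge0; [exact: ltW|lra].
  move: H ks; move: (s ^+ 2) => S; lra.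
- pose e := (s ^+ 2 - k) / (s ^+ 2 + k).
  have q0 : 0 < s ^+ 2 + k by rewrite ltr_pwDl.
  have e0 : 0 < e by rewrite divr_gt0 ?subr_gt0.
  have e1 : e <= 1 by rewrite ler_pdivrMr//; lra.
  have eE : e * (s ^+ 2 + k) = s ^+ 2 - k by rewrite mulfVK// gt_eqF.
  have a0 : 0 < 1 + e by lra.
  have := @ineq (1 + e) 0 (((1 + e) ^+ 2 - 1) / (s ^+ 2 *+ 2)) a0 (lexx _).
  rewrite mul0r addr0 sub0r -[s ^+ 2 *+ 2]mulr_natl -mulNr opprB => /(_ _ erefl).
  have -> : 0 <= ((1 + e) ^+ 2 - 1) / (2 * s ^+ 2).
    by rewrite divr_ge0 ?mulr_ge0 ?(ltW S2)//; nra.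
  move=> /(_ isT); rewrite -(ler_pM2r a0) mulrDl mulVf ?gt_eqF// mul1r => H.
  have : e <= ((1 + e) ^+ 2 - 1) / (2 * s ^+ 2) * k * (1 + e) by move: H; lra.
  rewrite -(ler_pM2r (mulr_gt0 (ltr0n R 2) S2)).
  have -> : ((1 + e) ^+ 2 - 1) / (2 * s ^+ 2) * k * (1 + e) * (2 * s ^+ 2) =
    (2 + e) * (1 + e) * k * e by field; rewrite gt_eqF.
  rewrite [leLHS]mulrC ler_pM2r//.
  have -> : (2 + e) * (1 + e) * k = 2 * k + 3 * (e * k) + e * (e * k) by ring.
  have ek : e * (e * k) <= e * k by rewrite ler_piMl// mulr_ge0// ltW.
  have eks : e * k < e * s ^+ 2 by rewrite ltr_pM2l.
  move: eE ks ek eks; rewrite mulrDr; move: (s ^+ 2) (e * k) => S z; lra.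
Qed.

End normal_moments.

Section mean.
Context {R : realType} dT (T : measurableType dT) (g : probability T R).
Implicit Types f : T -> R.

Definition intg f : Prop := g.-integrable setT (EFin \o f).
Definition mean f : R := (\int[g]_(w in setT) f w)%R.

Lemma EFin_mean f : intg f -> (\int[g]_w (f w)%:E = (mean f)%:E)%E.
Proof. by move=> If; rewrite /mean /Rintegral fineK//; exact: integrable_fin_num. Qed.

Lemma intgD f1 f2 : intg f1 -> intg f2 -> intg (fun w => f1 w + f2 w).
Proof. by move=> I1 I2; exact: (integrableD measurableT I1 I2). Qed.

Lemma intgZ (k : R) f : intg f -> intg (fun w => k * f w).
Proof. by move=> If; exact: (integrableZl measurableT k If). Qed.

Lemma intg_sum (I : Type) (s : seq I) (f : I -> T -> R) :
  (forall i, intg (f i)) -> intg (fun w => \sum_(i <- s) f i w).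
Proof.
move=> If; rewrite /intg (_ : EFin \o _ = fun w => (\sum_(i <- s) (f i w)%:E)%E).
  by apply: integrable_sum => // i _; exact: If.
by apply/funext => w; rewrite /= -sumEFin.
Qed.

Lemma intg_bounded f (B : R) : measurable_fun setT f -> (forall w, `|f w| <= B) -> intg f.
Proof.
move=> mf fB; apply: measurable_bounded_integrable => //.
  by rewrite (le_lt_trans (probability_le1 g measurableT))// ltry.
exists B; split; first exact: num_real.
by move=> x Bx w _ /=; rewrite (le_trans (fB w))// ltW.
Qed.

Lemma intg_le f h : measurable_fun setT f -> intg h -> (forall w, `|f w| <= `|h w|) -> intg f.
Proof.
move=> mf Ih fh; apply: (le_integrable measurableT _ _ Ih).
  exact/measurable_EFinP.
by move=> w _; rewrite lee_fin.
Qed.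

Lemma intg_cst (k : R) : intg (fun=> k).
Proof. exact: (@intg_bounded _ `|k|). Qed.

Lemma meanD f1 f2 : intg f1 -> intg f2 -> mean (fun w => f1 w + f2 w) = mean f1 + mean f2.
Proof. by move=> I1 I2; rewrite /mean RintegralD. Qed.

Lemma meanZ (k : R) f : intg f -> mean (fun w => k * f w) = k * mean f.
Proof. by move=> If; rewrite /mean RintegralZl. Qed.

Lemma mean_constant (k : R) : mean (fun=> k) = k.
Proof.
rewrite /mean Rintegral_cst//; have := probability_setT g => /= ->.
by rewrite mulr1.
Qed.

Lemma mean_sum (I : Type) (s : seq I) (f : I -> T -> R) :
  (forall i, intg (f i)) -> mean (fun w => \sum_(i <- s) f i w) = \sum_(i <- s) mean (f i).
Proof.
move=> If; elim: s => [|i s IH].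
  by rewrite big_nil; under eq_fun do rewrite big_nil; rewrite mean_constant.
rewrite big_cons -IH -meanD//; last exact: intg_sum.
by congr mean; apply/funext => w; rewrite big_cons.
Qed.

Lemma mean_le f1 f2 : intg f1 -> intg f2 -> (forall w, f1 w <= f2 w) -> mean f1 <= mean f2.
Proof. by move=> I1 I2 f12; apply: le_Rintegral. Qed.

Lemma mean_norm_le f h : intg f -> intg h -> (forall w, `|f w| <= h w) -> `|mean f| <= mean h.
Proof.
move=> If Ih fh; apply: (le_trans (le_normr_Rintegral measurableT If)).
apply: mean_le => //; rewrite /intg.
rewrite (_ : EFin \o _ = abse \o (EFin \o f))//.
exact: integrable_abse.
Qed.

End mean.

Section normal_symmetry.
Context {R : realType}.

Lemma normal_probN (s : R) (B : set R) : s != 0 -> measurable B ->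
  (normal_prob 0 s (-%R @^-1` B) = normal_prob 0 s B)%E.
Proof.
move=> s0 mB; have mN : measurable_fun [set: measurableTypeR R] (-%R : R -> measurableTypeR R).
  exact: oppr_measurable.
have pN x : normal_pdf 0 s (- x) = normal_pdf 0 s x.
  by rewrite !normal_pdfE// /normal_fun !subr0 sqrrN.
rewrite /normal_prob.
transitivity (\int[pushforward (@lebesgue_measure R) (-%R : R -> measurableTypeR R)]_(x in B)
    (normal_pdf 0 s x)%:E)%E.
  rewrite (ge0_integral_pushforward mN)//.
  - by apply: eq_integral => x _ /=; rewrite pN.
  - by apply: measurable_funTS; apply/measurable_EFinP; exact: measurable_normal_pdf.
  - by move=> x _; rewrite lee_fin normal_pdf_ge0.
by apply: eq_measure_integral => A mA _; exact: lebesgue_measureN.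
Qed.

End normal_symmetry.

(** * Vectors with independent centred normal entries *)

Section gaussian_vector.
Context {R : realType} (d : nat) (t : R) (g : probability 'cV[R]_d R).
Hypothesis t_gt0 : 0 < t.

Definition cV_rectangle (B : 'I_d -> set R) : set 'cV[R]_d := [set v | forall i, B i (v i ord0)].

Definition cV_rectangles : set (set 'cV[R]_d) :=
  [set cV_rectangle B | B in [set B : 'I_d -> set R | forall i, measurable (B i)]].

Lemma measurable_cV_rectangle B : (forall i, measurable (B i)) -> measurable (cV_rectangle B).
Proof.
move=> mB; rewrite (_ : cV_rectangle B =
    \bigcap_(i in [set: 'I_d]) (fun v : 'cV[R]_d => v i ord0) @^-1` B i).
  apply: fin_bigcap_measurable; first exact: finite_finset.
  by move=> i _; rewrite -[X in measurable X]setTI; exact: measurable_entry.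
by apply/seteqP; split => [v H i _|v H i]; [exact: H|exact: (H i)].
Qed.

Lemma cV_rectangle_entry (j : 'I_d) B :
  cV_rectangle (fun i => if i == j then B else setT) = [set v | B (v j ord0)].
Proof.
apply/seteqP; split => [v /(_ j)|v Bv i /=]; first by rewrite eqxx.
by case: eqP => [->|].
Qed.

Lemma measurable_cV_rectangles : @measurable _ 'cV[R]_d = <<s cV_rectangles >>.
Proof.
apply/seteqP; split.
  apply: smallest_sub; first exact: smallest_sigma_algebra.
  move=> _ [[i j] _ [B mB <-]]; apply: sub_sigma_algebra; rewrite setTI /= ord1.
  exists (fun k => if k == i then B else setT); last by rewrite cV_rectangle_entry.
  by move=> k; case: ifP.
apply: smallest_sub; first exact: smallest_sigma_algebra.
by move=> _ [B mB <-]; exact: measurable_cV_rectangle.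
Qed.

Lemma cV_rectangles_setI : setI_closed cV_rectangles.
Proof.
move=> _ _ [B mB <-] [C mC <-]; exists (fun i => B i `&` C i).
  by move=> i; exact: measurableI.
by apply/seteqP; split => [v H|v [H1 H2] i //]; split => i; have [] := H i.
Qed.

Lemma cV_rectanglesT : cV_rectangles setT.
Proof. by exists (fun=> setT) => //; apply/seteqP; split. Qed.

Definition gaussian_law : Prop := forall B : 'I_d -> set R, (forall i, measurable (B i)) ->
  (g (cV_rectangle B) = \prod_(i < d) normal_prob 0 (Num.sqrt t) (B i))%E.

Hypothesis g_gaussian : gaussian_law.

Let ent (j : 'I_d) (v : 'cV[R]_d) : R := v j ord0.

Lemma gaussian_entry (j : 'I_d) (f : R -> \bar R) :
  measurable_fun [set: measurableTypeR R] f -> (forall x, 0 <= f x)%E ->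
  (\int[g]_v f (v j ord0) = \int[normal_prob 0 (Num.sqrt t)]_x f x)%E.
Proof.
move=> mf f0.
have me : measurable_fun [set: 'cV[R]_d] (ent j : _ -> measurableTypeR R) by exact: measurable_entry.
transitivity (\int[pushforward g (ent j : _ -> measurableTypeR R)]_x f x)%E.
  by rewrite (ge0_integral_pushforward me).
apply: (eq_measure_integral (normal_prob 0 (Num.sqrt t))) => A mA _.
transitivity (g (cV_rectangle (fun i => if i == j then A else setT))).
  by rewrite cV_rectangle_entry.
rewrite g_gaussian; last by move=> i; case: ifP.
rewrite (bigD1 j)//= eqxx big1 ?mule1// => i /negPf ->.
exact: probability_setT.
Qed.

(** Reflections of coordinates preserve the law. Flipping one coordinate makes the covariances
    vanish, and flipping all of them symmetrizes the Taylor expansion. *)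
Definition sign_flip (e : 'I_d -> bool) (v : 'cV[R]_d) : 'cV[R]_d :=
  \col_i (if e i then - v i ord0 else v i ord0).

Lemma measurable_sign_flip e : measurable_fun setT (sign_flip e).
Proof.
apply: measurable_fun_mx => i j.
rewrite (_ : (fun v => _) = (fun v : 'cV[R]_d => if e i then - v i ord0 else v i ord0)).
  case: (e i); last exact: measurable_entry.
  exact: (measurableT_comp (@oppr_measurable R setT) (measurable_entry i ord0)).
by apply/funext => v; rewrite mxE.
Qed.

Lemma sign_flip_law e A : measurable A -> g (sign_flip e @^-1` A) = g A.
Proof.
have st0 : Num.sqrt t != 0 by rewrite gt_eqF// sqrtr_gt0.
apply: (@eq_measure_pi R _ 'cV[R]_d cV_rectangles
  (measure_function_pushforward__canonical__measure_function_Measure g (measurable_sign_flip e)) g).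
- exact: measurable_cV_rectangles.
- exact: cV_rectangles_setI.
- exact: cV_rectanglesT.
- rewrite /= /pushforward preimage_setT; have := probability_setT g => /= ->.
  by rewrite ltry.
move=> _ [B mB <-]; rewrite /= /pushforward.
rewrite (_ : _ @^-1` _ = cV_rectangle (fun i => if e i then -%R @^-1` B i else B i)).
  rewrite !g_gaussian//; last first.
    move=> i; case: ifP => // _; rewrite -[X in measurable X]setTI.
    exact: (@oppr_measurable R setT).
  by apply: eq_bigr => i _; case: ifP => // _; rewrite normal_probN.
by apply/seteqP; split => v H i; have := H i; rewrite mxE; case: (e i).
Qed.

Lemma mean_sign_flip e (f : 'cV[R]_d -> R) : measurable_fun setT f -> intg g f ->
  intg g (f \o sign_flip e) /\ mean g (f \o sign_flip e) = mean g f.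
Proof.
move=> mf If; have ms := measurable_sign_flip e.
have mF : measurable_fun setT (EFin \o f) by exact/measurable_EFinP.
have H (h : 'cV[R]_d -> \bar R) : measurable_fun setT h -> (forall w, 0 <= h w)%E ->
    (\int[g]_w h (sign_flip e w) = \int[g]_w h w)%E.
  move=> mh h0; transitivity (\int[pushforward g (sign_flip e)]_x h x)%E.
    by rewrite (ge0_integral_pushforward (measurable_sign_flip e)).
  apply: (@eq_measure_integral _ _ _ _ g (measure_function_pushforward__canonical__measure_function_Measure g ms)) => A mA _.
  exact: sign_flip_law.
have I2 : intg g (f \o sign_flip e).
  apply/integrableP; split.
    by apply/measurable_EFinP; exact: (measurableT_comp mf (measurable_sign_flip e)).
  have /integrableP[_] := If; congr (_ < _)%E; symmetry.
  apply: (H (fun w => `|(f w)%:E|)%E) => //.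
  exact: measurableT_comp.
split => //; rewrite /mean /Rintegral; congr fine.
rewrite -(@integral_pushforward _ _ _ _ _ _ (measurable_sign_flip e) g setT (EFin \o f))//.
by apply: (eq_measure_integral g) => A mA _; exact: sign_flip_law.
Qed.

Lemma gaussian_fourth (j : 'I_d) : intg g (fun v : 'cV[R]_d => v j ord0 ^+ 4) /\
  mean g (fun v : 'cV[R]_d => v j ord0 ^+ 4) <= 64 * t ^+ 2.
Proof.
have x4 (x : R) : 0 <= x ^+ 4 by rewrite (_ : 4%N = (2 * 2)%N)// exprM sqr_ge0.
have st0 : 0 < Num.sqrt t by rewrite sqrtr_gt0.
have E : (\int[g]_v (v j ord0 ^+ 4)%:E <= (64 * t ^+ 2)%:E)%E.
  rewrite (@gaussian_entry j (fun x => (x ^+ 4)%:E)).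
  - rewrite (le_trans (normal_fourth_moment_le st0))// lee_fin.
    by rewrite (_ : 4%N = (2 * 2)%N)// exprM sqr_sqrtr// ltW.
  - by apply/measurable_EFinP; apply: measurable_funX; exact: measurable_id.
  - by move=> x; rewrite lee_fin.
have I4 : intg g (fun v : 'cV[R]_d => v j ord0 ^+ 4).
  apply/integrableP; split.
    by apply/measurable_EFinP; apply: measurable_funX; exact: measurable_entry.
  under eq_integral do rewrite /= ger0_norm//.
  by apply: le_lt_trans E _; rewrite ltry.
by split => //; rewrite -lee_fin -EFin_mean.
Qed.

Lemma gaussian_second (j : 'I_d) : intg g (fun v : 'cV[R]_d => v j ord0 ^+ 2) /\
  mean g (fun v : 'cV[R]_d => v j ord0 ^+ 2) = t.
Proof.
have st0 : 0 < Num.sqrt t by rewrite sqrtr_gt0.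
have E : (\int[g]_v (v j ord0 ^+ 2)%:E = t%:E)%E.
  rewrite (@gaussian_entry j (fun x => (x ^+ 2)%:E)).
  - by rewrite (normal_second_moment st0) sqr_sqrtr// ltW.
  - by apply/measurable_EFinP; apply: measurable_funX; exact: measurable_id.
  - by move=> x; rewrite lee_fin sqr_ge0.
have I4 : intg g (fun v : 'cV[R]_d => v j ord0 ^+ 2).
  apply/integrableP; split.
    by apply/measurable_EFinP; apply: measurable_funX; exact: measurable_entry.
  under eq_integral do rewrite /= ger0_norm ?sqr_ge0//.
  by rewrite E ltry.
by split => //; apply: EFin_inj; rewrite -EFin_mean.
Qed.

Lemma gaussian_product (i j : 'I_d) : intg g (fun v : 'cV[R]_d => v i ord0 * v j ord0) /\
  mean g (fun v : 'cV[R]_d => v i ord0 * v j ord0) = t * (i == j)%:R.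
Proof.
have mm : measurable_fun setT (fun v : 'cV[R]_d => v i ord0 * v j ord0).
  by apply: measurable_funM; exact: measurable_entry.
have [Ii _] := gaussian_second i; have [Ij _] := gaussian_second j.
have I : intg g (fun v : 'cV[R]_d => v i ord0 * v j ord0).
  apply: (intg_le mm (intgD Ii Ij)) => v; rewrite [leRHS]ger0_norm; last first.
    by rewrite addr_ge0 ?sqr_ge0.
  rewrite ler_norml; move: (v i ord0) (v j ord0) => x y.
  by have := sqr_ge0 (x + y); have := sqr_ge0 (x - y); rewrite !expr2; nra.
split => //; have [->|ij] := eqVneq i j.
  by rewrite mulr1 -[RHS](gaussian_second j).2; congr mean; apply/funext => v; rewrite expr2.
rewrite mulr0; have [_] := @mean_sign_flip (pred1 i) _ mm I.
rewrite (_ : _ \o _ = (fun v : 'cV[R]_d => -1 * (v i ord0 * v j ord0))).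
  by rewrite meanZ//; lra.
by apply/funext => v; rewrite /= !mxE /= eqxx eq_sym (negPf ij) mulN1r mulNr.
Qed.

End gaussian_vector.

(** * The Euler-Maruyama transition operator *)

Section bounded_lipschitz.
Context {R : realType} (n : nat).
Implicit Types (f g : 'cV[R]_n -> R).

(** The class in which the splitting iterates are kept: it is stable under the transition operator
    and under multiplication by the likelihood, and its members are continuous and measurable. *)
Definition bounded_lipschitz f : Prop := exists2 B : R, 0 <= B &
  (forall x, `|f x| <= B) /\ forall x x', `|f x - f x'| <= B * norm1 (x - x').

Lemma bounded_lipschitzM f g :
  bounded_lipschitz f -> bounded_lipschitz g -> bounded_lipschitz (fun x => f x * g x).
Proof.
move=> [A A0 [fA fL]] [B B0 [gB gL]]; exists (A * B + 2 * (A * B)).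
  by rewrite addr_ge0// ?mulr_ge0.
have AB : 0 <= A * B by exact: mulr_ge0.
split => [x|x x'].
  by rewrite normrM (le_trans (ler_pM _ _ (fA x) (gB x)))// lerDl mulr_ge0.
have -> : f x * g x - f x' * g x' = f x * (g x - g x') + (f x - f x') * g x' by ring.
apply: (le_trans (ler_normD _ _)); rewrite !normrM.
apply: (@le_trans _ _ (A * (B * norm1 (x - x')) + A * norm1 (x - x') * B)).
  by apply: lerD; apply: ler_pM.
have : 0 <= A * B * norm1 (x - x') by rewrite mulr_ge0 ?norm1_ge0.
have -> : A * (B * norm1 (x - x')) = A * B * norm1 (x - x') by rewrite mulrA.
have -> : A * norm1 (x - x') * B = A * B * norm1 (x - x') by rewrite mulrAC.
have -> : (A * B + 2 * (A * B)) * norm1 (x - x') = 3 * (A * B * norm1 (x - x')) by ring.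
by move: (A * B * _) => z; lra.
Qed.

Lemma jet_bounded_lipschitz f (M : R) : smooth f ->
  (forall s x, (size s <= 1)%N -> `|iter_partial s f x| <= M) -> bounded_lipschitz f.
Proof.
move=> sf fM; exists M; first by apply: le_trans (fM [::] 0 isT).
split => [x|x x']; first exact: (fM [::]).
have fd z : differentiable f z by exact: smooth_differentiable.
have dr (s : R) := is_derive_line (v := x - x') (fd (x' + s *: (x - x'))).
have := derive_bounded_le (M := norm1 (x - x') * M) dr.
rewrite /= mulrC => /(_ _ 1); rewrite scale1r scale0r addr0 subrKC; apply; last by rewrite ler01 lexx.
move=> s _; apply: (le_trans (ler_norm_sum _ _ _)); rewrite mulr_sumr.
apply: ler_sum => l _; rewrite normrM [leRHS]mulrC ler_wpM2l//.
exact: (fM [:: l]).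
Qed.

Lemma Cb_bounded_lipschitz f : Cb_infty f -> bounded_lipschitz f.
Proof.
move=> Cf; have [M _ fM] := Cb_jet_bound 1 Cf.
exact: (jet_bounded_lipschitz (Cb_smooth Cf) fM).
Qed.

Lemma bounded_lipschitz_continuous f : bounded_lipschitz f -> continuous f.
Proof.
move=> [B B0 [_ fL]] x; have FF := nbhs_filter x.
apply/(@cvgrPdist_le _ _ _ _ FF) => e e0; apply/nbhs_ballP.
have q0 : 0 < B * n%:R + 1 by rewrite ltr_wpDl// mulr_ge0.
exists (e / (B * n%:R + 1)); first by rewrite /= divr_gt0.
move=> y [_ xy] /=; apply: (le_trans (fL _ _)).
apply: (@le_trans _ _ (B * (n%:R * (e / (B * n%:R + 1))))).
  rewrite ler_wpM2l//; apply: (@le_trans _ _ (\sum_(l < n) (e / (B * n%:R + 1)))).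
    apply: ler_sum => l _; rewrite !mxE; apply: ltW; exact: xy.
  by rewrite sumr_const card_ord mulr_natl.
rewrite !mulrA ler_pdivrMr// [_ * e]mulrC ler_pM2l//.
by rewrite lerDl.
Qed.

Lemma bounded_lipschitz_measurable f : bounded_lipschitz f -> measurable_fun setT f.
Proof. by move=> /bounded_lipschitz_continuous; exact: continuous_measurable_mx. Qed.

End bounded_lipschitz.

Lemma sqr_sum_ord_le (R : realType) (n : nat) (a : 'I_n -> R) :
  (\sum_i a i) ^+ 2 <= n%:R * \sum_i a i ^+ 2.
Proof.
have := sqr_sum_le (index_enum 'I_n) a; rewrite -[Finite.sort _]/'I_n.
rewrite /index_enum -enumT size_enum_ord; apply: le_trans.
rewrite -[leLHS]real_normK ?num_real//; apply: lerXn2r; rewrite ?nnegrE//; last exact: ler_norm_sum.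
by apply: sumr_ge0.
Qed.

Lemma quartic_sum_le (R : realType) (n : nat) (a : 'I_n -> R) :
  (\sum_i a i) ^+ 4 <= n%:R ^+ 3 * \sum_i a i ^+ 4.
Proof.
rewrite (_ : 4%N = (2 * 2)%N)// exprM.
have H : (\sum_i a i ^+ 2) ^+ 2 <= n%:R * \sum_i a i ^+ (2 * 2).
  by apply: (le_trans (sqr_sum_ord_le _)); under eq_bigr do rewrite -exprM.
apply: (@le_trans _ _ ((n%:R * \sum_i a i ^+ 2) ^+ 2)).
  apply: lerXn2r; rewrite ?nnegrE ?sqr_ge0 ?sqr_sum_ord_le// mulr_ge0//.
  by apply: sumr_ge0 => i _; exact: sqr_ge0.
by rewrite exprMn [n%:R ^+ 3]exprSr -mulrA ler_wpM2l// sqr_ge0.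
Qed.

(** The left side is the remainder of [symmetric_taylor] for a drift t b(x) of size p and a noise
    sigma(x) w of size q, with s the size of w. Under the Gaussian mean s^2 has order t and s^4
    order t^2, so each term on the right has order t^2. *)
Lemma taylor_remainder_le (R : realType) (t s p q L : R) : 0 <= t <= 1 -> 0 <= s -> 1 <= L ->
  0 <= p <= t * L -> 0 <= q <= L * s ->
  p ^+ 2 + (p ^+ 3 + 3 * p * q ^+ 2) / 3 + 2 * (p + q) ^+ 4 <=
  18 * L ^+ 4 * (t ^+ 2 + t * s ^+ 2 + s ^+ 4).
Proof.
move=> /andP[t0 t1] s0 L1 /andP[p0 pt] /andP[q0 qs].
have L0 : 0 <= L by exact: le_trans L1.
have tL0 : 0 <= t * L by exact: mulr_ge0.
have Ls0 : 0 <= L * s by exact: mulr_ge0.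
have L2 : L ^+ 2 <= L ^+ 4 by rewrite ler_weXn2l.
have L3 : L ^+ 3 <= L ^+ 4 by rewrite ler_weXn2l.
have t20 : 0 <= t ^+ 2 by exact: sqr_ge0.
have P2 : p ^+ 2 <= L ^+ 4 * t ^+ 2.
  apply: (@le_trans _ _ ((t * L) ^+ 2)); first by apply: lerXn2r; rewrite ?nnegrE.
  by rewrite exprMn mulrC ler_wpM2r.
have P3 : p ^+ 3 <= L ^+ 4 * t ^+ 2.
  apply: (@le_trans _ _ ((t * L) ^+ 3)); first by apply: lerXn2r; rewrite ?nnegrE.
  rewrite exprMn mulrC; apply: ler_pM; rewrite ?exprn_ge0//.
  by rewrite [t ^+ 3]exprS ler_piMl.
have PQ : p * q ^+ 2 <= L ^+ 4 * (t * s ^+ 2).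
  apply: (@le_trans _ _ ((t * L) * (L * s) ^+ 2)).
    by apply: ler_pM; rewrite ?sqr_ge0//; apply: lerXn2r; rewrite ?nnegrE.
  have -> : t * L * (L * s) ^+ 2 = L ^+ 3 * (t * s ^+ 2) by ring.
  by rewrite ler_wpM2r// mulr_ge0// sqr_ge0.
have P4 : (p + q) ^+ 4 <= 8 * L ^+ 4 * (t ^+ 2 + s ^+ 4).
  apply: (@le_trans _ _ ((L * (t + s)) ^+ 4)).
    apply: lerXn2r; rewrite ?nnegrE ?addr_ge0// ?mulr_ge0// ?addr_ge0//.
    by rewrite mulrDr [L * t]mulrC lerD.
  rewrite exprMn -mulrA [8 * _]mulrCA ler_wpM2l ?exprn_ge0//.
  apply: (@le_trans _ _ (8 * (t ^+ 4 + s ^+ 4))).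
    have h1 : (t + s) ^+ 2 <= 2 * (t ^+ 2 + s ^+ 2) by have := sqr_ge0 (t - s); nra.
    have -> : (t + s) ^+ 4 = ((t + s) ^+ 2) ^+ 2 by rewrite -exprM.
    apply: (@le_trans _ _ ((2 * (t ^+ 2 + s ^+ 2)) ^+ 2)).
      by apply: lerXn2r; rewrite ?nnegrE ?sqr_ge0// mulr_ge0// addr_ge0 ?sqr_ge0.
    by have := sqr_ge0 (t ^+ 2 - s ^+ 2); nra.
  rewrite ler_wpM2l// lerD2r.
  by rewrite (_ : 4%N = (2 + 2)%N)// exprD ler_piMl// exprn_ile1.
have T0 : 0 <= L ^+ 4 * t ^+ 2 by rewrite mulr_ge0 ?exprn_ge0.
have T1 : 0 <= L ^+ 4 * (t * s ^+ 2) by rewrite !mulr_ge0 ?exprn_ge0.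
have T2 : 0 <= L ^+ 4 * s ^+ 4 by rewrite mulr_ge0 ?exprn_ge0.
have -> : 18 * L ^+ 4 * (t ^+ 2 + t * s ^+ 2 + s ^+ 4) =
  18 * (L ^+ 4 * t ^+ 2) + 18 * (L ^+ 4 * (t * s ^+ 2)) + 18 * (L ^+ 4 * s ^+ 4) by ring.
have {}P4 : (p + q) ^+ 4 <= 8 * (L ^+ 4 * t ^+ 2) + 8 * (L ^+ 4 * s ^+ 4).
  by apply: (le_trans P4); rewrite mulrDr !mulrA.
have -> : 3 * p * q ^+ 2 = 3 * (p * q ^+ 2) by rewrite mulrA.
move: P2 P3 PQ P4 T0 T1 T2; move: (L ^+ 4 * t ^+ 2) (L ^+ 4 * (t * s ^+ 2)) (L ^+ 4 * s ^+ 4).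
move: ((p + q) ^+ 4) (p * q ^+ 2) (p ^+ 3) (p ^+ 2).
by clear; move=> *; lra.
Qed.

Section euler_operator.
Context {R : realType} (d : nat).
Variables (c : 'cV[R]_d -> R) (b : 'cV[R]_d -> 'cV[R]_d) (sigma : 'cV[R]_d -> 'M[R]_d).
Hypothesis Cc : Cb_infty c.
Hypothesis Cb_b : Cb_infty_mx b.
Hypothesis Cb_sigma : Cb_infty_mx sigma.

Definition em_map (t : R) (x w : 'cV[R]_d) : 'cV[R]_d := x + t *: b x + sigma x *m w.

Lemma measurable_em_map t :
  measurable_fun setT (fun z : 'cV[R]_d * 'cV[R]_d => em_map t z.1 z.2).
Proof.
have mC (f : 'cV[R]_d -> R) : Cb_infty f ->
    measurable_fun setT (fun z : 'cV[R]_d * 'cV[R]_d => f z.1).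
  move=> Cf; have /bounded_lipschitz_measurable mf := Cb_bounded_lipschitz Cf.
  exact: (measurableT_comp mf measurable_fst).
apply: measurable_fun_mx => i j; rewrite (_ : (fun z => _) =
    (fun z : 'cV[R]_d * 'cV[R]_d => (z.1 i j + t * b z.1 i j) +
       \sum_k sigma z.1 i k * z.2 k j)); last first.
  by apply/funext => z; rewrite !mxE.
apply: measurable_funD; first apply: measurable_funD.
- exact: (measurableT_comp (measurable_entry i j) measurable_fst).
- by apply: measurable_funM => //; exact: (mC _ (Cb_b i j)).
- apply: measurable_sum => k; apply: measurable_funM; first exact: (mC _ (Cb_sigma i k)).
  exact: (measurableT_comp (measurable_entry k j) measurable_snd).
Qed.

Lemma measurable_em_map_r t x : measurable_fun setT (em_map t x).
Proof.
exact: (measurableT_comp (measurable_em_map t) (measurable_pair1 x)).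
Qed.

Lemma norm1_mulmx (A : 'M[R]_d) (C : R) (w : 'cV[R]_d) :
  (forall i, norm1 (col i A) <= C) -> norm1 (A *m w) <= C * norm1 w.
Proof.
move=> AC; rewrite {2}/norm1 mulr_sumr.
apply: (@le_trans _ _ (\sum_k norm1 (col k A) * `|w k ord0|)); last first.
  by apply: ler_sum => k _; rewrite ler_wpM2r.
under [leRHS]eq_bigr do rewrite mulr_suml.
rewrite exchange_big/=; apply: ler_sum => i _; rewrite mxE.
apply: (le_trans (ler_norm_sum _ _ _)); apply: ler_sum => k _.
by rewrite normrM !mxE.
Qed.

Lemma em_map_lipschitz : exists2 C : R, 0 <= C & forall t x x' w, 0 <= t <= 1 ->
  norm1 (em_map t x w - em_map t x' w) <= norm1 (x - x') * (C * (1 + norm1 w)).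
Proof.
have /choice[B BP] : forall i, exists B : R, 0 <= B /\
    forall x x', `|b x i ord0 - b x' i ord0| <= B * norm1 (x - x').
  by move=> i; have [B B0 [_ H]] := Cb_bounded_lipschitz (Cb_b i ord0); exists B.
have /choice[S SP] : forall p : 'I_d * 'I_d, exists B : R, 0 <= B /\
    forall x x', `|sigma x p.1 p.2 - sigma x' p.1 p.2| <= B * norm1 (x - x').
  by move=> p; have [C C0 [_ H]] := Cb_bounded_lipschitz (Cb_sigma p.1 p.2); exists C.
pose CB := \sum_i B i; pose CS := \sum_i \sum_k S (i, k).
have CB0 : 0 <= CB by apply: sumr_ge0 => i _; have [] := BP i.
have CS0 : 0 <= CS by apply: sumr_ge0 => i _; apply: sumr_ge0 => k _; have [] := SP (i, k).
exists (1 + CB + CS); first by rewrite !addr_ge0.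
move=> t x x' w /andP[t0 t1]; have n0 := norm1_ge0 (x - x'); have w0 := norm1_ge0 w.
have -> : em_map t x w - em_map t x' w =
    (x - x') + t *: (b x - b x') + (sigma x - sigma x') *m w.
  by rewrite /em_map mulmxBl scalerBr !opprD addrACA; congr (_ + _); rewrite addrACA.
have hb : norm1 (t *: (b x - b x')) <= CB * norm1 (x - x').
  rewrite norm1Z ger0_norm//; apply: (@le_trans _ _ (norm1 (b x - b x'))).
    by rewrite ler_piMl// norm1_ge0.
  by rewrite /CB mulr_suml; apply: ler_sum => i _; rewrite !mxE; have [_] := BP i; exact.
have hs : norm1 ((sigma x - sigma x') *m w) <= CS * norm1 (x - x') * norm1 w.
  apply: norm1_mulmx => k; rewrite /CS exchange_big/= (bigD1 k)//= mulrDl -[leLHS]addr0.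
  apply: lerD.
    rewrite mulr_suml; apply: ler_sum => i _; rewrite !mxE; have [_] := SP (i, k); exact.
  rewrite mulr_ge0//; apply: sumr_ge0 => j _; apply: sumr_ge0 => i _; by have [] := SP (i, j).
apply: (le_trans (norm1D _ _)); apply: (le_trans (lerD (norm1D _ _) (lexx _))).
apply: (le_trans (lerD (lerD (lexx _) hb) hs)).
have : 0 <= CB * norm1 (x - x') * norm1 w by rewrite !mulr_ge0.
have : 0 <= CS * norm1 (x - x') by rewrite mulr_ge0.
have : 0 <= norm1 (x - x') * norm1 w by rewrite mulr_ge0.
move: (norm1 (x - x')) (norm1 w) => p q; clear -p q => h1 h2 h3.
have -> : p * ((1 + CB + CS) * (1 + q)) = p + CB * p + CS * p * q + (p * q + CB * p * q + CS * p) by ring.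
by rewrite lerDl; rewrite !addr_ge0.
Qed.

Section step.
Variables (t : R) (g : probability 'cV[R]_d R).
Hypothesis t01 : 0 < t <= 1.
Hypothesis g_gaussian : gaussian_law t g.

Let t0 : 0 < t. Proof. by case/andP: t01. Qed.
Let t1 : t <= 1. Proof. by case/andP: t01. Qed.

(** This is G_b f for the time step t when F_b is multiplication by c. *)
Definition weighted (f : 'cV[R]_d -> R) (x : 'cV[R]_d) : R := (1 + t * c x) * f x.

Definition euler_op (f : 'cV[R]_d -> R) (x : 'cV[R]_d) : R :=
  mean g (fun w => weighted f (em_map t x w)).

Lemma bounded_lipschitz_weighted f : bounded_lipschitz f -> bounded_lipschitz (weighted f).
Proof.
move=> bf; apply: bounded_lipschitzM => //; apply: Cb_bounded_lipschitz.
by apply: CbD; [exact: Cb_cst|apply: CbM => //; exact: Cb_cst].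
Qed.

Lemma intg_weighted f x : bounded_lipschitz f -> intg g (fun w => weighted f (em_map t x w)).
Proof.
move=> /bounded_lipschitz_weighted bf; have [B B0 [fB _]] := bf.
apply: (@intg_bounded _ _ _ _ _ B) => //.
exact: (measurableT_comp (bounded_lipschitz_measurable bf) (measurable_em_map_r t x)).
Qed.

Lemma euler_op_contract f h La e : bounded_lipschitz f -> bounded_lipschitz h ->
  (forall x, `|c x| <= La) -> (forall x, `|f x - h x| <= e) ->
  forall x, `|euler_op f x - euler_op h x| <= (1 + t * La) * e.
Proof.
move=> bf bh cLa fh x.
have If := intg_weighted x bf; have Ih := intg_weighted x bh.
have -> : euler_op f x - euler_op h x =
    mean g (fun w => weighted f (em_map t x w) + -1 * weighted h (em_map t x w)).
  by rewrite meanD ?meanZ ?mulN1r//; exact: intgZ.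
rewrite -[leRHS](mean_constant g); apply: mean_norm_le.
- by apply: intgD => //; exact: intgZ.
- exact: intg_cst.
move=> w; move: (em_map t x w) => z.
rewrite /weighted mulN1r -mulrBr normrM; apply: ler_pM => //.
apply: (le_trans (ler_normD _ _)); rewrite normr1 lerD2l normrM (gtr0_norm t0).
by rewrite ler_wpM2l// ltW.
Qed.

(** Both starting points are moved with the same noise w. The images then differ by at most a
    multiple of norm1 (x - x') * (1 + norm1 w), which has finite mean. *)
Lemma euler_op_bounded_lipschitz f : bounded_lipschitz f -> bounded_lipschitz (euler_op f).
Proof.
move=> bf; have [B B0 [fB fL]] := bounded_lipschitz_weighted bf.
have [C C0 CP] := em_map_lipschitz.
have Iw : intg g (@norm1 R d).
  have mn : measurable_fun setT (@norm1 R d).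
    apply: measurable_sum => l; apply: measurableT_comp; first exact: normr_measurable.
    exact: measurable_entry.
  (* The bound |z| <= 1 + z^2 on each entry reduces integrability to second moments. *)
  apply: (@intg_le _ _ _ g _ (fun w : 'cV[R]_d => \sum_l (1 + w l ord0 ^+ 2)) mn).
    apply: intg_sum => l; apply: intgD; first exact: intg_cst.
    exact: (gaussian_second t0 g_gaussian l).1.
  move=> w; rewrite ger0_norm ?norm1_ge0// ger0_norm; last first.
    by apply: sumr_ge0 => l _; rewrite addr_ge0 ?sqr_ge0.
  apply: ler_sum => l _; rewrite -[w l ord0 ^+ 2]real_normK ?num_real//.
  by have := sqr_ge0 (`|w l ord0| - 1); move: `|w l ord0| => z; nra.
have I1 : intg g (fun w => 1 + norm1 w) by apply: intgD => //; exact: intg_cst.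
have m0 : 0 <= mean g (fun w => 1 + norm1 w).
  rewrite -(mean_constant g 0); apply: mean_le => //; first exact: intg_cst.
  by move=> w; rewrite addr_ge0// norm1_ge0.
exists (B + B * C * mean g (fun w => 1 + norm1 w)); first by rewrite addr_ge0 ?mulr_ge0.
split => [x|x x'].
  apply: (@le_trans _ _ B); last by rewrite lerDl !mulr_ge0.
  rewrite -[leRHS](mean_constant g); apply: mean_norm_le => //; last exact: intg_cst.
  exact: intg_weighted.
have -> : euler_op f x - euler_op f x' =
    mean g (fun w => weighted f (em_map t x w) + -1 * weighted f (em_map t x' w)).
  rewrite meanD ?meanZ ?mulN1r//; first exact: intg_weighted.
  - exact: intg_weighted.
  - by apply: intgZ; exact: intg_weighted.
apply: (@le_trans _ _ (mean g (fun w => B * C * norm1 (x - x') * (1 + norm1 w)))).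
  apply: mean_norm_le.
  - by apply: intgD; [exact: intg_weighted|apply: intgZ; exact: intg_weighted].
  - exact: intgZ.
  move=> w; rewrite mulN1r; apply: (le_trans (fL _ _)).
  rewrite -2!mulrA ler_wpM2l// mulrCA; apply: CP.
  by rewrite ltW.
rewrite meanZ// mulrDl; have : 0 <= B * norm1 (x - x') by rewrite mulr_ge0 ?norm1_ge0.
have -> : B * C * norm1 (x - x') * mean g (fun w => 1 + norm1 w) =
   B * C * mean g (fun w => 1 + norm1 w) * norm1 (x - x') by rewrite mulrAC.
by rewrite lerDr.
Qed.

Lemma euler_op_symmetric f x : bounded_lipschitz f ->
  let s w := weighted f (x + t *: b x + sigma x *m w) +
             weighted f (x + t *: b x - sigma x *m w) in
  intg g s /\ 2 * euler_op f x = mean g s.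
Proof.
move=> bf; have mf := bounded_lipschitz_measurable (bounded_lipschitz_weighted bf).
have If := intg_weighted x bf.
have [] := @mean_sign_flip _ _ t g t0 g_gaussian xpredT _
  (measurableT_comp mf (measurable_em_map_r t x)) If.
rewrite (_ : _ \o _ = fun w => weighted f (x + t *: b x - sigma x *m w)); last first.
  apply/funext => w; rewrite /= /em_map -mulmxN; congr (weighted f (_ + _ *m _)).
  by apply/colP => i; rewrite !mxE.
by move=> I2 E2 s; split; [exact: intgD|rewrite meanD// E2 mulr2n mulrDl mul1r].
Qed.

Lemma mean_quadratic (A : 'M[R]_d) (D : 'I_d -> 'I_d -> R) :
  intg g (fun w => \sum_k \sum_l (A *m w) k ord0 * (A *m w) l ord0 * D k l) /\
  mean g (fun w => \sum_k \sum_l (A *m w) k ord0 * (A *m w) l ord0 * D k l) =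
  t * \sum_k \sum_l (A *m A^T) k l * D k l.
Proof.
rewrite (_ : (fun w => _) = fun w : 'cV[R]_d => \sum_k \sum_l \sum_i \sum_j
    (A k i * A l j * D k l) * (w i ord0 * w j ord0)); last first.
  apply/funext => w; apply: eq_bigr => k _; apply: eq_bigr => l _.
  rewrite !mxE !mulr_suml; apply: eq_bigr => i _.
  rewrite mulr_sumr mulr_suml; apply: eq_bigr => j _.
  by move: (A k i) (A l j) (D k l) (w i ord0) (w j ord0) => *; ring.
have I i j (u : R) : intg g (fun w : 'cV[R]_d => u * (w i ord0 * w j ord0)).
  by apply: intgZ; exact: (gaussian_product t0 g_gaussian i j).1.
split; first by do 4 (apply: intg_sum => ?); exact: I.
rewrite mean_sum; last by move=> k; do 3 (apply: intg_sum => ?); exact: I.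
rewrite mulr_sumr; apply: eq_bigr => k _.
rewrite mean_sum; last by move=> l; do 2 (apply: intg_sum => ?); exact: I.
rewrite mulr_sumr; apply: eq_bigr => l _.
rewrite mean_sum; last by move=> i; apply: intg_sum => ?; exact: I.
rewrite mxE mulr_suml mulr_sumr; apply: eq_bigr => i _.
rewrite mean_sum; last by move=> j; exact: I.
rewrite (bigD1 i)//= big1 => [|j ji].
  rewrite meanZ; last exact: (gaussian_product t0 g_gaussian i i).1.
  rewrite (gaussian_product t0 g_gaussian i i).2 eqxx mulr1 addr0 mxE mulrC.
  by rewrite !mulrA.
rewrite meanZ; last exact: (gaussian_product t0 g_gaussian i j).1.
by rewrite (gaussian_product t0 g_gaussian i j).2 eq_sym (negPf ji) !mulr0.
Qed.

End step.

Local Opaque dird.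

Let comb (t D Df Dc S Sf Sc : R) : D = Df + t * Dc -> S = Sf + t * Sc ->
  D + 2^-1 * S = (Df + 2^-1 * Sf) + t * (Dc + 2^-1 * Sc).
Proof. by move=> -> ->; ring. Qed.

(* The Gaussian mean of the symmetrized Taylor expansion reproduces the second
   order part of the generator; the fourth moments bound the remainder. *)
Lemma euler_op_consistent : exists2 C : R, 0 <= C &
  forall t (g : probability 'cV[R]_d R) f M x, 0 < t <= 1 -> gaussian_law t g ->
  bounded_lipschitz f -> smooth f -> jet_le f M ->
  `|euler_op t g f x - (f x + t * gen c b sigma f x)| <= C * M * t ^+ 2.
Proof.
have [La La1 LaP] := coef_bound Cc Cb_b Cb_sigma.
have La0 : 0 <= La by apply: le_trans La1.
have [Mc Mc0 cM] := Cb_jet_bound 4 Cc.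
(* With zero potential [gen] is A_b. *)
have [CA CA0 CAP] := @gen_jet R d (fun=> 0) b sigma (@Cb_cst R d 0) Cb_b Cb_sigma.
pose C1 := 18 * La ^+ 4 * (1 + d%:R * d%:R + d%:R ^+ 3 * d%:R * 64) : R.
have C10 : 0 <= C1 by rewrite !mulr_ge0 ?exprn_ge0 ?addr_ge0 ?mulr_ge0 ?exprn_ge0.
exists ((1 + 16 * Mc) * C1 + CA * 16 * Mc).
  by rewrite addr_ge0 ?mulr_ge0 ?addr_ge0 ?mulr_ge0.
move=> t g f M x t01 gg bf sf fM.
have /andP[t0 t1] := t01.
have M0 : 0 <= M by apply: le_trans (fM [::] x isT).
(* The expansion is made for h, which carries the weight 1 + t c. Replacing t A_b h by t A_b f then
   costs t^2 A_b (c f). *)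
pose h z := f z + t * (c z * f z).
have scf : smooth (fun z => c z * f z) by apply: smoothM => //; exact: Cb_smooth.
have jcf : jet_le (fun z => c z * f z) (2 ^+ 4 * (Mc * M)).
  by apply: iter_partialM_le => //; exact: Cb_smooth.
have stcf : smooth (fun z => t * (c z * f z)) by apply: smoothM => //; exact: smooth_cst.
have sh : smooth h by exact: smoothD.
have hE : weighted t f = h by apply/funext => z; rewrite /weighted /h mulrDl mul1r mulrA.
have jh : jet_le h ((1 + 16 * Mc) * M).
  move=> s z s4; rewrite iter_partialD// iter_partialZ//.
  apply: (le_trans (ler_normD _ _)); rewrite mulrDl mul1r lerD ?fM// normrM gtr0_norm//.
  apply: (@le_trans _ _ (1 * (2 ^+ 4 * (Mc * M)))).
    by apply: ler_pM => //; [exact: ltW|exact: jcf].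
  by rewrite mul1r -mulrA -natrX.
have lin v : dird v h = fun z => dird v f z + t * dird v (fun z => c z * f z) z.
  by apply/funext => z; rewrite dirdD// dirdZ.
have hx : h x = f x + t * (c x * f x) by [].
clearbody h.
pose Q w := dird (sigma x *m w) (dird (sigma x *m w) h) x.
have dh l : differentiable (partial l h) x by apply: smooth_differentiable; exact: smooth_partial.
have QE : Q = fun w : 'cV[R]_d =>
    \sum_k \sum_l (sigma x *m w) k ord0 * (sigma x *m w) l ord0 * partial k (partial l h) x.
  by apply/funext => w; rewrite /Q dird2E.
have [] := mean_quadratic t01 gg (sigma x) (fun k l => partial k (partial l h) x).
rewrite -QE => IQ mQ.
have [] := @euler_op_symmetric t g t01 gg f x bf; rewrite hE => Ih sE.
(* Powers of norm1 w in [taylor_remainder_le] are replaced by sums of powers of the entries, whose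
   means are computed or bounded. *)
pose P (w : 'cV[R]_d) : R := 18 * La ^+ 4 * t ^+ 2 +
  (18 * La ^+ 4 * t * d%:R * (\sum_i w i ord0 ^+ 2) + 18 * La ^+ 4 * d%:R ^+ 3 * (\sum_i w i ord0 ^+ 4)).
have I2 : intg g (fun w : 'cV[R]_d => \sum_i w i ord0 ^+ 2).
  by apply: intg_sum => i; exact: (gaussian_second t0 gg i).1.
have I4 : intg g (fun w : 'cV[R]_d => \sum_i w i ord0 ^+ 4).
  by apply: intg_sum => i; exact: (gaussian_fourth t0 gg i).1.
have IP : intg g P by apply: intgD; [exact: intg_cst|apply: intgD; exact: intgZ].
have mP : mean g P <= C1 * t ^+ 2.
  rewrite /P meanD ?mean_constant ?meanD ?meanZ//; last 4 first.
  - exact: intgZ.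
  - exact: intgZ.
  - exact: intg_cst.
  - by apply: intgD; exact: intgZ.
  rewrite mean_sum; last by move=> i; exact: (gaussian_second t0 gg i).1.
  rewrite mean_sum; last by move=> i; exact: (gaussian_fourth t0 gg i).1.
  under eq_bigr do rewrite (gaussian_second t0 gg _).2.
  rewrite sumr_const card_ord -[t *+ d]mulr_natl.
  have : \sum_(i < d) mean g (fun w : 'cV[R]_d => w i ord0 ^+ 4) <= d%:R * (64 * t ^+ 2).
    apply: (@le_trans _ _ (\sum_(i < d) (64 * t ^+ 2))).
      by apply: ler_sum => i _; exact: (gaussian_fourth t0 gg i).2.
    by rewrite sumr_const card_ord -[(_ * _) *+ d]mulr_natl.
  move: (\sum_(i < d) _) => S SP.
  have -> : C1 * t ^+ 2 = 18 * La ^+ 4 * t ^+ 2 + (18 * La ^+ 4 * t * d%:R * (d%:R * t) +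
     18 * La ^+ 4 * d%:R ^+ 3 * (d%:R * (64 * t ^+ 2))) by rewrite /C1; ring.
  by rewrite 2!lerD2l ler_wpM2l// !mulr_ge0 ?exprn_ge0.
have H : `|mean g (fun w => (h (x + t *: b x + sigma x *m w) + h (x + t *: b x - sigma x *m w)) +
    (- (2 * h x + 2 * dird (t *: b x) h x) + -1 * Q w))| <= (1 + 16 * Mc) * M * (C1 * t ^+ 2).
  apply: (@le_trans _ _ (mean g (fun w => (1 + 16 * Mc) * M * P w))); last first.
    by rewrite meanZ// ler_wpM2l// mulr_ge0// addr_ge0// mulr_ge0.
  apply: mean_norm_le.
  - by apply: intgD => //; apply: intgD; [exact: intg_cst|exact: intgZ].
  - exact: intgZ.
  move=> w; have := symmetric_taylor x (t *: b x) (sigma x *m w) sh jh.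
  rewrite mulN1r opprD !addrA => /le_trans; apply; rewrite ler_wpM2l//.
    by rewrite mulr_ge0// addr_ge0// mulr_ge0.
  apply: (@le_trans _ _ (18 * La ^+ 4 * (t ^+ 2 + t * norm1 w ^+ 2 + norm1 w ^+ 4))).
    have [_ bLa sLa] := LaP x.
    apply: taylor_remainder_le => //.
    - by rewrite (ltW t0).
    - exact: norm1_ge0.
    - by rewrite norm1_ge0/= norm1Z gtr0_norm// ler_wpM2l// ltW.
    - by rewrite norm1_ge0/= norm1_mulmx.
  have q2 := sqr_sum_ord_le (fun i => `|w i ord0|).
  have q4 := quartic_sum_le (fun i => `|w i ord0|).
  have E2 : \sum_i `|w i ord0| ^+ 2 = \sum_i w i ord0 ^+ 2.
    by apply: eq_bigr => i _; rewrite real_normK ?num_real.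
  have E4 : \sum_i `|w i ord0| ^+ 4 = \sum_i w i ord0 ^+ 4.
    by apply: eq_bigr => i _; rewrite (_ : 4%N = (2 * 2)%N)// !exprM real_normK ?num_real.
  move: q2 q4; rewrite E2 E4 -/(norm1 w) /P; move: (\sum_i w i ord0 ^+ 2) (\sum_i w i ord0 ^+ 4) => S2 S4.
  move=> q2 q4; have L4 : 0 <= 18 * La ^+ 4 by rewrite mulr_ge0 ?exprn_ge0.
  have -> : 18 * La ^+ 4 * t ^+ 2 + (18 * La ^+ 4 * t * d%:R * S2 + 18 * La ^+ 4 * d%:R ^+ 3 * S4) =
    18 * La ^+ 4 * (t ^+ 2 + t * (d%:R * S2) + d%:R ^+ 3 * S4) by ring.
  by rewrite ler_wpM2l// lerD// lerD2l ler_wpM2l// ltW.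
move: H; rewrite (meanD Ih (intgD (intg_cst g _) (intgZ (-1) IQ))).
rewrite (meanD (intg_cst g _) (intgZ _ IQ)) mean_constant (meanZ _ IQ).
rewrite -sE mQ dirdZl => H.
pose A := op_A sigma b h x.
have AE : 2 * A = 2 * dird (b x) h x + \sum_k \sum_l (sigma x *m (sigma x)^T) k l * partial k (partial l h) x.
  rewrite /A /op_A mulrDr mulrA divff// mul1r addrC; congr (_ + _).
have A2 : A = op_A sigma b f x + t * op_A sigma b (fun z => c z * f z) x.
  have dd (k : 'cV[R]_d -> R) : smooth k -> forall l, differentiable (partial l k) x.
    by move=> sk l; apply: smooth_differentiable; exact: smooth_partial.
  rewrite /A !op_A_dird//; [|exact: dd|exact: dd].
  apply: (@comb t _ _ _ _ _ _ (congr1 (@^~ x) (lin (b x)))).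
  rewrite mulr_sumr -big_split/=; apply: eq_bigr => i _; rewrite lin.
  rewrite (dirdD _ (smooth_dird _ sf) (smoothM (@smooth_cst _ _ t) (smooth_dird _ scf))).
  by rewrite dirdZ//; exact: smooth_dird.
have A3 : `|op_A sigma b (fun z => c z * f z) x| <= CA * (16 * (Mc * M)).
  have := CAP _ _ scf jcf [::] x isT; rewrite /= /gen mul0r add0r.
  by rewrite -natrX.
have -> : euler_op t g f x - (f x + t * gen c b sigma f x) =
   (euler_op t g f x - h x - t * A) + t ^+ 2 * op_A sigma b (fun z => c z * f z) x.
  by rewrite A2 hx /gen; move: (op_A _ _ _ _) (op_A _ _ _ _) (c x) (f x) (euler_op _ _ _ _) => *; ring.
apply: (le_trans (ler_normD _ _)).
have -> : ((1 + 16 * Mc) * C1 + CA * 16 * Mc) * M * t ^+ 2 =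
  (1 + 16 * Mc) * M * (C1 * t ^+ 2) + t ^+ 2 * (CA * (16 * (Mc * M))) by ring.
apply: lerD; last by rewrite normrM ger0_norm ?sqr_ge0// ler_wpM2l// sqr_ge0.
apply: le_trans H.
have -> : 2 * euler_op t g f x + (- (2 * h x + 2 * (t * dird (b x) h x)) +
    -1 * (t * \sum_k \sum_l (sigma x *m (sigma x)^T) k l * partial k (partial l h) x)) =
  2 * (euler_op t g f x - h x - t * A).
  rewrite [t * A](_ : _ = t * (2 * A) / 2); last by field.
  by rewrite AE; move: (\sum_k _) (dird _ _ _) (euler_op _ _ _ _) (h x) => *; field.
by rewrite normrM ger0_norm// ler_peMl// ler1n.
Qed.

End euler_operator.

(** * The optimization problems *)

Section one_step.
Context {R : realType} (d : nat).
Variables (c : 'cV[R]_d -> R) (b : 'cV[R]_d -> 'cV[R]_d) (sigma : 'cV[R]_d -> 'M[R]_d).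
Hypothesis Cc : Cb_infty c.
Hypothesis Cb_b : Cb_infty_mx b.
Hypothesis Cb_sigma : Cb_infty_mx sigma.

Lemma mean_minimizes dT (T : measurableType dT) (g : probability T R) (f : T -> R) (B a : R) :
  measurable_fun setT f -> (forall w, `|f w| <= B) ->
  (\int[g]_w (`|mean g f - f w| ^+ 2)%:E <= \int[g]_w (`|a - f w| ^+ 2)%:E)%E.
Proof.
move=> mf fB; have If : intg g f by exact: intg_bounded fB.
have B0 : 0 <= B by apply: le_trans (fB point).
have Isq k : intg g (fun w => `|k - f w| ^+ 2).
  apply: (@intg_bounded _ _ _ _ _ ((`|k| + B) ^+ 2)).
    apply: measurable_funX; apply: measurableT_comp; first exact: normr_measurable.
    exact: measurable_funB.
  move=> w; rewrite ger0_norm ?sqr_ge0//; apply: lerXn2r; rewrite ?nnegrE ?addr_ge0//.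
  by rewrite (le_trans (ler_normB _ _))// lerD2l.
rewrite !EFin_mean// lee_fin; set m := mean g f.
have -> : (fun w => `|a - f w| ^+ 2) =
    (fun w => `|m - f w| ^+ 2 + (((a - m) ^+ 2 + 2 * (a - m) * m) + - (2 * (a - m)) * f w)).
  apply/funext => w; rewrite !real_normK ?num_real//; ring.
rewrite meanD//; last by apply: intgD; [exact: intg_cst|exact: intgZ].
rewrite (meanD (intg_cst g _) (intgZ _ If)) mean_constant meanZ// -/m lerDl.
by have := sqr_ge0 (a - m); rewrite mulNr addrK.
Qed.

Context dO (Omega : measurableType dO) (P : probability Omega R).
Variables (t : R) (X X' D : {mfun Omega >-> 'cV[R]_d}).
Hypothesis XE : forall w, X' w = em_map b sigma t (X w) (D w).
Hypothesis XD : forall A B, measurable A -> measurable B ->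
  P (X @^-1` A `&` D @^-1` B) = (P (X @^-1` A) * P (D @^-1` B))%E.
Local Notation g := (distribution P D).
Hypothesis t01 : 0 < t <= 1.
Hypothesis D_gaussian : gaussian_law t g.
Local Notation S := (euler_op c b sigma t g).
Local Notation wt := (weighted c t).

(** Since X and D are independent, the loss is an integral over the law of X of losses over the
    noise alone. At X = z the function contributes a constant, and the best constant is the mean,
    which is [S f z]. *)
Lemma conditional_mean_minimizes f (r : 'cV[R]_d -> R) :
  bounded_lipschitz f -> measurable_fun setT r ->
  (\int[P]_w (`|S f (X w) - wt f (X' w)| ^+ 2)%:E <=
   \int[P]_w (`|r (X w) - wt f (X' w)| ^+ 2)%:E)%E.
Proof.
move=> bf mr; have bw := bounded_lipschitz_weighted Cc t bf.
have mw := bounded_lipschitz_measurable bw.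
have mS : measurable_fun setT (S f).
  by apply: bounded_lipschitz_measurable; exact: (euler_op_bounded_lipschitz Cc Cb_b Cb_sigma t01 D_gaussian).
have H (k : 'cV[R]_d -> R) : measurable_fun setT k ->
  (\int[P]_w (`|k (X w) - wt f (X' w)| ^+ 2)%:E =
   \int[distribution P X]_z \int[g]_w (`|k z - wt f (em_map b sigma t z w)| ^+ 2)%:E)%E.
  move=> mk; under eq_integral do rewrite XE.
  apply: (@joint_law _ _ _ P _ _ _ _ D X _
    (fun z => (`|k z.2 - wt f (em_map b sigma t z.2 z.1)| ^+ 2)%:E)) => //.
  - by move=> A B mA mB; rewrite setIC XD// muleC.
  - apply/measurable_EFinP; apply: measurable_funX; apply: measurableT_comp.
      exact: normr_measurable.
    apply: measurable_funB; first exact: (measurableT_comp mk measurable_snd).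
    apply: (measurableT_comp mw).
    exact: (measurableT_comp (measurable_em_map Cb_b Cb_sigma t)
      (measurable_fun_pair measurable_snd measurable_fst)).
rewrite (H _ mS) (H _ mr); apply: ae_le_lower_integral.
- by move=> z; apply: integral_ge0 => w _; rewrite lee_fin sqr_ge0.
- by move=> z; apply: integral_ge0 => w _; rewrite lee_fin sqr_ge0.
apply: aeW => z; have [B _ [wB _]] := bw.
apply: (@mean_minimizes _ _ g _ B) => [|w]; last exact: wB.
exact: (measurableT_comp mw (measurable_em_map_r Cb_b Cb_sigma t z)).
Qed.

Context (m n : nat) (Y : {mfun Omega >-> 'M[R]_(m, n)}).
Hypothesis XY : forall A A' B, measurable A -> measurable A' -> measurable B ->
  P ((X @^-1` A `&` X' @^-1` A') `&` Y @^-1` B) =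
  (P (X @^-1` A `&` X' @^-1` A') * P (Y @^-1` B))%E.
Local Notation nu := (distribution P Y).

Lemma disintegrate_loss (f : ('cV[R]_d * 'cV[R]_d) * 'M[R]_(m, n) -> \bar R) :
  measurable_fun setT f -> (forall z, 0 <= f z)%E ->
  (\int[P]_w f ((X w, X' w), Y w) = \int[nu]_y \int[P]_w f ((X w, X' w), y))%E.
Proof.
move=> mf f0.
have mV : measurable_fun setT (fun w => (X w, X' w)) by exact: measurable_fun_pair.
pose V : {mfun Omega >-> ('cV[R]_d * 'cV[R]_d)%type} := HB.pack (fun w => (X w, X' w))
  (isMeasurableFun.Build _ _ _ _ _ mV).
rewrite (@joint_law _ _ _ P _ _ _ _ V Y _ f)//.
  apply: eq_integral => y _; rewrite ge0_integral_distribution//.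
  exact: (measurableT_comp mf (measurable_pair2 y)).
move=> A B mA mB.
apply: (@indep_event_pi _ _ _ P _ _ V
  [set A1 `*` A2 | A1 in measurable & A2 in measurable]) => //.
- by rewrite -[X in measurable X]setTI; exact: measurable_funPT.
- exact: measurable_prod_measurableType.
- move=> _ _ [A1 mA1 [A2 mA2 <-]] [B1 mB1 [B2 mB2 <-]].
  exists (A1 `&` B1); first exact: measurableI.
  by exists (A2 `&` B2); [exact: measurableI|rewrite setXI].
- by exists setT => //; exists setT => //; rewrite setXTT.
move=> _ [A1 mA1 [A2 mA2 <-]]; exact: XY.
Qed.

(* The previous iterate is only known up to a null set of observations. *)
Lemma euler_op_minimizes (f f' u : 'M[R]_(m, n) -> 'cV[R]_d -> R) :
  (forall y, bounded_lipschitz (f y)) ->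
  strongly_measurable nu f -> strongly_measurable nu (fun y => S (f y)) ->
  {ae nu, forall y, forall x, f' y x = f y x} -> strongly_measurable nu u ->
  (\int[P]_w (`|S (f (Y w)) (X w) - wt (f' (Y w)) (X' w)| ^+ 2)%:E <=
   \int[P]_w (`|u (Y w) (X w) - wt (f' (Y w)) (X' w)| ^+ 2)%:E)%E.
Proof.
move=> bf smf smS ff' smu.
have [F mF FE] := strongly_measurable_version smf.
have aeY (A : 'M[R]_(m, n) -> Prop) : {ae nu, forall y, A y} -> {ae P, forall w, A (Y w)}.
  move=> [N [mN N0 AN]]; exists (Y @^-1` N); split => //; last by move=> w; exact: AN.
  by rewrite -[X in measurable X]setTI; exact: measurable_funPT.
(* The functions are replaced by jointly measurable versions, for which the law of Y can be
   separated, and are then put back for almost every y. *)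
have H (k : 'M[R]_(m, n) -> 'cV[R]_d -> R) (V : 'M[R]_(m, n) * 'cV[R]_d -> R) :
    measurable_fun setT V -> {ae nu, forall y, forall x, V (y, x) = k y x} ->
    (\int[P]_w (`|k (Y w) (X w) - wt (f' (Y w)) (X' w)| ^+ 2)%:E =
     \int[nu]_y \int[P]_w (`|k y (X w) - wt (f y) (X' w)| ^+ 2)%:E)%E.
  move=> mV VE.
  transitivity (\int[P]_w (`|V (Y w, X w) - wt (fun x => F (Y w, x)) (X' w)| ^+ 2)%:E)%E.
    apply/eqP; rewrite eq_le; apply/andP; split; apply: ae_le_lower_integral.
    - by move=> w; rewrite lee_fin sqr_ge0.
    - by move=> w; rewrite lee_fin sqr_ge0.
    - apply: filterS3 (aeY _ ff') (aeY _ VE) (aeY _ FE) => w e1 e2 e3.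
      by rewrite e2 /weighted e1 e3.
    - by move=> w; rewrite lee_fin sqr_ge0.
    - by move=> w; rewrite lee_fin sqr_ge0.
    - apply: filterS3 (aeY _ ff') (aeY _ VE) (aeY _ FE) => w e1 e2 e3.
      by rewrite e2 /weighted e1 e3.
  rewrite (@disintegrate_loss
    (fun z => (`|V (z.2, z.1.1) - wt (fun x => F (z.2, x)) z.1.2| ^+ 2)%:E)); last 2 first.
  - apply/measurable_EFinP; apply: measurable_funX; apply: measurableT_comp.
      exact: normr_measurable.
    have m11 : measurable_fun setT (fun z : ('cV[R]_d * 'cV[R]_d) * 'M[R]_(m, n) => z.1.1).
      exact: (measurableT_comp measurable_fst measurable_fst).
    have m12 : measurable_fun setT (fun z : ('cV[R]_d * 'cV[R]_d) * 'M[R]_(m, n) => z.1.2).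
      exact: (measurableT_comp measurable_snd measurable_fst).
    apply: measurable_funB.
      by apply: (measurableT_comp mV); exact: measurable_fun_pair.
    apply: measurable_funM; last by apply: (measurableT_comp mF); exact: measurable_fun_pair.
    apply: measurable_funD => //; apply: measurable_funM => //.
    have mc := bounded_lipschitz_measurable (Cb_bounded_lipschitz Cc).
    exact: (measurableT_comp mc m12).
  - by move=> z; rewrite lee_fin sqr_ge0.
  apply/eqP; rewrite eq_le; apply/andP; split; apply: ae_le_lower_integral.
  - by move=> y; apply: integral_ge0 => w _; rewrite lee_fin sqr_ge0.
  - by move=> y; apply: integral_ge0 => w _; rewrite lee_fin sqr_ge0.
  - apply: filterS2 VE FE => y e2 e3.
    by under eq_integral do rewrite /= e2 /weighted e3.
  - by move=> y; apply: integral_ge0 => w _; rewrite lee_fin sqr_ge0.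
  - by move=> y; apply: integral_ge0 => w _; rewrite lee_fin sqr_ge0.
  - apply: filterS2 VE FE => y e2 e3.
    by under [leRHS]eq_integral do rewrite /= e2 /weighted e3.
have [US mUS USE] := strongly_measurable_version smS.
have [U mU UE] := strongly_measurable_version smu.
rewrite (H _ _ mUS USE) (H _ _ mU UE); apply: ae_le_lower_integral.
- by move=> y; apply: integral_ge0 => w _; rewrite lee_fin sqr_ge0.
- by move=> y; apply: integral_ge0 => w _; rewrite lee_fin sqr_ge0.
apply: filterS UE => y uE; apply: conditional_mean_minimizes => //.
rewrite (_ : u y = fun x => U (y, x)); first exact: (measurableT_comp mU (measurable_pair1 y)).
by apply/funext => x; rewrite uE.
Qed.

End one_step.

(** * The Euler-Maruyama path and its independent increments *)

Section euler_maruyama_system.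
Context {R : realType} (d : nat).
Variables (b : 'cV[R]_d -> 'cV[R]_d) (sigma : 'cV[R]_d -> 'M[R]_d).
Hypothesis Cb_b : Cb_infty_mx b.
Hypothesis Cb_sigma : Cb_infty_mx sigma.
Context dO (Omega : measurableType dO) (P : probability Omega R).

Lemma measurable_mxB dT (T : measurableType dT) m n (f h : T -> 'M[R]_(m, n)) :
  measurable_fun setT f -> measurable_fun setT h -> measurable_fun setT (fun w => f w - h w).
Proof.
move=> mf mh; apply: measurable_fun_mx => i j.
rewrite (_ : (fun w => _) = (fun w => f w i j - h w i j)); last first.
  by apply/funext => w; rewrite !mxE.
apply: measurable_funB.
  exact: (measurableT_comp (measurable_entry i j) mf).
exact: (measurableT_comp (measurable_entry i j) mh).
Qed.

(** Adaptedness becomes measurability for the space equipped with G, so that measurable maps can be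
    composed in the induction along the path. *)
Lemma adapted_measurable dT (T : measurableType dT) (G : set (set Omega)) (f : Omega -> T) :
  sigma_algebra setT G -> (forall B, measurable B -> G (f @^-1` B)) <->
  measurable_fun [set: g_sigma_algebraType G] (f : g_sigma_algebraType G -> T).
Proof.
move=> sG; have GE : <<s G >> = G by apply: sigma_algebra_id.
split=> [fG _ B mB|mf B mB].
  by rewrite setTI; change (<<s G >> (f @^-1` B)); rewrite GE; exact: fG.
have : <<s G >> (f @^-1` B) by have := mf measurableT B mB; rewrite setTI.
by rewrite GE.
Qed.

Variables (T tau : R) (N : nat) (F : R -> set (set Omega)) (W : R -> Omega -> 'cV[R]_d).
Variables (q : 'cV[R]_d -> R) (Z : nat -> Omega -> 'cV[R]_d).
Hypothesis tau_gt0 : 0 < tau.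
Hypothesis NT : N%:R * tau <= T.
Hypothesis F_filtration : is_filtration T F.
Hypothesis W_brownian : brownian_motion P T F W.
Hypothesis Z_em : euler_maruyama P N tau b sigma q F W Z.

Lemma grid_point m : (m <= N)%N -> 0 <= m%:R * tau <= T.
Proof.
move=> mN; rewrite mulr_ge0 ?(ltW tau_gt0)//=; apply: le_trans NT.
by rewrite ler_wpM2r ?ler_nat// ltW.
Qed.

Lemma em_adapted m : (m <= N)%N -> forall B, measurable B -> F (m%:R * tau) (Z m @^-1` B).
Proof.
have [sF monF] := F_filtration.
elim: m => [_|m IH mN] B mB; first by rewrite mul0r; exact: (em_init_adapted Z_em).
have /andP[t10 t1T] := grid_point mN; have /andP[t00 t0T] := grid_point (ltnW mN).
have sub : F (m%:R * tau) `<=` F (m.+1%:R * tau).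
  by apply: monF => //; rewrite ler_wpM2r ?ler_nat ?leqnSn// ltW.
have [sG _] := sF _ (grid_point mN).
have mW0 := (adapted_measurable (W (m%:R * tau)) sG).1
  (fun B mB => sub _ (bm_adapted W_brownian (grid_point (ltnW mN)) mB)).
have mW1 := (adapted_measurable (W (m.+1%:R * tau)) sG).1
  (fun B mB => bm_adapted W_brownian (grid_point mN) mB).
have mZ := (adapted_measurable (Z m) sG).1 (fun B mB => sub _ (IH (ltnW mN) B mB)).
move: B mB; apply: (adapted_measurable (Z m.+1) sG).2.
rewrite (_ : Z m.+1 = fun w => em_map b sigma tau (Z m w)
    (W (m.+1%:R * tau) w - W (m%:R * tau) w)); last first.
  by apply/funext => w; rewrite (em_step Z_em).
exact: (measurableT_comp (measurable_em_map Cb_b Cb_sigma tau)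
  (measurable_fun_pair mZ (measurable_mxB mW1 mW0))).
Qed.

Lemma em_system : exists Zf Df : nat -> {mfun Omega >-> 'cV[R]_d},
  (forall m, (m <= N)%N -> Zf m = Z m :> (Omega -> _)) /\
  forall m, (m < N)%N ->
    [/\ (forall w, Zf m.+1 w = em_map b sigma tau (Zf m w) (Df m w)),
        (forall A B, measurable A -> measurable B ->
           P (Zf m @^-1` A `&` Df m @^-1` B) = (P (Zf m @^-1` A) * P (Df m @^-1` B))%E) &
        gaussian_law tau (distribution P (Df m))].
Proof.
have [sF monF] := F_filtration.
have Fm t : 0 <= t <= T -> F t `<=` measurable by move=> t0T; have [_] := sF t t0T.
have mZ m : (m <= N)%N -> measurable_fun setT (Z m).
  by move=> mN _ B mB; rewrite setTI; apply: (Fm _ (grid_point mN)); exact: em_adapted.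
have mW m : (m <= N)%N -> measurable_fun setT (W (m%:R * tau)).
  move=> mN _ B mB; rewrite setTI; apply: (Fm _ (grid_point mN)).
  exact: (bm_adapted W_brownian (grid_point mN)).
have mz : measurable_fun setT (fun _ : Omega => 0 : 'cV[R]_d) by exact: measurable_cst.
(* A default for indices beyond the grid, where nothing is known about Z or the increments. *)
pose z0 : {mfun Omega >-> 'cV[R]_d} := HB.pack (fun _ : Omega => 0 : 'cV[R]_d)
  (isMeasurableFun.Build _ _ _ _ _ mz).
have /choice[Zf ZfE] : forall m, exists f : {mfun Omega >-> 'cV[R]_d},
    (m <= N)%N -> f = Z m :> (Omega -> _).
  move=> m; have [mN|_] := leqP m N; last by exists z0.
  pose f : {mfun Omega >-> 'cV[R]_d} := HB.pack (Z m)
    (isMeasurableFun.Build _ _ _ _ _ (mZ m mN)).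
  by exists f.
pose dW m w := W (m.+1%:R * tau) w - W (m%:R * tau) w.
have /choice[Df DfE] : forall m, exists f : {mfun Omega >-> 'cV[R]_d},
    (m < N)%N -> f = dW m :> (Omega -> _).
  move=> m; have [mN|_] := ltnP m N; last by exists z0.
  pose f : {mfun Omega >-> 'cV[R]_d} := HB.pack (dW m)
    (isMeasurableFun.Build _ _ _ _ _ (measurable_mxB (mW _ mN) (mW _ (ltnW mN)))).
  by exists f.
exists Zf, Df; split => // m mN.
have /andP[t10 t1T] := grid_point mN; have /andP[t00 t0T] := grid_point (ltnW mN).
have lt01 : m%:R * tau < m.+1%:R * tau by rewrite ltr_pM2r// ltr_nat.
split.
- by move=> w; rewrite !ZfE ?(ltnW mN)// DfE// (em_step Z_em).
- move=> A B mA mB; rewrite ZfE ?(ltnW mN)// DfE//.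
  by apply: (bm_independent W_brownian) => //; apply: em_adapted => //; exact: ltnW.
move=> B mB; have := bm_gaussian W_brownian t00 lt01 t1T mB.
rewrite -mulrBl -natrB// subSnn mul1r => <-.
transitivity (P (Df m @^-1` cV_rectangle B)); first by [].
by rewrite DfE//; congr (P _); apply/seteqP; split => w H i; exact: (H i).
Qed.

End euler_maruyama_system.

(** * The likelihood as a function of observation and state *)

Section likelihood.
Context {R : realType} (d d' : nat) (L : 'cV[R]_d' -> 'cV[R]_d -> R).
Local Notation Lj := (fun z : 'cV[R]_(d' + d) => L (usubmx z) (dsubmx z)).

Lemma likelihoodE y x : L y x = Lj (col_mx y x).
Proof. by rewrite /= col_mxKu col_mxKd. Qed.

Lemma partial_col_mx (G : 'cV[R]_(d' + d) -> R) y j x :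
  partial j (fun z => G (col_mx y z)) x = partial (rshift d' j) G (col_mx y x).
Proof.
rewrite /partial /derive; set f1 := (fun h : R => _); set f2 := (X in _ = lim (X @ _)).
suff -> : f1 = f2 by []. apply/funext => h; rewrite /f1 /f2 /=.
congr (_ *: (G _ - _)); apply/colP => i; rewrite !mxE.
case: splitP => k ik; last first.
  rewrite !mxE; have -> : (i == rshift d' j) = (k == j); last by [].
  apply/eqP/eqP => [iE|kj]; apply/val_inj; last by rewrite /= ik kj.
  by apply/eqP; rewrite -(eqn_add2l d') -ik iE.
rewrite (_ : (i == _) = false) ?mulr0 ?add0r//.
by apply/eqP => iE; have := ltn_ord k; rewrite -ik iE/= ltnNge leq_addr.
Qed.

Lemma iter_partial_col_mx (G : 'cV[R]_(d' + d) -> R) y s :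
  iter_partial s (fun z => G (col_mx y z)) =
  fun x => iter_partial (map (@rshift d' d) s) G (col_mx y x).
Proof. by elim: s => //= j s ->; apply/funext => x; rewrite partial_col_mx. Qed.

Hypothesis CL : Cb_infty Lj.

Lemma smooth_likelihood y : smooth (L y).
Proof.
rewrite (_ : L y = fun x => Lj (col_mx y x)); last by apply/funext => x; exact: likelihoodE.
apply: (smooth_chain (phi := col_mx y) (f := Lj)); last exact: Cb_smooth.
move=> l; rewrite (_ : (fun x => _) = fun x : 'cV[R]_d =>
    match fintype.split l with inl i => y i ord0 | inr i => x i ord0 end); last first.
  by apply/funext => x; rewrite mxE.
by case: (fintype.split l) => i; [exact: smooth_cst|exact: smooth_coord].
Qed.

(** Derivatives in the state are derivatives of the joint function in its last d coordinates. The
    bound is uniform in the observation, as the final constant has to be. *)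
Lemma likelihood_jet k : exists2 M : R, 1 <= M & forall y s x, (size s <= k)%N ->
  `|iter_partial s (L y) x| <= M.
Proof.
have [M M0 LM] := Cb_jet_bound k CL; exists (1 + M); first by rewrite lerDl.
move=> y s x sk; rewrite (_ : L y = fun x => Lj (col_mx y x)); last first.
  by apply/funext => z; exact: likelihoodE.
rewrite (iter_partial_col_mx Lj); apply: (le_trans (LM _ _ _)); first by rewrite size_map.
by rewrite lerDr.
Qed.

Lemma likelihood_lipschitz : exists2 B : R, 0 <= B &
  (forall y x, `|L y x| <= B) /\ forall y y' x, `|L y x - L y' x| <= B * norm1 (y - y').
Proof.
have [B B0 [LB LL]] := Cb_bounded_lipschitz CL; exists B => //; split => [y x|y y' x].
  by rewrite likelihoodE.
rewrite (likelihoodE y) (likelihoodE y'); apply: (le_trans (LL _ _)); rewrite ler_wpM2l//.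
rewrite /norm1 big_split_ord/= [X in _ + X]big1 ?addr0 => [|i _].
  apply: ler_sum => i _; rewrite mxE [(- col_mx y' x) _ _]mxE !col_mxEu.
  by rewrite [(y - y') _ _]mxE [(- y') _ _]mxE.
by rewrite mxE [(- col_mx y' x) _ _]mxE !col_mxEd subrr normr0.
Qed.

End likelihood.

(** * Explicit splitting iterates and their regularity *)

Section splitting_iterates.
Context {R : realType} (d d' K : nat).
Variables (c : 'cV[R]_d -> R) (b : 'cV[R]_d -> 'cV[R]_d) (sigma : 'cV[R]_d -> 'M[R]_d).
Hypothesis Cc : Cb_infty c.
Hypothesis Cb_b : Cb_infty_mx b.
Hypothesis Cb_sigma : Cb_infty_mx sigma.
Variables (q0 : 'cV[R]_d -> R) (L : 'cV[R]_d' -> 'cV[R]_d -> R).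
Hypothesis Cq0 : Cb_infty q0.
Hypothesis CL : Cb_infty (fun z : 'cV[R]_(d' + d) => L (usubmx z) (dsubmx z)).
Variables (N : nat) (t : R) (g : nat -> probability 'cV[R]_d R).
Hypothesis t01 : 0 < t <= 1.
Hypothesis g_gaussian : forall m, (m < N)%N -> gaussian_law t (g m).
Local Notation Obs := 'M[R]_(d', K.+1).

(* the n-th step transports backwards along the law of Z_(N-n.+1), Z_(N-n) *)
Fixpoint iterates (f : 'cV[R]_d -> R) (n : nat) : 'cV[R]_d -> R :=
  if n is n'.+1 then euler_op c b sigma t (g (N - n)) (iterates f n') else f.

Fixpoint iterate_init (k : nat) (y : Obs) : 'cV[R]_d -> R :=
  if k is k'.+1 then fun x => iterates (iterate_init k' y) N x * L (obs k y) x
  else fun x => q0 x * L (obs 0 y) x.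

Definition iterate k n (y : Obs) : 'cV[R]_d -> R := iterates (iterate_init k y) n.

(** Iterates are defined on whole observation paths. Dependence on the first observations only makes
    them candidates in an optimization over functions of y_{0:k}. *)
Lemma iterate_local k n y y' : (forall j, (j <= k)%N -> obs j y = obs j y') ->
  iterate k n y = iterate k n y'.
Proof.
move=> yy'; rewrite /iterate; suff -> : iterate_init k y = iterate_init k y' by [].
elim: k yy' => [|k IH] yy' /=; first by rewrite yy'.
by rewrite yy'// IH// => j jk; rewrite yy'// ltnW.
Qed.

(** The Lipschitz constant in x may vary with y, whereas the one in y is uniform in x; the latter
    yields strong measurability with values in the continuous functions. *)
Definition parametric_lipschitz (f : Obs -> 'cV[R]_d -> R) : Prop :=
  (forall y, bounded_lipschitz (f y)) /\ exists2 B : R, 0 <= B &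
  (forall y x, `|f y x| <= B) /\ forall y y' x, `|f y x - f y' x| <= B * norm1_mx (y - y').

Lemma parametric_lipschitzM f h : parametric_lipschitz f -> parametric_lipschitz h ->
  parametric_lipschitz (fun y x => f y x * h y x).
Proof.
move=> [bf [A A0 [fA fL]]] [bh [B B0 [hB hL]]]; split => [y|].
  exact: bounded_lipschitzM.
have AB : 0 <= A * B by exact: mulr_ge0.
exists (2 * (A * B)); first by rewrite mulr_ge0.
split => [y x|y y' x].
  by rewrite normrM (le_trans (ler_pM _ _ (fA y x) (hB y x)))// mulr2n mulrDl mul1r lerDl.
have -> : f y x * h y x - f y' x * h y' x =
  f y x * (h y x - h y' x) + (f y x - f y' x) * h y' x by ring.
apply: (le_trans (ler_normD _ _)); rewrite !normrM.
have -> : 2 * (A * B) * norm1_mx (y - y') =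
  A * (B * norm1_mx (y - y')) + A * norm1_mx (y - y') * B by ring.
by apply: lerD; apply: ler_pM.
Qed.

Lemma parametric_lipschitz_likelihood k : parametric_lipschitz (fun y => L (obs k y)).
Proof.
have [M _ LM] := likelihood_jet CL 1; have [B B0 [LB LL]] := likelihood_lipschitz CL.
split => [y|]; first exact: (jet_bounded_lipschitz (smooth_likelihood CL _) (LM _)).
exists B => //; split => // y y' x; apply: (le_trans (LL _ _ _)); rewrite ler_wpM2l//.
rewrite /norm1 /norm1_mx; apply: ler_sum => i _.
by rewrite (bigD1 (inord k))//= !mxE lerDl; exact: sumr_ge0.
Qed.

Lemma parametric_lipschitz_euler m f : (m < N)%N ->
  parametric_lipschitz f -> parametric_lipschitz (fun y => euler_op c b sigma t (g m) (f y)).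
Proof.
move=> mN [bf [B B0 [fB fL]]].
split => [y|]; first exact: (euler_op_bounded_lipschitz Cc Cb_b Cb_sigma t01 (g_gaussian mN)).
have [La La0 cLa] := Cb_bounded Cc.
have C0 : 0 <= 1 + t * La by rewrite addr_ge0// mulr_ge0// ltW//; case/andP: t01.
exists ((1 + t * La) * B); first exact: mulr_ge0.
split => [y x|y y' x].
  have bl0 : bounded_lipschitz (fun=> 0 : R) (n := d).
    by exists 0 => //; split => *; rewrite ?subrr ?normr0 ?mul0r.
  have := euler_op_contract Cc Cb_b Cb_sigma (g m) t01 (bf y) bl0 cLa (e := B).
  have -> : euler_op c b sigma t (g m) (fun=> 0) = fun=> 0.
    apply/funext => z; rewrite -[RHS](mean_constant (g m)); congr mean.
    by apply/funext => w; rewrite /weighted mulr0.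
  move=> /(_ _ x); rewrite subr0; apply => z.
  by rewrite subr0.
by rewrite -mulrA; apply: (euler_op_contract Cc Cb_b Cb_sigma (g m) t01 (bf y) (bf y') cLa).
Qed.

Lemma parametric_lipschitz_iterate k n : (n <= N)%N -> parametric_lipschitz (iterate k n).
Proof.
have run f j : (j <= N)%N -> parametric_lipschitz f -> parametric_lipschitz (fun y => iterates (f y) j).
  elim: j => [//|j IH] jN pf /=; apply: parametric_lipschitz_euler; last exact: IH (ltnW jN) pf.
  by rewrite ltn_subrL (leq_ltn_trans _ jN).
move=> nN; apply: (run) => //.
elim: k => [|k IH] /=; apply: parametric_lipschitzM; try exact: parametric_lipschitz_likelihood.
  have bq := Cb_bounded_lipschitz Cq0; have [B B0 [qB _]] := bq.
  split => //; exists B => //; split => // y y' x.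
  by rewrite subrr normr0 mulr_ge0// norm1_mx_ge0.
exact: run.
Qed.

Lemma parametric_lipschitz_Linfty_C (nu : {measure set Obs -> \bar R}) f :
  parametric_lipschitz f -> Linfty_C nu f.
Proof.
move=> [bf [B B0 [fB fL]]].
have cf y : continuous (f y) by apply: bounded_lipschitz_continuous.
split => //; first exact: (lipschitz_strongly_measurable _ cf fB fL).
by exists B; exact: aeW.
Qed.

End splitting_iterates.

(** * Reduction of F_b to a potential *)

Section potential.
Context {R : realType} (d : nat).
Variables (mu : 'cV[R]_d -> 'cV[R]_d) (sigma : 'cV[R]_d -> 'M[R]_d) (b : 'cV[R]_d -> 'cV[R]_d).
Hypothesis Cb_mu : Cb_infty_mx mu.
Hypothesis Cb_sigma : Cb_infty_mx sigma.
Hypothesis bE : forall x i, b x i ord0 =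
  - mu x i ord0 + \sum_(j < d) partial j (diffusion_coef sigma i j) x.

Definition potential (x : 'cV[R]_d) : R :=
  2^-1 * (\sum_(i < d) \sum_(j < d) partial i (partial j (diffusion_coef sigma i j)) x) +
  -1 * \sum_(i < d) partial i (fun z => mu z i ord0) x.

(* for this b the first order terms of F_b cancel *)
Lemma op_F_potential phi x : op_F mu sigma b phi x = potential x * phi x.
Proof.
have -> : op_F mu sigma b phi x =
    \sum_(i < d) (\sum_(j < d) partial j (diffusion_coef sigma i j) x) * partial i phi x +
    2^-1 * ((\sum_(i < d) \sum_(j < d) partial i (partial j (diffusion_coef sigma i j)) x) * phi x) -
    (\sum_(i < d) partial i (fun z => mu z i ord0) x) * phi x -
    \sum_(i < d) mu x i ord0 * partial i phi x -
    (- (\sum_(i < d) mu x i ord0 * partial i phi x) +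
     \sum_(i < d) (\sum_(j < d) partial j (diffusion_coef sigma i j) x) * partial i phi x).
  rewrite /op_F; congr (_ + _ * _ - _ - _ - _).
  - by rewrite mulr_suml; apply: eq_bigr => i _; rewrite mulr_suml.
  - by rewrite mulr_suml.
  - by rewrite -sumrN -big_split/=; apply: eq_bigr => i _; rewrite bE mulrDl mulNr.
rewrite /potential; move: (\sum_(i < d) (\sum_(j < d) _) * _) (\sum_(i < d) \sum_(j < d) _).
by move: (\sum_(i < d) mu _ _ _ * _) (\sum_(i < d) partial _ _ _) (phi x) => *; ring.
Qed.

Lemma Cb_potential : Cb_infty potential.
Proof.
apply: CbD; apply: CbM; try exact: Cb_cst.
  apply: Cb_sum => i; apply: Cb_sum => j; do 2 apply: Cb_partial.
  exact: Cb_diffusion_coef.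
by apply: Cb_sum => i; apply: Cb_partial; exact: Cb_mu.
Qed.

Lemma Cb_drift : Cb_infty_mx b.
Proof.
move=> i j; rewrite ord1 (_ : (fun x => _) = fun x =>
    -1 * mu x i ord0 + \sum_j partial j (diffusion_coef sigma i j) x); last first.
  by apply/funext => x; rewrite bE mulN1r.
apply: CbD; first by apply: CbM; [exact: Cb_cst|exact: Cb_mu].
by apply: Cb_sum => k; apply: Cb_partial; exact: Cb_diffusion_coef.
Qed.

End potential.

(** * Identification of the minimizers *)

Section splitting_iterate.
Context {R : realType} (d d' K N : nat) (T : R).
Hypothesis T_gt0 : 0 < T.
Hypothesis K_gt0 : (0 < K)%N.
Variables (mu : 'cV[R]_d -> 'cV[R]_d) (sigma : 'cV[R]_d -> 'M[R]_d) (b : 'cV[R]_d -> 'cV[R]_d).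
Hypothesis Cb_mu : Cb_infty_mx mu.
Hypothesis Cb_sigma : Cb_infty_mx sigma.
Hypothesis bE : forall x i, b x i ord0 =
  - mu x i ord0 + \sum_(j < d) partial j (diffusion_coef sigma i j) x.
Variables (q0 : 'cV[R]_d -> R) (L : 'cV[R]_d' -> 'cV[R]_d -> R).
Hypothesis Cq0 : Cb_infty q0.
Hypothesis CL : Cb_infty (fun z : 'cV[R]_(d' + d) => L (usubmx z) (dsubmx z)).
Hypothesis N_gt0 : (0 < N)%N.
Local Notation tau := (time_step T K N).
Hypothesis tau_le1 : tau <= 1.
Context dO (Omega : measurableType dO) (P : probability Omega R).
Variables (F : R -> set (set Omega)) (W : R -> Omega -> 'cV[R]_d) (qt0 : 'cV[R]_d -> R).
Variables (Z : nat -> Omega -> 'cV[R]_d) (Y : {RV P >-> 'M[R]_(d', K.+1)}).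
Variable tpi : forall k, nat -> 'cV[R]_d -> 'M[R]_(d', k.+1) -> R.
Hypothesis F_filtration : is_filtration T F.
Hypothesis W_brownian : brownian_motion P T F W.
Hypothesis Z_em : euler_maruyama P N tau b sigma qt0 F W Z.
Hypothesis ZY : independent_path P N Z Y.
Hypothesis tpi_splitting : splitting_recursion N T mu sigma b q0 L Z Y tpi.
Local Notation nu := (distribution P Y).
Local Notation c := (potential mu sigma).

(* a path of observations that prolongs y_{0:k} *)
Let extend k (y : 'M[R]_(d', k.+1)) : 'M[R]_(d', K.+1) := \matrix_(i, j) y i (inord j).

Let obs_extend k j (y : 'M[R]_(d', K.+1)) : (k < K)%N -> (j <= k)%N ->
  obs j (extend (obs_upto k y)) = obs j y.
Proof.
move=> kK jk; have jK : (j < K.+1)%N by rewrite ltnS (leq_trans jk)// ltnW.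
apply/colP => i; rewrite !mxE; congr (y i _); apply/val_inj.
by rewrite /= !inordK// ?ltnS// ?inordK// (leq_trans jk)// ltnW.
Qed.

(** By induction the previous iterate is almost everywhere the explicit one. The next explicit
    iterate is admissible and its loss is at most that of the given minimizer, hence equal to it,
    and the uniqueness part of [is_argmin] identifies the two. *)
Lemma splitting_iterate : exists g : nat -> probability 'cV[R]_d R,
  (forall m, (m < N)%N -> gaussian_law tau (g m)) /\
  forall k n, grid_index K N (k, n) ->
    {ae nu, forall y, forall x,
      tpi n x (obs_upto k y) = iterate c b sigma q0 L N tau g k n y x}.
Proof.
have Cc := Cb_potential Cb_mu Cb_sigma; have Cb_b := Cb_drift Cb_mu Cb_sigma bE.
have tau0 : 0 < tau by exact: time_step_gt0.
have t01 : 0 < tau <= 1 by rewrite tau0.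
have [Zf [Df [ZfE ZDf]]] := em_system Cb_b Cb_sigma tau0
  (N_time_step T_gt0 K_gt0 N_gt0) F_filtration W_brownian Z_em.
exists (fun m => distribution P (Df m)); split; first by move=> m mN; have [] := ZDf m mN.
set g := fun m => _; have gg m : (m < N)%N -> gaussian_law tau (g m).
  by move=> mN; have [] := ZDf m mN.
pose I k n := iterate c b sigma q0 L N tau g k n : 'M[R]_(d', K.+1) -> 'cV[R]_d -> R.
have step k n : (k < K)%N -> (n < N)%N ->
    {ae nu, forall y, forall x, tpi n x (obs_upto k y) = I k n y x} ->
    {ae nu, forall y, forall x, tpi n.+1 x (obs_upto k y) = I k n.+1 y x}.
  move=> kK nN tpiE; have [tpi_space tpi_min tpi_uniq] := ds_step tpi_splitting kK nN.
  pose u x (y : 'M[R]_(d', k.+1)) := I k n.+1 (extend y) x.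
  have uE y x : u x (obs_upto k y) = I k n.+1 y x.
    by congr (_ x); apply: iterate_local => j jk; exact: obs_extend.
  have plI j : (j <= N)%N -> parametric_lipschitz (I k j).
    exact: parametric_lipschitz_iterate.
  have u_space : splitting_space Y u.
    rewrite /splitting_space /= (_ : (fun y x => _) = I k n.+1).
      exact: parametric_lipschitz_Linfty_C (plI _ nN).
    by apply/funext => y; apply/funext => x; exact: uE.
  pose m := (N - n.+1)%N.
  have mN : (m < N)%N by rewrite ltn_subrL (leq_ltn_trans _ nN).
  have m1 : (N - n)%N = m.+1 by rewrite /m -subSn// subSS.
  have [XE XD XG] := ZDf m mN.
  have XY A A' B : measurable A -> measurable A' -> measurable B ->
      P ((Zf m @^-1` A `&` Zf m.+1 @^-1` A') `&` Y @^-1` B) =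
      (P (Zf m @^-1` A `&` Zf m.+1 @^-1` A') * P (Y @^-1` B))%E.
    move=> mA mA' mB.
    (* An event about two consecutive times is a rectangle of paths whose other factors are
       trivial. *)
    have := ZY (A := fun i => if i == m then A else if i == m.+1 then A' else setT) _ mB.
    rewrite (_ : [set w | _] = Zf m @^-1` A `&` Zf m.+1 @^-1` A').
      by apply => i; case: ifP => // _; case: ifP.
    rewrite !ZfE//; last exact: ltnW.
    apply/seteqP; split => [w H|w [H1 H2] i _].
      split; first by have := H m (ltnW mN); rewrite eqxx.
      by have := H m.+1 mN; rewrite eqxx gtn_eqF.
    by case: eqP => [->//|_]; case: eqP => [->|].
  have le : (splitting_loss N T mu sigma b Z Y n (tpi n) u <=
      splitting_loss N T mu sigma b Z Y n (tpi n) (tpi (k := k) n.+1))%E.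
    have GE phi : op_G mu sigma b tau phi = weighted c tau phi.
      by apply/funext => x; rewrite /op_G op_F_potential// /weighted [RHS]mulrDl mul1r -[in RHS]mulrA.
    have lossE v : splitting_loss N T mu sigma b Z Y n (tpi (k := k) n) v =
        (\int[P]_w (`|v (Zf m w) (obs_upto k (Y w)) -
           weighted c tau (fun x => tpi n x (obs_upto k (Y w))) (Zf m.+1 w)| ^+ 2)%:E)%E.
      by rewrite /splitting_loss unlock m1 -/m !ZfE ?(ltnW mN)//; under eq_integral do rewrite GE.
    rewrite !lossE; under eq_integral do rewrite uE.
    have [_ smI _] := parametric_lipschitz_Linfty_C nu (plI _ (ltnW nN)).
    have [_ smS _] := parametric_lipschitz_Linfty_C nu (plI _ nN).
    have [_ smt _] := tpi_space.
    exact: (euler_op_minimizes Cc Cb_b Cb_sigma XE XD t01 XG XY (plI _ (ltnW nN)).1 smI smS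
      tpiE smt).
  have uJ : splitting_loss N T mu sigma b Z Y n (tpi n) u =
      splitting_loss N T mu sigma b Z Y n (tpi n) (tpi (k := k) n.+1).
    by apply/eqP; rewrite eq_le le/=; exact: tpi_min.
  have := tpi_uniq u u_space uJ; apply: filterS => y H x.
  by rewrite -H uE.
have row k : (k < K)%N -> {ae nu, forall y, forall x, tpi 0 x (obs_upto k y) = I k 0%N y x} ->
    forall n, (n <= N)%N -> {ae nu, forall y, forall x, tpi n x (obs_upto k y) = I k n y x}.
  move=> kK H0; elim=> [//|n IH] nN; apply: step => //; exact: IH (ltnW nN).
have start k : (k <= K)%N -> {ae nu, forall y, forall x, tpi 0 x (obs_upto k y) = I k 0%N y x}.
  elim: k => [_|k IH kK].
    by apply: filterS (msupport_ae nu) => y Sy x; rewrite (ds_init tpi_splitting).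
  apply: filterS2 (msupport_ae nu) (row k kK (IH (ltnW kK)) N (leqnn N)) => y Sy H x.
  by rewrite (ds_update tpi_splitting)// H.
move=> k n [/= [kK nN]|[-> ->]]; last exact: start.
by apply: row => //; apply: start; exact: ltnW.
Qed.

End splitting_iterate.

Theorem corollary2p1 (R : realType) (d d' K : nat) (T : R)
  (mu : 'cV[R]_d -> 'cV[R]_d) (sigma : 'cV[R]_d -> 'M[R]_d)
  (q0 : 'cV[R]_d -> R) (L : 'cV[R]_d' -> 'cV[R]_d -> R)
  (b : 'cV[R]_d -> 'cV[R]_d) :
  (0 < d)%N -> (0 < d')%N -> (0 < K)%N -> 0 < T ->
  Cb_infty_mx mu -> Cb_infty_mx sigma ->
  Cb_infty q0 -> is_density q0 ->
  Cb_infty (fun z : 'cV[R]_(d' + d) => L (usubmx z) (dsubmx z)) ->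
  (forall x, is_density (L ^~ x)) ->
  parabolic_hoermander mu sigma ->
  (forall x i, b x i ord0 =
     - mu x i ord0 +
     \sum_(j < d) partial j (diffusion_coef sigma i j) x) ->
  exists C : R, 0 < C /\
    forall N : nat, (0 < N)%N -> time_step T K N <= 1 ->
    forall (dO : measure_display) (Omega : measurableType dO)
      (P : probability Omega R) (F : R -> set (set Omega))
      (W : R -> Omega -> 'cV[R]_d) (qt0 : 'cV[R]_d -> R)
      (Z : nat -> Omega -> 'cV[R]_d) (Y : {RV P >-> 'M[R]_(d', K.+1)})
      (p : forall k, R -> 'cV[R]_d -> 'M[R]_(d', k.+1) -> R)
      (tpi : forall k, nat -> 'cV[R]_d -> 'M[R]_(d', k.+1) -> R),
    is_filtration T F -> brownian_motion P T F W ->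
    is_density qt0 -> finite_moments qt0 ->
    euler_maruyama P N (time_step T K N) b sigma qt0 F W Z ->
    (exists M : R, {ae P, forall w, `|Y w| <= M}) ->
    independent_path P N Z Y ->
    fokker_planck_recursion T mu sigma b q0 L
      (msupport (distribution P Y)) p ->
    splitting_recursion N T mu sigma b q0 L Z Y tpi ->
    (ereal_sup
       [set Linfty_norm (distribution P Y) (fun y x =>
              (p kn.1 (grid_time T K N kn.1 kn.2) x (obs_upto kn.1 y) -
               tpi kn.1 kn.2 x (obs_upto kn.1 y))%R)
        | kn in grid_index K N] <= (C * time_step T K N)%:E)%E.
Proof.
move=> d_gt0 _ K_gt0 T_gt0 Cmu Csigma Cq0 _ CL _ _ bE.
pose c := potential mu sigma.
have Cc : Cb_infty c by exact: Cb_potential.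
have Cb_b : Cb_infty_mx b by exact: Cb_drift.
have [La La1 LaP] := coef_bound Cc Cb_b Csigma.
have La0 : 0 <= La by apply: le_trans La1.
have [CS CS0 CSP] := euler_op_consistent Cc Cb_b Csigma.
have [ML ML1 MLP] := likelihood_jet CL 4.
have [Mq Mq0 MqP] := Cb_jet_bound 4 Cq0.
have ML0 : 0 <= ML by apply: le_trans ML1.
have M00 : 0 <= 2 ^+ 4 * (Mq * ML) by rewrite mulr_ge0// mulr_ge0.
(* The constant is fixed here, before N, the probability space and the observations. *)
have [C C0 CP] := scheme_error d_gt0 Cc Cb_b Csigma T_gt0 K_gt0 La0 CS0 ML1 M00.
exists C; split => // N N0 tau1 dO Omega P F W qt0 Z Y p tpi FF WB _ _ ZE _ ZY pFP tS.
have [g [gg tpiE]] := splitting_iterate T_gt0 K_gt0 Cmu Csigma bE Cq0 CL N0 tau1 FF WB ZE ZY tS.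
have tau0 : 0 < time_step T K N by exact: time_step_gt0.
have t01 : 0 < time_step T K N <= 1 by rewrite tau0.
(* The estimate holds for every y in the support when stated for the explicit iterates; the given
   minimizers agree with these only for almost every y. *)
have err k n y : grid_index K N (k, n) -> msupport (distribution P Y) y -> forall x,
    `|p k (grid_time T K N k n) x (obs_upto k y) -
      iterate c b sigma q0 L N (time_step T K N) g k n y x| <= C * time_step T K N.
  move=> kn Sy; have sL j : smooth (L j) by exact: (smooth_likelihood CL).
  have genE k' s z : op_A sigma b (fun z => p k' s z (obs_upto k' y)) z +
      op_F mu sigma b (fun z => p k' s z (obs_upto k' y)) z =
      gen c b sigma (fun z => p k' s z (obs_upto k' y)) z.
    by rewrite (op_F_potential bE) addrC.
  apply: (CP N (fun x => q0 x * L (obs 0 y) x) (fun k => L (obs k y))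
    (fun k n => iterate c b sigma q0 L N (time_step T K N) g k n y)
    (fun k t x => p k t x (obs_upto k y))) => //.
  - by apply: smoothM => //; exact: Cb_smooth.
  - by apply: iter_partialM_le => //; [exact: Cb_smooth|exact: MLP].
  - by move=> j s z; exact: MLP.
  - move=> k' n' h M e kK nN sh jh he x.
    have mN : (N - n'.+1 < N)%N by rewrite ltn_subrL (leq_ltn_trans _ nN).
    have bh : bounded_lipschitz h.
      by apply: (jet_bounded_lipschitz (M := M)) => // s z s1; apply: jh; exact: leq_trans s1 _.
    have [bi _] := parametric_lipschitz_iterate K Cc Cb_b Csigma Cq0 CL t01 gg k' (ltnW nN).
    have LaC z : `|c z| <= La by have [] := LaP z.
    (* Stability carries over the distance of the iterate from h, and consistency adds the local
       error of the step applied to h. *)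
    have := euler_op_contract Cc Cb_b Csigma (g (N - n'.+1)%N) t01 (bi y) bh LaC he x.
    have := CSP _ _ _ _ x t01 (gg _ mN) bh sh jh => H2 H1.
    rewrite -(subrKA (euler_op c b sigma (time_step T K N) (g (N - n'.+1)%N) h x)).
    by apply: (le_trans (ler_normD _ _)); exact: lerD.
  - by move=> x; exact: (fp_init pFP).
  - by move=> k' x kK; exact: (fp_update pFP).
  - by move=> k' kK; exact: (fp_regular pFP).
  - move=> k' t x kK tI; rewrite (fp_equation pFP x kK Sy tI); congr (_ + _).
    by apply: eq_Rintegral => s _; exact: genE.
apply: ge_ereal_sup => _ [[k n] kn <-]; apply/ess_supP.
apply: filterS2 (msupport_ae (distribution P Y)) (tpiE k n kn) => y Sy tE.
apply/ess_supP; apply: aeW => x; rewrite lee_fin tE.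
exact: err.
Qed.
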